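(* Let $\nu>1/2$ be real, let $0<r<1$, let $\mathbb{P}^\nu_0$ be the determinantal point process on the unit disc $\mathbb{D}$ associated with the weighted Bergman kernel, and let $N_r$ be the number of its particles in $D_r=\{z\in\mathbb{C}:|z|<r\}$. Then for any $s\in(-1,1)$, $$\mathbb{E}\big((1+s)^{N_r}\big) = \prod_{j=1}^{\infty} \left(1+s(2\nu-1)\frac{(2\nu)_{j-1}}{(j-1)!}B_{r} (j, 2\nu-1)\right),$$ where the expectation is with respect to $\mathbb{P}^\nu_0$ and $$B_r(j, 2\nu-1) := \int_0^{r^2} u^{j-1}(1-u)^{2\nu-2}\, du .$$ In particular, $N_r$ has the same distribution as $\sum_{j=1}^{\infty}X_j$, where $(X_j)_{j \geq 1}$ are independent $\{0,1\}$-valued random variables defined on some probability space with probability measure $\mathbb{Q}$ such that $$\mathbb{Q}(X_j = 1) = (2\nu-1)\frac{(2\nu)_{j-1}}{(j-1)!}B_{r} (j, 2\nu-1) = \frac{B_{r} (j, 2\nu-1)}{B_{1} (j, 2\nu-1)}, \qquad j\ge 1.$$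
   Context: Notation: $\mathbb{D}=\{z\in\mathbb{C}:|z|<1\}$; $dz$ is Lebesgue measure on $\mathbb{C}\cong\mathbb{R}^2$; $\lambda_\nu(dz) := (1-|z|^2)^{2\nu-2}\,dz$ on $\mathbb{D}$; $(a)_k=a(a+1)\cdots(a+k-1)$, $(a)_0=1$, is the Pochhammer symbol; $B_1(j,2\nu-1)$ is the integral defining $B_r(j,2\nu-1)$ taken with $r=1$. Determinantal point process: a point process $\mathbb{P}$ on a locally compact Polish space $E$ (a probability measure on locally finite configurations $X\subset E$) is determinantal with correlation kernel $K$ and reference measure $\mu$ if for every $n\ge 1$ and every bounded compactly supported measurable $f:E^n\to\mathbb{C}$, $$\mathbb{E}_{\mathbb{P}}\Big[\sum_{x_1,\dots,x_n\in X} f(x_1,\dots,x_n)\Big]=\int_{E^n} f(x_1,\dots,x_n)\det(K(x_i,x_j))_{1\le i,j\le n}\,d\mu(x_1)\cdots d\mu(x_n),$$ where the sum is over $n$-tuples of pairwise distinct points of $X$. The process $\mathbb{P}^\nu_0$ is the determinantal point process on $\mathbb{D}$ with reference measure $\lambda_\nu$ and correlation kernel the weighted Bergman kernel $$G_0^{\nu}(z,w) = \frac{2\nu-1}{\pi}\,\frac{1}{(1-z\bar{w})^{2\nu}},\qquad z,w\in\mathbb{D}$$ (principal branch of the power). *)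

(* Defs.v *)
From HB Require Import structures.
From mathcomp Require Import all_boot all_order all_algebra finmap.
From mathcomp Require Import all_classical all_reals all_analysis.
From mathcomp Require Import measurable_realfun complex.

Set Implicit Arguments.
Unset Strict Implicit.
Unset Printing Implicit Defensive.

Import Order.TTheory GRing.Theory Num.Theory.
Import numFieldNormedType.Exports.

Local Open Scope classical_set_scope.
Local Open Scope complex_scope.
Local Open Scope ring_scope.

Section density.
Context d (T : measurableType d) (R : realType).
Variables (mu : {sigma_finite_measure set T -> \bar R}) (w : T -> R).
Hypotheses (mw : measurable_fun [set: T] w) (w0 : forall x, 0 <= w x).

(* The proofs are arguments so that the measure structure can be inferred. *)
Definition density of measurable_fun [set: T] w & (forall x, 0 <= w x) :
  set T -> \bar R := fun A => (\int[mu]_(x in A) (w x)%:E)%E.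

Let density0 : density mw w0 set0 = 0%E.
Proof. by rewrite /density integral_set0. Qed.

Let density_ge0 A : (0 <= density mw w0 A)%E.
Proof. by apply: integral_ge0 => x _; rewrite lee_fin. Qed.

Let density_sigma_additive : semi_sigma_additive (density mw w0).
Proof.
apply: semi_sigma_additive_nng_induced; first exact/measurable_EFinP.
by move=> x; rewrite lee_fin.
Qed.

HB.instance Definition _ := isMeasure.Build _ _ _ (density mw w0)
  density0 density_ge0 density_sigma_additive.

Let density_sigma_finite : sigma_finite [set: T] (density mw w0).
Proof.
have /sigma_finiteP[F [TF ndF Foo]] := sigma_finiteT mu.
have mle k : measurable [set x | w x <= k%:R].
  rewrite -[X in measurable X]setTI.
  rewrite (_ : [set x | _] = w @^-1` `]-oo, k%:R]).
    by apply: mw => //; exact: measurable_itv.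
  by apply/seteqP; split=> x /=; rewrite in_itv.
exists (fun k => F k `&` [set x | w x <= k%:R]).
  apply/esym/seteqP; split=> // x _.
  have [n _ Fnx] : (\bigcup_k F k) x by rewrite -TF.
  have [m wm] : exists m : nat, w x <= m%:R.
    by exists (Num.Def.archi_bound (w x)); rewrite ltW// archi_boundP.
  exists (maxn n m) => //; split=> /=.
    by move: x Fnx {wm}; exact/subsetPset/ndF/leq_maxl.
  by rewrite (le_trans wm)// ler_nat leq_maxr.
move=> k; have [mF Fk] := Foo k; split; first exact: measurableI.
have mFk : measurable (F k `&` [set x | w x <= k%:R]) by exact: measurableI.
set G := F k `&` _ in mFk *.
have le_int : (density mw w0 G <= \int[mu]_(x in G) (cst k%:R%:E x))%E.
  apply: ge0_le_integral => //.
  - by move=> x _; rewrite lee_fin.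
  - by apply/measurable_EFinP; exact: measurable_funS mw.
  - by move=> x [_ /=]; rewrite lee_fin.
apply: (le_lt_trans le_int).
rewrite integral_cst//= lte_mul_pinfty ?lee_fin//.
by apply: le_lt_trans Fk; apply: le_measure; rewrite ?inE//; exact: subIsetl.
Qed.

HB.instance Definition _ := Measure_isSigmaFinite.Build _ _ _ (density mw w0)
  density_sigma_finite.

End density.
Arguments density {d T R} mu {w}.

(* The library registers this instance for subprobabilities only. *)
Lemma sigma_finite_product d1 d2 (T1 : measurableType d1)
    (T2 : measurableType d2) (R : realType)
    (m1 : {sigma_finite_measure set T1 -> \bar R})
    (m2 : {sigma_finite_measure set T2 -> \bar R}) :
  sigma_finite [set: T1 * T2] (m1 \x m2)%E.
Proof.
have /sigma_finiteP[F [TF ndF Foo]] := sigma_finiteT m1.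
have /sigma_finiteP[G [TG ndG Goo]] := sigma_finiteT m2.
exists (fun n => F n `*` G n).
  rewrite -setXTT TF TG predeqE => -[x y]; split.
    move=> [/= [n _ Fnx] [k _ Gky]]; exists (maxn n k) => //; split.
    - by move: x Fnx; exact/subsetPset/ndF/leq_maxl.
    - by move: y Gky; exact/subsetPset/ndG/leq_maxr.
  by move=> [n _ []/= ? ?]; split; exists n.
move=> k; have [? ?] := Foo k; have [? ?] := Goo k.
split; first exact: measurableX.
by rewrite product_measure1E// lte_mul_pinfty// ge0_fin_numE.
Qed.

Section tuple_measure.
Context d (T : measurableType d) (R : realType).
Variable mu : {sigma_finite_measure set T -> \bar R}.

Definition tuple_consp n (p : T * n.-tuple T) : n.+1.-tuple T :=
  [the n.+1.-tuple T of p.1 :: p.2].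

Lemma measurable_tuple_consp n :
  measurable_fun [set: T * n.-tuple T] (@tuple_consp n).
Proof. exact: measurable_cons. Qed.

Definition cons_measure n (m : {sigma_finite_measure set (n.-tuple T) -> \bar R})
    : set (n.+1.-tuple T) -> \bar R :=
  pushforward (mu \x m)%E (@tuple_consp n).

Section instances.
Variables (n : nat) (m : {sigma_finite_measure set (n.-tuple T) -> \bar R}).

Let cons_measure0 : cons_measure m set0 = 0%E.
Proof. by rewrite /cons_measure /pushforward preimage_set0 measure0. Qed.

Let cons_measure_ge0 A : (0 <= cons_measure m A)%E.
Proof. exact: integral_ge0. Qed.

Let cons_measure_sigma_additive : semi_sigma_additive (cons_measure m).
Proof.
move=> F mF tF mUF; rewrite /cons_measure /pushforward preimage_bigcup.
have mpre A : measurable A -> measurable (@tuple_consp n @^-1` A).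
  move=> mA; rewrite -[X in measurable X]setTI.
  exact: measurable_tuple_consp.
apply: measure_semi_sigma_additive => [i||].
- exact: mpre.
- apply/trivIsetP => /= i j _ _ ij; rewrite -preimage_setI.
  by move/trivIsetP : tF => /(_ _ _ _ _ ij) ->//; rewrite preimage_set0.
- by rewrite -preimage_bigcup; exact: mpre.
Qed.

HB.instance Definition _ := isMeasure.Build _ _ _ (cons_measure m)
  cons_measure0 cons_measure_ge0 cons_measure_sigma_additive.

Let cons_measure_sigma_finite :
  sigma_finite [set: n.+1.-tuple T] (cons_measure m).
Proof.
have [F TF Foo] := sigma_finite_product mu m.
pose g (t : n.+1.-tuple T) : T * n.-tuple T :=
  (thead t, [tuple of behead t]).
have mg : measurable_fun [set: n.+1.-tuple T] g.
  apply/measurable_fun_pair; first exact: measurable_tnth.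
  exact: measurable_behead.
have gK p : g (tuple_consp p) = p.
  by case: p => x t; congr pair; apply/val_inj.
exists (fun k => g @^-1` F k).
  by rewrite -preimage_bigcup -TF preimage_setT.
move=> k; have [mF Fk] := Foo k; split.
  by rewrite -[X in measurable X]setTI; exact: mg.
rewrite /cons_measure /pushforward -comp_preimage.
by rewrite (_ : g \o _ = id) ?preimage_id//; apply/funext => p /=.
Qed.

HB.instance Definition _ := Measure_isSigmaFinite.Build _ _ _ (cons_measure m)
  cons_measure_sigma_finite.

End instances.

Fixpoint tuple_measure n : {sigma_finite_measure set (n.-tuple T) -> \bar R} :=
  match n with
  | 0 => \d_([tuple] : 0.-tuple T)
  | n'.+1 => cons_measure (tuple_measure n')
  end.

End tuple_measure.

Section complex.
Context (R : realType).
Local Notation C := R[i].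

Definition abs (z : C) : R := Normc.normc z.

(* Principal argument, in ]-pi, pi]; irrelevant value at z = 0. *)
Definition carg (z : C) : R :=
  if 0 <= complex.Im z then acos (complex.Re z / abs z)
  else - acos (complex.Re z / abs z).

(* Principal branch of z ^ a for z != 0. *)
Definition cpow (z : C) (a : R) : C :=
  (abs z `^ a)%:C * (cos (a * carg z) +i* sin (a * carg z)).

Context d (T : measurableType d).

Definition cmeasurable (D : set T) (f : T -> C) : Prop :=
  measurable_fun D (fun x => complex.Re (f x)) /\
  measurable_fun D (fun x => complex.Im (f x)).

Definition cintegrable (mu : {measure set T -> \bar R}) (D : set T)
    (f : T -> C) : Prop :=
  mu.-integrable D (fun x => (complex.Re (f x))%:E) /\
  mu.-integrable D (fun x => (complex.Im (f x))%:E).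

Definition cintegral (mu : {measure set T -> \bar R}) (D : set T)
    (f : T -> C) : C :=
  (\int[mu]_(x in D) complex.Re (f x)) +i* (\int[mu]_(x in D) complex.Im (f x)).

End complex.

Section plane_lebesgue.
Context (R : realType).
Local Notation plane := (R * R)%type.

Definition plane_lebesgue : set plane -> \bar R :=
  (@lebesgue_measure R \x @lebesgue_measure R)%E.

(* lebesgue_measure lives on measurableTypeR R, whose measurable sets are those
   of R up to conversion. *)
Let plane_lebesgue0 : plane_lebesgue set0 = 0%E.
Proof. exact: (@measure0 _ _ _ (@lebesgue_measure R \x @lebesgue_measure R)%E). Qed.

Let plane_lebesgue_ge0 A : (0 <= plane_lebesgue A)%E.
Proof. exact: (@measure_ge0 _ _ _ (@lebesgue_measure R \x @lebesgue_measure R)%E). Qed.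

Let plane_lebesgue_sigma_additive : semi_sigma_additive plane_lebesgue.
Proof.
exact: (@measure_semi_sigma_additive _ _ _
  (@lebesgue_measure R \x @lebesgue_measure R)%E).
Qed.

HB.instance Definition _ := isMeasure.Build _ _ _ plane_lebesgue
  plane_lebesgue0 plane_lebesgue_ge0 plane_lebesgue_sigma_additive.

Let plane_lebesgue_sigma_finite : sigma_finite [set: plane] plane_lebesgue.
Proof.
exact: (sigma_finite_product (@lebesgue_measure R) (@lebesgue_measure R)).
Qed.

HB.instance Definition _ := Measure_isSigmaFinite.Build _ _ _ plane_lebesgue
  plane_lebesgue_sigma_finite.

End plane_lebesgue.
Arguments plane_lebesgue : clear implicits.

Section plane.
Context (R : realType).
Local Notation plane := (R * R)%type.
Local Notation C := R[i].

(* The plane R * R carries the measure theory; cplx identifies it with R[i]. *)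
Definition cplx (z : plane) : C := z.1 +i* z.2.

(* Compactness does not depend on whether it is taken in E or in the plane. *)
Record config (E : set plane) := Config {
  config_set :> set plane ;
  config_sub : config_set `<=` E ;
  config_locally_finite : forall Q, compact Q -> Q `<=` E ->
    finite_set (config_set `&` Q) }.

Definition empty_config (E : set plane) : config E.
Proof.
by exists set0 => [|Q _ _]; [exact: sub0set|rewrite set0I; exact: finite_set0].
Defined.

HB.instance Definition _ E := gen_eqMixin (config E).
HB.instance Definition _ E := gen_choiceMixin (config E).
HB.instance Definition _ E := isPointed.Build (config E) (empty_config E).

(* Number of points of X in A; only meaningful when X `&` A is finite, e.g.
   when A is relatively compact in E. *)
Definition npoints (E : set plane) (A : set plane) (X : config E) : nat :=
  #|` fset_set (X `&` A) |.

Definition relatively_compact (E A : set plane) : Prop :=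
  exists Q, [/\ compact Q, Q `<=` E & A `<=` Q].

Definition counting_events (E : set plane) : set (set (config E)) :=
  [set S | exists (A : set plane) (k : nat),
    [/\ measurable A, relatively_compact E A &
        S = [set X | npoints A X = k]]].
Arguments counting_events : clear implicits.

Definition config_space (E : set plane) : measurableType _ :=
  g_sigma_algebraType (counting_events E).

(* Bounded measurable functions on E^n with compact support, extended by zero
   to (R * R)^n. A compact subset of E^n is contained in some Q^n with Q a
   compact subset of E. *)
Definition test_function (E : set plane) n (f : n.-tuple plane -> C) : Prop :=
  [/\ cmeasurable [set: n.-tuple plane] f,
      exists M : R, forall x, abs (f x) <= M &
      exists Q, [/\ compact Q, Q `<=` E &
        forall x, f x != 0 -> forall i, Q (tnth x i)]].

(* Sum of f over the n-tuples of pairwise distinct points of X; it has finitely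
   many nonzero terms when f is a test function. *)
Definition multi_sum (E : set plane) n (f : n.-tuple plane -> C)
    (X : config E) : C :=
  \sum_(x \in [set x : n.-tuple plane |
              uniq x /\ forall i, config_set X (tnth x i)]) f x.

(* mu is a measure on the whole plane, used on E only. The integrability
   clause says that the expectation on the left-hand side makes sense:
   cintegral is 0 by convention on parts with an infinite integral. *)
Definition is_determinantal (E : set plane)
    (mu : {sigma_finite_measure set plane -> \bar R})
    (K : plane -> plane -> C) (P : probability (config_space E) R) : Prop :=
  forall n (f : n.-tuple plane -> C), (0 < n)%N -> test_function E f ->
    cintegrable P [set: config_space E] (multi_sum f) /\
    cintegral P [set: config_space E] (multi_sum f) =
    cintegral (tuple_measure mu n)
      [set x : n.-tuple plane | forall i, E (tnth x i)]
      (fun x => f x * \det (\matrix_(i < n, j < n) K (tnth x i) (tnth x j))).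

Definition disc (r : R) : set plane := [set z | abs (cplx z) < r].

Definition bergman_weight (nu : R) : plane -> R :=
  (fun z => (1 - abs (cplx z) ^+ 2) `^ (2 * nu - 2)) \_ (disc 1).

Lemma measurable_abs_cplx : measurable_fun [set: plane] (fun z => abs (cplx z)).
Proof.
apply: (measurableT_comp (continuous_measurable_fun (@sqrt_continuous R))).
by apply: measurable_funD; apply: measurable_funX.
Qed.

Lemma measurable_disc r : measurable (disc r).
Proof.
rewrite -[X in measurable X]setTI.
rewrite (_ : disc r = (fun z => abs (cplx z)) @^-1` `]-oo, r[).
  by apply: measurable_abs_cplx => //; exact: measurable_itv.
by apply/seteqP; split=> z /=; rewrite in_itv.
Qed.

Lemma measurable_bergman_weight nu :
  measurable_fun [set: plane] (bergman_weight nu).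
Proof.
apply/(measurable_restrictT _ (measurable_disc 1)); apply: measurable_funTS.
apply: (measurableT_comp (measurable_powR _)).
apply: measurable_funB => //; apply: measurable_funX.
exact: measurable_abs_cplx.
Qed.

Lemma bergman_weight_ge0 nu z : 0 <= bergman_weight nu z.
Proof. by rewrite /bergman_weight patchE; case: ifP => // _; exact: powR_ge0. Qed.

(* (1 - |z|^2)^(2 nu - 2) dz on the unit disc, extended by zero. *)
Definition bergman_measure (nu : R) :
    {sigma_finite_measure set plane -> \bar R} :=
  density (plane_lebesgue R) (measurable_bergman_weight nu) (bergman_weight_ge0 nu).

Definition bergman_kernel (nu : R) (z w : plane) : C :=
  ((2 * nu - 1) / pi)%:C *
  (cpow (1 - cplx z * conjc (cplx w)) (2 * nu))^-1.

(* The rising factorial a (a + 1) ... (a + k - 1). *)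
Definition pochhammer (a : R) (k : nat) : R := \prod_(i < k) (a + i%:R).

(* The incomplete Beta integral B_r(j, b), for j >= 1. Note the upper bound r ^ 2;
   for b = 2 nu - 1 the exponent of 1 - u is 2 nu - 2. *)
Definition incbeta (r : R) (j : nat) (b : R) : R :=
  \int[lebesgue_measure]_(u in `[0, r ^+ 2]) (u ^+ j.-1 * (1 - u) `^ (b - 1)).

(* The parameter of the j-th Bernoulli variable, for j >= 1. *)
Definition bergman_param (nu r : R) (j : nat) : R :=
  (2 * nu - 1) * (pochhammer (2 * nu) j.-1 / (j.-1)`!%:R) *
  incbeta r j (2 * nu - 1).

End plane.

Definition mutually_independent d (T : measurableType d) (R : realType)
    d' (T' : measurableType d') (Q : probability T R) (J : set nat)
    (X : nat -> {mfun T >-> T'}) : Prop :=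
  forall (s : seq nat) (B : nat -> set T'), uniq s -> [set` s] `<=` J ->
    (forall j, measurable (B j)) ->
    Q (\bigcap_(j in [set` s]) (X j @^-1` B j)) =
    (\prod_(j <- s) Q (X j @^-1` B j))%E.

(* Main.v *)
(* The kernel is the sum over k of the terms c_k (z w^-)^k, and the monomials
   z^k are orthogonal on D_r: the measure is rotation invariant, and integrating
   over the circles gives c_k ||z^k||^2 = p_(k+1), the k+1st Bernoulli parameter.
   Hence the n-th factorial moment of N_r, which is the integral of the n-point
   determinant over D_r^n, is n! times the n-th elementary symmetric function
   of the p_j (expand the truncated kernel, then pass to the limit by dominated
   convergence), and summing these moments against s^n gives the product.
   The variables X_j are read off a single uniform variable u in [0, 1]: X_1 is
   the event u < p_1, after which u is rescaled within the chosen part of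
   [0, 1] and the next variable is drawn from the result. The law of N_r is
   then recovered from its probability generating function on (0, 1). *)
Require Import Defs.
From HB Require Import structures.
From mathcomp Require Import all_boot all_order all_algebra finmap.
From mathcomp Require Import all_classical all_reals all_analysis.
From mathcomp Require Import measurable_realfun complex perm ring lra.

Set Implicit Arguments.
Unset Strict Implicit.
Unset Printing Implicit Defensive.

Import Order.TTheory GRing.Theory Num.Theory.
Import numFieldNormedType.Exports.

Local Open Scope classical_set_scope.
Local Open Scope complex_scope.
Local Open Scope ring_scope.

(** The kernel is defined through the principal power, itself built from [acos], so its expansion in
    powers of z times conj w has to be earned. For |zeta| < 1 the segment t -> 1 - t zeta stays in
    the right half-plane, where the principal power is differentiable in t. The sum f(t) of the
    binomial series at t zeta satisfies (1 - t zeta) f' = a zeta f, so the product of f(t) and (1 -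
    t zeta)^a is constant, equal to 1. Negative s rules out monotone arguments: the case t = |s| is
    done first and then dominates, both under the expectation and in the comparison with the finite
    products. That p_j is a probability comes from the value of the complete Beta integral, of which
    the incomplete one is a fraction. The sum of the X_j is a natural number only almost surely,
    because its expectation, the sum of the p_j, is finite; this finiteness is the first moment of
    N_r. *)

Local Notation pushforward_measure :=
  measure_function_pushforward__canonical__measure_function_Measure.

(** * Complex-valued integrals *)

Section complex_values.
Context {R : realType}.
Local Notation C := R[i].
Implicit Types z w : C.

Lemma ReD z w : complex.Re (z + w) = complex.Re z + complex.Re w.
Proof. by case: z w => [a b] [c d]. Qed.
Lemma ImD z w : complex.Im (z + w) = complex.Im z + complex.Im w.
Proof. by case: z w => [a b] [c d]. Qed.
Lemma ReM z w :
  complex.Re (z * w) = complex.Re z * complex.Re w - complex.Im z * complex.Im w.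
Proof. by case: z w => [a b] [c d]. Qed.
Lemma ImM z w :
  complex.Im (z * w) = complex.Re z * complex.Im w + complex.Im z * complex.Re w.
Proof. by case: z w => [a b] [c d]. Qed.

Lemma abs_ge0 z : 0 <= abs z.
Proof. by case: z => a b; exact: sqrtr_ge0. Qed.

Lemma absE z : (abs z)%:C = `|z| :> C.
Proof. by rewrite normc_def; case: z. Qed.

Lemma absM z w : abs (z * w) = abs z * abs w.
Proof. exact: Normc.normcM. Qed.

Lemma le_absD z w : abs (z + w) <= abs z + abs w.
Proof. by rewrite -lecR rmorphD/= !absE ler_normD. Qed.

Lemma abs_real (x : R) : abs x%:C = `|x|.
Proof. by rewrite /abs /= expr0n addr0 sqrtr_sqr. Qed.

Lemma le_Re_abs z : `|complex.Re z| <= abs z.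
Proof.
case: z => a b; rewrite /abs /= -sqrtr_sqr ler_wsqrtr// lerDl; exact: sqr_ge0.
Qed.

Lemma le_Im_abs z : `|complex.Im z| <= abs z.
Proof.
case: z => a b; rewrite /abs /= -sqrtr_sqr ler_wsqrtr// lerDr; exact: sqr_ge0.
Qed.

End complex_values.

Section cmeasurable.
Context {R : realType} {d} {T : measurableType d}.
Local Notation C := R[i].
Implicit Types f g : T -> C.

Lemma cmeasurable_cst D (c : C) : cmeasurable D (fun _ : T => c).
Proof. by split; exact: measurable_cst. Qed.

Lemma cmeasurableD D f g : cmeasurable D f -> cmeasurable D g ->
  cmeasurable D (fun x => f x + g x).
Proof.
move=> [rf jf] [rg jg]; split.
  by under eq_fun do rewrite ReD; exact: measurable_funD.
by under eq_fun do rewrite ImD; exact: measurable_funD.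
Qed.

Lemma cmeasurableM D f g : cmeasurable D f -> cmeasurable D g ->
  cmeasurable D (fun x => f x * g x).
Proof.
move=> [rf jf] [rg jg]; split.
  under eq_fun do rewrite ReM.
  by apply: measurable_funB; exact: measurable_funM.
under eq_fun do rewrite ImM.
by apply: measurable_funD; exact: measurable_funM.
Qed.

Lemma cmeasurable_prod D I (s : seq I) (F : I -> T -> C) :
  (forall i, cmeasurable D (F i)) -> cmeasurable D (fun x => \prod_(i <- s) F i x).
Proof.
move=> mF; elim: s => [|i s ih].
  under eq_fun do rewrite big_nil; exact: cmeasurable_cst.
by under eq_fun do rewrite big_cons; exact: cmeasurableM.
Qed.

Lemma cmeasurableX D f n : cmeasurable D f -> cmeasurable D (fun x => f x ^+ n).
Proof.
move=> mf; elim: n => [|n ih]; first exact: cmeasurable_cst.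
by under eq_fun do rewrite exprS; exact: cmeasurableM.
Qed.

Lemma cmeasurable_conj D f : cmeasurable D f -> cmeasurable D (fun x => (f x)^*%C).
Proof.
move=> [rf jf]; split.
  by rewrite (_ : (fun x => _) = fun x => complex.Re (f x))//; apply/funext => x; case: (f x).
rewrite (_ : (fun x => _) = fun x => - complex.Im (f x)).
  exact: measurableT_comp.
by apply/funext => x; case: (f x).
Qed.

Lemma cmeasurable_real D (g : T -> R) : measurable_fun D g ->
  cmeasurable D (fun x => (g x)%:C).
Proof. by move=> mg; split => //=; exact: measurable_cst. Qed.

Lemma cmeasurable_comp d' (T' : measurableType d') (h : T' -> T) f :
  measurable_fun setT h -> cmeasurable setT f ->
  cmeasurable setT (fun x => f (h x)).
Proof.
by move=> mh [rf jf]; split; [exact: (measurableT_comp rf mh)|exact: (measurableT_comp jf mh)].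
Qed.

End cmeasurable.

Section cintegral.
Context {R : realType} {d} {T : measurableType d} (mu : {measure set T -> \bar R}).
Local Notation C := R[i].
Implicit Types f g : T -> C.
Local Notation integ f := (cintegrable mu setT f).
Local Notation "'cint' f" := (cintegral mu setT f) (at level 10).

Lemma cintegrable_measurable f : integ f -> cmeasurable setT f.
Proof. by move=> [/measurable_int/measurable_EFinP ? /measurable_int/measurable_EFinP ?]. Qed.

Lemma cintegrable_le f (g : T -> R) : cmeasurable setT f ->
  mu.-integrable setT (EFin \o g) -> (forall x, abs (f x) <= g x) -> integ f.
Proof.
move=> [rf jf] ig fg; split.
  apply: (le_integrable _ _ _ ig) => //; first exact/measurable_EFinP.
  move=> x _ /=; rewrite lee_fin (le_trans (le_Re_abs _))// (le_trans (fg x))//.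
  exact: ler_norm.
apply: (le_integrable _ _ _ ig) => //; first exact/measurable_EFinP.
move=> x _ /=; rewrite lee_fin (le_trans (le_Im_abs _))// (le_trans (fg x))//.
exact: ler_norm.
Qed.

Lemma cintegrable0 : integ (fun=> 0).
Proof. by split; exact: integrable0. Qed.

Lemma cintegrableD f g : integ f -> integ g -> integ (fun x => f x + g x).
Proof.
move=> [rf jf] [rg jg]; split.
  by under eq_fun do rewrite ReD EFinD; exact: integrableD.
by under eq_fun do rewrite ImD EFinD; exact: integrableD.
Qed.

Lemma cintegralD f g : integ f -> integ g ->
  cint (fun x => f x + g x) = cint f + cint g.
Proof.
move=> [rf jf] [rg jg]; rewrite /cintegral.
under eq_Rintegral do rewrite ReD.
under [X in _ +i* X]eq_Rintegral do rewrite ImD.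
by rewrite !RintegralD.
Qed.

Lemma cintegrableZ (c : C) f : integ f -> integ (fun x => c * f x).
Proof.
move=> [rf jf]; split.
  under eq_fun do rewrite ReM EFinB !EFinM.
  by apply: integrableB => //; exact: integrableZl.
under eq_fun do rewrite ImM EFinD !EFinM.
by apply: integrableD => //; exact: integrableZl.
Qed.

Lemma cintegralZ (c : C) f : integ f -> cint (fun x => c * f x) = c * cint f.
Proof.
move=> [rf jf]; rewrite /cintegral.
under eq_Rintegral do rewrite ReM.
under [X in _ +i* X]eq_Rintegral do rewrite ImM.
have h (a : R) (g : T -> R) : mu.-integrable setT (fun x => (g x)%:E) ->
    mu.-integrable setT (EFin \o (fun x => a * g x)).
  by move=> ig; rewrite /comp; under eq_fun do rewrite EFinM; exact: integrableZl.
rewrite RintegralB ?RintegralD//; try exact: h.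
by rewrite !RintegralZl//; case: c.
Qed.

Lemma cintegrable_sum I (s : seq I) (F : I -> T -> C) :
  (forall i, integ (F i)) -> integ (fun x => \sum_(i <- s) F i x).
Proof.
move=> iF; elim: s => [|i s ih].
  under eq_fun do rewrite big_nil; exact: cintegrable0.
by under eq_fun do rewrite big_cons; exact: cintegrableD.
Qed.

Lemma cintegral_sum I (s : seq I) (F : I -> T -> C) :
  (forall i, integ (F i)) ->
  cint (fun x => \sum_(i <- s) F i x) = \sum_(i <- s) cint (F i).
Proof.
move=> iF; elim: s => [|i s ih].
  rewrite big_nil; under eq_fun do rewrite big_nil.
  by rewrite /cintegral !Rintegral_cst// !mul0r.
rewrite big_cons -ih -cintegralD//; last exact: cintegrable_sum.
by congr cintegral; apply/funext => x; rewrite big_cons.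
Qed.

End cintegral.

(** * Change of variables along measure-preserving maps *)

Section measure_preserving.
Context d1 d2 (X : measurableType d1) (Y : measurableType d2) (R : realType).
Variables (m1 : {measure set X -> \bar R}) (m2 : {measure set Y -> \bar R}).
Variables (phi : X -> Y) (mphi : measurable_fun setT phi).
Hypothesis m12 : forall A, measurable A -> m2 A = m1 (phi @^-1` A).

(** Since [m2] need only agree with the image measure on measurable sets, the result covers
    [tuple_measure] (an image by definition) as well as measures that are their own image under a
    rotation. *)
Lemma ge0_integral_preserving (f : Y -> \bar R) : measurable_fun setT f ->
  (forall y, 0 <= f y)%E -> (\int[m2]_y f y = \int[m1]_x f (phi x))%E.
Proof.
move=> mf f0.
rewrite (eq_measure_integral (pushforward m1 phi))//; last by move=> A mA _; rewrite m12.
by rewrite ge0_integral_pushforward// preimage_setT.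
Qed.

Lemma integral_preserving (f : Y -> \bar R) : measurable_fun setT f ->
  (\int[m2]_y f y = \int[m1]_x f (phi x))%E.
Proof.
move=> mf; rewrite integralE [RHS]integralE; congr (_ - _)%E.
  rewrite (ge0_integral_preserving (measurable_funepos mf))//.
  by apply: eq_integral => x _; rewrite -[RHS]/((f \o phi)^\+ x)%E (funepos_comp f phi).
rewrite (ge0_integral_preserving (measurable_funeneg mf))//.
by apply: eq_integral => x _; rewrite -[RHS]/((f \o phi)^\- x)%E (funeneg_comp f phi).
Qed.

Lemma integrable_preserving (f : Y -> \bar R) : measurable_fun setT f ->
  m2.-integrable setT f <-> m1.-integrable setT (f \o phi).
Proof.
move=> mf; split=> /integrableP[_ foo]; apply/integrableP; split => //.
- exact: measurableT_comp.
- rewrite (le_lt_trans _ foo)// (ge0_integral_preserving (f := fun x => `|f x|%E))//.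
  exact: measurableT_comp.
- rewrite ge0_integral_preserving//; exact: measurableT_comp.
Qed.

Lemma cintegral_preserving (f : Y -> R[i]) : cmeasurable setT f ->
  cintegral m2 setT f = cintegral m1 setT (f \o phi).
Proof.
move=> [mr mi]; rewrite /cintegral /Rintegral.
by rewrite !integral_preserving//; exact/measurable_EFinP.
Qed.

Lemma cintegrable_preserving (f : Y -> R[i]) : cmeasurable setT f ->
  cintegrable m2 setT f <-> cintegrable m1 setT (f \o phi).
Proof.
move=> [/measurable_EFinP mr /measurable_EFinP mi].
split=> -[ir ii]; split.
- exact: (integrable_preserving mr).1.
- exact: (integrable_preserving mi).1.
- exact: (integrable_preserving mr).2.
- exact: (integrable_preserving mi).2.
Qed.

End measure_preserving.

(** * Integrals of tensor products *)

Section product_integral.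
Context d1 d2 (X : measurableType d1) (Y : measurableType d2) (R : realType).
Variables (m1 : {sigma_finite_measure set X -> \bar R})
  (m2 : {sigma_finite_measure set Y -> \bar R}).

Let mfst (f : X -> R) : measurable_fun setT f ->
  measurable_fun setT (fun z : X * Y => f z.1).
Proof. by move=> mf; exact: (measurableT_comp mf). Qed.

Let msnd (f : Y -> R) : measurable_fun setT f ->
  measurable_fun setT (fun z : X * Y => f z.2).
Proof. by move=> mf; exact: (measurableT_comp mf). Qed.

Lemma integrable_tensor (f : X -> R) (g : Y -> R) :
  m1.-integrable setT (EFin \o f) -> m2.-integrable setT (EFin \o g) ->
  (m1 \x m2)%E.-integrable setT (fun z => (f z.1 * g z.2)%:E).
Proof.
move=> if_ ig.
have /measurable_EFinP mf := measurable_int _ if_.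
have /measurable_EFinP mg := measurable_int _ ig.
have mfg : measurable_fun setT (fun z : X * Y => (f z.1 * g z.2)%:E).
  by apply/measurable_EFinP/measurable_funM; [exact: mfst|exact: msnd].
apply/integrable12ltyP => //=.
under eq_integral => x _.
  under eq_integral => y _ do rewrite normrM EFinM.
  rewrite ge0_integralZl//; last by apply/measurable_EFinP; exact: measurableT_comp.
  over.
move/integrableP : ig => [_ /= ig].
move/integrableP : if_ => [_ /= if_].
have /fineK <- : (\int[m2]_x `|g x|%:E \is a fin_num)%E.
  by rewrite ge0_fin_numE// integral_ge0.
rewrite ge0_integralZr//=.
- apply: lte_mul_pinfty; rewrite ?ltry//; first exact: integral_ge0.
  by rewrite ge0_fin_numE// integral_ge0.
- by apply/measurable_EFinP; exact: measurableT_comp.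
- by rewrite lee_fin fine_ge0// integral_ge0.
Qed.

Lemma integral_tensor (f : X -> R) (g : Y -> R) :
  m1.-integrable setT (EFin \o f) -> m2.-integrable setT (EFin \o g) ->
  \int[(m1 \x m2)%E]_z (f z.1 * g z.2) = (\int[m1]_x f x) * (\int[m2]_y g y).
Proof.
move=> if_ ig; have ifg := integrable_tensor if_ ig.
rewrite /Rintegral -integral12_prod_meas1//= /fubini_F/=.
under eq_integral => x _.
  under eq_integral => y _ do rewrite EFinM.
  rewrite integralZl//.
  over.
have gfin : (\int[m2]_x (g x)%:E \is a fin_num)%E by exact: integrable_fin_num.
have ffin : (\int[m1]_x (f x)%:E \is a fin_num)%E by exact: integrable_fin_num.
by rewrite -(fineK gfin) integralZr//= fineM.
Qed.

Lemma cintegrable_tensor (f : X -> R[i]) (g : Y -> R[i]) :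
  cintegrable m1 setT f -> cintegrable m2 setT g ->
  cintegrable (m1 \x m2)%E setT (fun z => f z.1 * g z.2).
Proof.
move=> [rf jf] [rg jg]; split.
  under eq_fun do rewrite ReM EFinB.
  by apply: integrableB => //;
    [exact: (integrable_tensor rf rg)|exact: (integrable_tensor jf jg)].
under eq_fun do rewrite ImM EFinD.
by apply: integrableD => //;
  [exact: (integrable_tensor rf jg)|exact: (integrable_tensor jf rg)].
Qed.

Lemma cintegral_tensor (f : X -> R[i]) (g : Y -> R[i]) :
  cintegrable m1 setT f -> cintegrable m2 setT g ->
  cintegral (m1 \x m2)%E setT (fun z => f z.1 * g z.2) =
  cintegral m1 setT f * cintegral m2 setT g.
Proof.
move=> [rf jf] [rg jg]; rewrite /cintegral.
under eq_Rintegral do rewrite ReM.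
under [X in _ +i* X]eq_Rintegral do rewrite ImM.
rewrite RintegralB//; [|exact: (integrable_tensor rf rg)|exact: (integrable_tensor jf jg)].
rewrite RintegralD//; [|exact: (integrable_tensor rf jg)|exact: (integrable_tensor jf rg)].
rewrite (integral_tensor rf rg) (integral_tensor jf jg).
by rewrite (integral_tensor rf jg) (integral_tensor jf rg).
Qed.

End product_integral.

Section tuple_integral.
Context d (T : measurableType d) (R : realType).
Variable mu : {sigma_finite_measure set T -> \bar R}.

(** Induction on n: [tuple_measure mu n.+1] is the image of a product measure under [tuple_consp],
    through which the integrand becomes a tensor product. The base case is a Dirac mass. *)
Lemma cintegral_tuple_prod n (g : 'I_n -> T -> R[i]) :
  (forall i, cintegrable mu setT (g i)) ->
  cintegrable (tuple_measure mu n) setT (fun x => \prod_i g i (tnth x i)) /\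
  cintegral (tuple_measure mu n) setT (fun x => \prod_i g i (tnth x i)) =
  \prod_i cintegral mu setT (g i).
Proof.
elim: n g => [|n ih] g ig.
  under [X in cintegrable _ _ X]eq_fun do rewrite big_ord0.
  under [X in cintegral _ _ X]eq_fun do rewrite big_ord0.
  rewrite big_ord0; split.
    split; rewrite /=.
      by apply/integrableP; split=> //=; rewrite integral_cst//= diracE mem_set// ?mule1 ?mul1e ltry.
    exact: integrable0.
  by rewrite /cintegral /= Rintegral_cst// Rintegral_cst//=; rewrite indicE mem_set// mul0r mulr1.
have {ih}[] := ih (fun i => g (lift ord0 i)) (fun i => ig _).
set G := (fun x : n.-tuple T => _) => iG cG.
set F := (fun x : n.+1.-tuple T => _).
have mF : cmeasurable setT F.
  apply: cmeasurable_prod => i.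
  exact: (cmeasurable_comp (measurable_tnth i) (cintegrable_measurable (ig i))).
have FE : F \o (@tuple_consp _ T n) = fun z => g ord0 z.1 * G z.2.
  apply/funext => -[x t]; rewrite /F /= big_ord_recl/= tnth0; congr (_ * _).
  by apply: eq_bigr => i _; rewrite tnthS.
have pres A : measurable A -> tuple_measure mu n.+1 A =
  (mu \x tuple_measure mu n)%E (@tuple_consp _ T n @^-1` A) by [].
split.
  apply/(cintegrable_preserving (@measurable_tuple_consp _ T n) pres mF).
  by rewrite FE; exact: cintegrable_tensor.
rewrite (cintegral_preserving (@measurable_tuple_consp _ T n) pres mF) FE.
by rewrite cintegral_tensor// cG big_ord_recl.
Qed.

End tuple_integral.

(** * Rotations of the plane *)

Section affine.
Context {R : realType}.
Local Notation lam := (@lebesgue_measure R).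
Local Notation mR := (measurableTypeR R).

Lemma measurable_affine (a b : R) :
  measurable_fun [set: mR] (fun y : mR => a * y + b : mR).
Proof. by apply: measurable_funD => //; exact: measurable_funM. Qed.

(** Both sides are measures in A that agree on the intervals ]u, v]. The case a = 1 serves the
    shears, b = 0 the dilations, and the general case the rescaling of a uniform variable. *)
Lemma lebesgue_measure_affine (a b : R) (A : set mR) : 0 < a -> measurable A ->
  (lam A = a%:E * lam [set y | A (a * y + b)%R])%E.
Proof.
move=> a0 mA.
pose phi : mR -> mR := fun y => a * y + b.
have mphi : measurable_fun [set: mR] phi by exact: measurable_affine.
pose m' := mscale (NngNum (ltW a0)) (pushforward_measure lam mphi).
have h X : ocitv X -> lam X = m' X.
  move=> [[u v] _ <-] /=; rewrite /m' /= /mscale /= /pushforward.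
  rewrite (_ : phi @^-1` `]u, v]%classic = `](u - b) / a, (v - b) / a]%classic); last first.
    apply/seteqP; split => y /=; rewrite !in_itv/= ltr_pdivrMr// ler_pdivlMr// /phi;
    by rewrite ltrBlDr lerBrDr mulrC.
  rewrite !lebesgue_measure_itv/= !lte_fin ltr_pM2r ?invr_gt0// ltrD2r.
  case: ifPn => _; last by rewrite mule0.
  rewrite -!EFinB -EFinM; congr EFin; field; exact: lt0r_neq0.
exact: (lebesgue_measure_unique h).
Qed.

End affine.

Section plane_maps.
Context {R : realType}.
Local Notation lam := (@lebesgue_measure R).
Local Notation mR := (measurableTypeR R).
Local Notation plane := (R * R)%type.
Local Notation pl := (plane_lebesgue R).

(** The product measure is defined by slicing along the first coordinate; its uniqueness allows
    slicing along the second, as horizontal shears require. *)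
Lemma plane_lebesgue_ysection (A : set plane) : measurable A ->
  (pl A = \int[lam]_y lam (ysection A y))%E.
Proof.
move=> mA; rewrite /plane_lebesgue.
have -> : (lam \x lam)%E A = (lam \x^ lam)%E A.
  by apply: product_measure_unique => // B C mB mC/=; rewrite product_measure2E.
by [].
Qed.

Lemma measurable_vshear (a : R) :
  measurable_fun [set: plane] (fun z : plane => (z.1, z.2 + a * z.1) : plane).
Proof.
by apply/measurable_fun_pair => //=; apply: measurable_funD => //; exact: measurable_funM.
Qed.

Lemma measurable_hshear (a : R) :
  measurable_fun [set: plane] (fun z : plane => (z.1 + a * z.2, z.2) : plane).
Proof.
by apply/measurable_fun_pair => //=; apply: measurable_funD => //; exact: measurable_funM.
Qed.

Lemma plane_lebesgue_vshear (a : R) (A : set plane) : measurable A ->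
  pl A = pl [set z | A (z.1, z.2 + a * z.1)].
Proof.
move=> mA; apply: eq_integral => x _ /=.
rewrite (@lebesgue_measure_affine R 1 (a * x))//; last exact: measurable_xsection.
rewrite mul1e; congr (lam _); apply/seteqP; split => y /=;
by rewrite !xsectionP /= mul1r.
Qed.

Lemma plane_lebesgue_hshear (a : R) (A : set plane) : measurable A ->
  pl A = pl [set z | A (z.1 + a * z.2, z.2)].
Proof.
move=> mA; rewrite !plane_lebesgue_ysection//; last first.
  by rewrite -[X in measurable X]setTI; exact: measurable_hshear.
apply: eq_integral => y _ /=.
rewrite (@lebesgue_measure_affine R 1 (a * y))//; last exact: measurable_ysection.
rewrite mul1e; congr (lam _); apply/seteqP; split => x /=;
by rewrite !ysectionP /= mul1r.
Qed.

Definition rotation (c s : R) (z : plane) : plane :=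
  (c * z.1 - s * z.2, s * z.1 + c * z.2).

Lemma measurable_rotation c s : measurable_fun [set: plane] (rotation c s).
Proof.
by apply/measurable_fun_pair => //=; [apply: measurable_funB => //|apply: measurable_funD => //];
  exact: measurable_funM.
Qed.

(* A rotation of angle t is a product of three shears of slopes - tan (t / 2),
   sin t and - tan (t / 2). *)
Lemma plane_lebesgue_rotation (c s : R) (A : set plane) :
  c ^+ 2 + s ^+ 2 = 1 -> c != -1 -> measurable A ->
  pl A = pl (rotation c s @^-1` A).
Proof.
move=> cs c1 mA; have c0 : 1 + c != 0 by rewrite addrC -subr_eq0 opprK in c1 *.
(* Half-angle formula: this is minus the tangent of half the angle, infinite for the half-turn,
   which [c != -1] excludes. *)
set t := - (s / (1 + c)).
have mpre (h : plane -> plane) (B : set plane) : measurable_fun setT h ->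
    measurable B -> measurable (h @^-1` B).
  by move=> mh mB; rewrite -[X in measurable X]setTI; exact: mh.
rewrite (plane_lebesgue_hshear t)// (plane_lebesgue_vshear s); last exact: (mpre _ _ (measurable_hshear _)).
rewrite (plane_lebesgue_hshear t); last first.
  exact: (mpre _ _ (measurable_vshear _) (mpre _ _ (measurable_hshear _) mA)).
have e1 : 1 + s * t = c.
  apply: (mulIf c0); rewrite mulrDl mul1r mulrN mulNr !mulrA mulfVK// -expr2.
  by rewrite (_ : s ^+ 2 = 1 - c ^+ 2); [ring|rewrite -cs; ring].
have e2 : t * (1 + c) = - s by rewrite /t mulNr mulfVK.
have e3 x y : x + t * y + t * (y + s * (x + t * y)) = c * x - s * y.
  by rewrite -mulNr -e2 -e1; ring.
have e4 x y : y + s * (x + t * y) = s * x + c * y by rewrite -e1; ring.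
by congr (pl _); apply/seteqP; split => -[x y] /=; rewrite /rotation/= e3 e4.
Qed.

End plane_maps.

(** * Radial integration and the monomials in the disc *)

Section radial.
Context {R : realType}.
Local Notation lam := (@lebesgue_measure R).
Local Notation mR := (measurableTypeR R).
Local Notation plane := (R * R)%type.
Local Notation pl := (plane_lebesgue R).

(** The square is the right radial variable: the image of the plane measure under it is a constant
    multiple of Lebesgue measure on the half-line. *)
Definition sqnorm (z : plane) : mR := z.1 ^+ 2 + z.2 ^+ 2.

Lemma measurable_sqnorm : measurable_fun [set: plane] sqnorm.
Proof. by apply: measurable_funD; exact: measurable_funX. Qed.

Let mpre (A : set mR) : measurable A -> measurable (sqnorm @^-1` A).
Proof. by move=> mA; rewrite -[X in measurable X]setTI; exact: measurable_sqnorm. Qed.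

Let ball2 (u : R) : set plane := [set z | sqnorm z <= u].

Let mball2 u : measurable (ball2 u).
Proof.
rewrite (_ : ball2 u = sqnorm @^-1` `]-oo, u]%classic).
  by apply: mpre; exact: measurable_itv.
by apply/seteqP; split => z /=; rewrite in_itv.
Qed.

Let sub_box (u : R) : 0 <= u -> ball2 u `<=` `[- Num.sqrt u, Num.sqrt u]%classic `*` `[- Num.sqrt u, Num.sqrt u]%classic.
Proof.
move=> u0 [x y]; rewrite /ball2 /sqnorm /= => xy.
by split=> /=; rewrite in_itv/= -ler_norml -sqrtr_sqr ler_wsqrtr// (le_trans _ xy)//
  ?lerDl ?lerDr sqr_ge0.
Qed.

Let pl_ball2_lty (u : R) : 0 <= u -> (pl (ball2 u) < +oo)%E.
Proof.
move=> u0; have mi : measurable (`[- Num.sqrt u, Num.sqrt u]%classic : set mR) by exact: measurable_itv.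
apply: (@le_lt_trans _ _ (pl (`[- Num.sqrt u, Num.sqrt u]%classic `*` `[- Num.sqrt u, Num.sqrt u]%classic))).
  apply: le_measure; rewrite ?inE//; last exact: sub_box.
  exact: measurableX.
rewrite /plane_lebesgue product_measure1E//= lebesgue_measure_itv/=.
by case: ifP => _; rewrite -?EFinB -?EFinM ?mule0 ltry.
Qed.

Let pl_ball2_1_gt0 : (0 < pl (ball2 1))%E.
Proof.
have mi : measurable (`[0, 1/2]%classic : set mR) by exact: measurable_itv.
apply: (@lt_le_trans _ _ (pl (`[0, 1/2]%classic `*` `[0, 1/2]%classic))).
  rewrite /plane_lebesgue product_measure1E//= lebesgue_measure_itv/= lte_fin ifT.
    by rewrite -EFinB -EFinM lte_fin subr0 mulr_gt0.
  by [].
apply: le_measure; rewrite ?inE//; first exact: measurableX.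
move=> [x y] [/=]; rewrite !in_itv/= => /andP[x0 x1] /andP[y0 y1].
rewrite /ball2/= /sqnorm/=; nra.
Qed.

(** The dilation by the square root of u scales each factor of the product measure by that root,
    hence the area by u. *)
Let ball2_scale (u : R) : 0 < u -> pl (ball2 u) = (u%:E * pl (ball2 1))%E.
Proof.
move=> u0; set a := Num.sqrt u; have a0 : 0 < a by rewrite sqrtr_gt0.
have a2 : a ^+ 2 = u by rewrite sqr_sqrtr// ltW.
pose phi (z : mR * mR) : mR * mR := (a * z.1, a * z.2).
have mphi : measurable_fun [set: mR * mR] phi.
  by apply/measurable_fun_pair => //=; exact: measurable_funM.
pose m' := mscale (NngNum (ltW u0)) (pushforward_measure (lam \x lam)%E mphi).
have h (A B : set mR) : measurable A -> measurable B -> m' (A `*` B) = (lam A * lam B)%E.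
  move=> mA mB; rewrite /m' /= /mscale/= /pushforward.
  rewrite (_ : phi @^-1` (A `*` B) = [set x | A (a * x + 0)] `*` [set x | B (a * x + 0)]); last first.
    by apply/seteqP; split => -[x y] /=; rewrite !addr0.
  rewrite product_measure1E//; last 2 first.
  - by rewrite -[X in measurable X]setTI; exact: measurable_affine.
  - by rewrite -[X in measurable X]setTI; exact: measurable_affine.
  rewrite (lebesgue_measure_affine 0 a0 mA) (lebesgue_measure_affine 0 a0 mB).
  by rewrite -a2 expr2 EFinM -!muleA; congr (_ * _)%E; rewrite muleCA.
rewrite {1}/plane_lebesgue (product_measure_unique h)//; last exact: mball2.
rewrite /m' /= /mscale/= /pushforward; congr (_ * pl _)%E.
apply/seteqP; split => z; rewrite /ball2/= /sqnorm /= !exprMn a2 -mulrDr;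
by rewrite -ler_pdivlMl// mulVf// lt0r_neq0.
Qed.

(** The area of the unit disc; until [c_pi], only its positivity and finiteness are known. *)
Let c : R := fine (pl (ball2 1)).
Let c_gt0 : 0 < c.
Proof. by rewrite fine_gt0// pl_ball2_1_gt0/= pl_ball2_lty. Qed.

Let pl_ball2_gt0 (u : R) : 0 < u -> pl (ball2 u) = (c * u)%:E.
Proof.
move=> u0; rewrite ball2_scale// mulrC EFinM; congr (_ * _)%E.
by rewrite /c fineK// ge0_fin_numE// pl_ball2_lty.
Qed.

Let pl_ball2_le0 (u : R) : u <= 0 -> pl (ball2 u) = 0%E.
Proof.
move=> u0; apply/eqP; rewrite eq_le measure_ge0 andbT.
apply/lee_addgt0Pr => e e0; rewrite add0e.
have ec : 0 < e / c by rewrite divr_gt0.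
rewrite (@le_trans _ _ (pl (ball2 (e / c))))//.
  apply: le_measure; rewrite ?inE// => z; rewrite /ball2 /= => zu.
  by rewrite (le_trans zu)// (le_trans u0)// ltW.
by rewrite pl_ball2_gt0// mulrC divfK// lt0r_neq0.
Qed.

Let nneg : set mR := `[0, +oo[%classic.

(** Uniqueness of Lebesgue measure concerns the whole line, whereas the image of the plane measure
    lives on [0, +oo[. Hence [m'] adds to the normalized image the Lebesgue measure of the negative
    half-line before both are compared on the intervals ]u, v]. *)
Let pl_sqnorm (A : set mR) : measurable A ->
  pl (sqnorm @^-1` A) = (c%:E * lam (A `&` nneg))%E.
Proof.
move=> mA.
have mn : measurable nneg by exact: measurable_itv.
have ci0 : 0 <= c^-1 by rewrite invr_ge0 ltW.
pose m1 := mscale (NngNum ci0) (pushforward_measure pl measurable_sqnorm).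
pose m2 := mrestr lam (measurableC mn).
pose m' := measure_add m1 m2.
have m'E B : m' B = ((c^-1)%:E * pl (sqnorm @^-1` B) + lam (B `&` ~` nneg))%E.
  by rewrite /m' measure_addE.
have h X : ocitv X -> lam X = m' X.
  move=> [[u v] _ <-]; rewrite m'E /=.
  have [vu|uv] := leP v u.
    by rewrite set_itv_ge ?bnd_simp -?leNgt// preimage_set0 set0I !measure0 mule0 adde0.
  have -> : sqnorm @^-1` `]u, v]%classic = ball2 v `\` ball2 u.
    apply/seteqP; split => z /=; rewrite in_itv/= /ball2/=.
      by move=> /andP[uz ->]; split => //; apply/negP; rewrite -ltNge.
    by move=> [-> /negP]; rewrite -ltNge => ->.
  rewrite measureD//; last first.
    rewrite -[ltLHS]/(pl (ball2 v)) (le_lt_trans _ (pl_ball2_lty (normr_ge0 v)))//.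
    apply: le_measure; rewrite ?inE// => z; rewrite /ball2/= => /le_trans; apply.
    exact: ler_norm.
  rewrite (_ : ball2 v `&` ball2 u = ball2 u); last first.
    apply/seteqP; split=> [z []//|z]; rewrite /ball2/= => zu; split => //.
    by rewrite (le_trans zu)// ltW.
  rewrite -![X in (_ * X)%E]/(pl (ball2 v) - pl (ball2 u))%E.
  have [u0|u0] := leP 0 u.
    rewrite (_ : _ `&` _ = set0); last first.
      apply/seteqP; split => // z [] ; rewrite /nneg/= !in_itv/= andbT => /andP[uz _] /negP.
      by rewrite -ltNge => z0; have := lt_trans uz z0; rewrite ltNge u0.
    rewrite measure0 adde0 lebesgue_measure_itv/= lte_fin uv.
    rewrite pl_ball2_gt0 ?(le_lt_trans u0)//.
    have [<-|u1] := eqVneq 0 u; first by rewrite pl_ball2_le0// !sube0 -EFinM mulKf// gt_eqF.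
    by rewrite pl_ball2_gt0 ?lt_def 1?eq_sym ?u1// -!EFinB -EFinM -mulrBr mulKf// gt_eqF.
  rewrite (pl_ball2_le0 (ltW u0)) sube0.
  have [v0|v0] := ltP 0 v.
    rewrite (_ : _ `&` _ = `]u, 0[%classic); last first.
      apply/seteqP; split => z ; rewrite /nneg/= !in_itv/= andbT.
        by move=> [/andP[-> _]] /negP; rewrite -ltNge.
      move=> /andP[-> z0]; split; first by rewrite (le_trans (ltW z0))// ltW.
      by apply/negP; rewrite -ltNge.
    rewrite pl_ball2_gt0// -EFinM mulKf ?gt_eqF//.
    by rewrite !lebesgue_measure_itv/= !lte_fin uv u0 -!EFinB -EFinD sub0r.
  rewrite (pl_ball2_le0 v0) mule0 add0e.
  (* The endpoint v is in the negative half-line only if v < 0, but a point carries no mass. *)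
  rewrite (_ : _ `&` _ = `]u, v[%classic `|` (if v < 0 then [set v] else set0)); last first.
    apply/seteqP; split => z ; rewrite /nneg/= !in_itv/= andbT.
      move=> [/andP[uz]]; rewrite le_eqVlt => /predU1P[->|zv _]; last by left; rewrite uz.
      by move=> /negP; rewrite -ltNge => vn; right; rewrite vn.
    move=> [/andP[uz zv]|]; first by rewrite uz ltW//; split => //; apply/negP; rewrite -ltNge (lt_le_trans zv).
    case: ifPn => // vn -> ; rewrite uv lexx; split => //; by apply/negP; rewrite -ltNge.
  rewrite measureU0//; last 2 first.
  - by case: ifP => _; [exact: measurable_set1|exact: measurable0].
  - by case: ifP => _; [exact: lebesgue_measure_set1|exact: measure0].
  by rewrite [LHS]lebesgue_measure_itv [RHS]lebesgue_measure_itv/= !lte_fin uv.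
have mAn : measurable (A `&` nneg) by exact: measurableI.
have -> : lam (A `&` nneg) = m' (A `&` nneg) by exact: (lebesgue_measure_unique h mAn).
rewrite m'E.
rewrite -setIA setICr setI0 measure0 adde0 muleA -EFinM divff ?gt_eqF// mul1e.
congr (pl _); apply/seteqP; split=> [z /= Az|z []//]; split => //=.
by rewrite /nneg/= in_itv/= andbT /sqnorm addr_ge0// sqr_ge0.
Qed.

Let ge0_integral_sqnorm_c (f : mR -> \bar R) : measurable_fun setT f ->
  (forall u, 0 <= f u)%E ->
  (\int[pl]_z f (sqnorm z) = c%:E * \int[lam]_(u in nneg) f u)%E.
Proof.
move=> mf f0; have mn : measurable nneg by exact: measurable_itv.
transitivity (\int[pl]_z (f \_ nneg) (sqnorm z))%E.
  apply: eq_integral => z _; rewrite patchE mem_set// /nneg/= in_itv/= andbT.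
  by rewrite /sqnorm addr_ge0// sqr_ge0.
rewrite -(@ge0_integral_preserving _ _ _ _ _ pl
  (pushforward_measure pl measurable_sqnorm) _ measurable_sqnorm)//.
- rewrite -integral_mkcond.
  rewrite (eq_measure_integral (mscale (NngNum (ltW c_gt0)) lam)); last first.
    move=> A mA An; rewrite [LHS]pl_sqnorm// (setIidl An)//.
  by rewrite ge0_integral_mscale//; exact: measurable_funTS.
- exact/(measurable_restrictT _ mn)/measurable_funTS.
- by move=> y; rewrite patchE; case: ifP.
Qed.

(* The constant is found by integrating [exp (- |z|^2)]. *)
Let c_pi : c = pi.
Proof.
have mg : measurable_fun [set: mR] (@gauss_fun R) by exact: measurable_gauss_fun.
have mge : measurable_fun [set: mR] (EFin \o @gauss_fun R) by exact/measurable_EFinP.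
have me : measurable_fun [set: mR] (fun u : mR => (expR (- u))%:E).
  by apply/measurable_EFinP; exact: measurableT_comp.
have := ge0_integral_sqnorm_c me (fun u => expR_ge0 _).
have -> : (\int[lam]_(u in nneg) (expR (- u))%:E = 1)%E.
  rewrite -(integral_exponential_pdf (@ltr01 R)) integral_mkcond.
  apply: eq_integral => x _; rewrite /exponential_pdf !patchE; case: ifP => //.
  by rewrite mul1r mulN1r.
rewrite mule1.
have -> : (\int[pl]_z (expR (- sqnorm z))%:E =
    \int[lam]_x \int[lam]_y (expR (- (x ^+ 2 + y ^+ 2)))%:E)%E.
  pose f (z : mR * mR) := (expR (- (z.1 ^+ 2 + z.2 ^+ 2)))%:E.
  have mf : measurable_fun [set: mR * mR] f by exact: (measurableT_comp me measurable_sqnorm).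
  have f0 z : (0 <= f z)%E by rewrite lee_fin expR_ge0.
  have mid : measurable_fun [set: mR * mR] (id : mR * mR -> plane) by move=> _ A mA; rewrite setTI.
  rewrite (@ge0_integral_preserving _ _ _ _ _ (lam \x lam)%E pl _ mid _ (fun z : plane => (expR (- sqnorm z))%:E))//.
  exact (fubini_tonelli1 f mf f0).
have E (x : mR) : (\int[lam]_y (expR (- (x ^+ 2 + y ^+ 2)))%:E =
    (gauss_fun x)%:E * (Num.sqrt pi)%:E)%E.
  under eq_integral => y _ do rewrite opprD expRD EFinM.
  by rewrite ge0_integralZl ?lee_fin ?expR_ge0// -[in RHS]integralT_gauss.
under eq_integral do rewrite E.
rewrite ge0_integralZr//; last by move=> y _; rewrite lee_fin expR_ge0.
rewrite integralT_gauss -EFinM -expr2 sqr_sqrtr ?pi_ge0//.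
by move=> [].
Qed.

Lemma ge0_integral_sqnorm (f : mR -> \bar R) : measurable_fun setT f ->
  (forall u, 0 <= f u)%E ->
  (\int[pl]_z f (sqnorm z) = pi%:E * \int[lam]_(u in `[0%R, +oo[) f u)%E.
Proof. by rewrite -c_pi; exact: ge0_integral_sqnorm_c. Qed.

End radial.

(** * Integration against the weighted measure *)

Section density_integral.
Context d (T : measurableType d) (R : realType).
Variables (mu : {sigma_finite_measure set T -> \bar R}) (w : T -> R).
Hypotheses (mw : measurable_fun [set: T] w) (w0 : forall x, 0 <= w x).
Local Notation wmu := (density mu mw w0).

Import HBNNSimple.

Let mwe : measurable_fun [set: T] (EFin \o w).
Proof. exact/measurable_EFinP. Qed.

Let integral_density_nnsfun (f : {nnsfun T >-> R}) :
  (\int[wmu]_x (f x)%:E = \int[mu]_x ((f x)%:E * (w x)%:E))%E.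
Proof.
under [LHS]eq_integral do rewrite fimfunE -fsumEFin//.
rewrite [LHS]ge0_integral_fsum//; last 2 first.
- by move=> r; exact/measurable_EFinP/measurableT_comp.
- by move=> n x _; rewrite EFinM nnfun_muleindic_ge0.
under [RHS]eq_integral.
  move=> x _; rewrite fimfunE -fsumEFin// ge0_mule_fsuml; last first.
    by move=> r; rewrite EFinM nnfun_muleindic_ge0.
  over.
rewrite [RHS]ge0_integral_fsum//; last 2 first.
- move=> r; apply: emeasurable_funM => //.
  exact/measurable_EFinP/measurableT_comp.
- by move=> n x _; rewrite EFinM mule_ge0// ?nnfun_muleindic_ge0// lee_fin.
apply: eq_fsbigr => r _.
rewrite integralZl_indic_nnsfun// integral_indic// setIT.
have [r0|r0] := leP 0 r; last first.
  rewrite preimage_nnfun0//= measure0 mule0.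
  by rewrite integral0_eq// => x _; rewrite indic0 mulr0 mul0e.
under eq_integral do rewrite EFinM -muleA.
rewrite ge0_integralZl//; last 2 first.
- by apply: emeasurable_funM => //; exact/measurable_EFinP.
- by move=> x _; rewrite mule_ge0// lee_fin.
congr (_ * _)%E; rewrite [LHS]integral_mkcond; apply: eq_integral => x _.
by rewrite patchE indicE; case: ifPn => _; rewrite ?mul1e ?mul0e.
Qed.

Lemma ge0_integral_density (f : T -> \bar R) : measurable_fun setT f ->
  (forall x, 0 <= f x)%E ->
  (\int[wmu]_x f x = \int[mu]_x (f x * (w x)%:E))%E.
Proof.
move=> mf f0; pose f_ := nnsfun_approx measurableT mf.
have cf x : (EFin \o f_ ^~ x @ \oo --> f x)%classic by exact: cvg_nnsfun_approx.
have ndf x (m n : nat) : (m <= n)%N -> f_ m x <= f_ n x.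
  by move=> mn; exact/lefP/nd_nnsfun_approx.
transitivity (limn (fun n => \int[wmu]_x (f_ n x)%:E)%E).
  rewrite -monotone_convergence//=.
  - by apply: eq_integral => x _; apply/esym/cvg_lim => //; exact: cf.
  - by move=> n; exact/measurable_EFinP.
  - by move=> n x _; rewrite lee_fin.
  - by move=> x _ m n mn; rewrite lee_fin ndf.
transitivity (limn (fun n => \int[mu]_x ((f_ n x)%:E * (w x)%:E))%E).
  by congr (limn _); apply/funext => n; exact: integral_density_nnsfun.
rewrite -monotone_convergence//=.
- apply: eq_integral => x _; apply/cvg_lim => //.
  by apply: cvgeMr => //; exact: cf.
- by move=> n; apply: emeasurable_funM => //; exact/measurable_EFinP.
- by move=> n x _; rewrite mule_ge0// lee_fin.
- by move=> x _ m n mn; rewrite lee_wpmul2r// lee_fin// ndf.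
Qed.

End density_integral.

Section beta_density.
Context {R : realType}.
Local Notation lam := (@lebesgue_measure R).
Local Notation mR := (measurableTypeR R).

Lemma is_derive_powR_onem (a u : R) : u < 1 ->
  is_derive u 1 (fun u : R => (1 - u) `^ a) (- (a * (1 - u) `^ (a - 1))).
Proof.
move=> u1; have u1' : 0 < 1 - u by rewrite subr_gt0.
have d1 := is_derive1_powR a u1'.
have d2 : is_derive u 1 (fun u : R => 1 - u) (- 1).
  by apply: is_derive_eq; rewrite add0r mul1r.
by have := @is_derive1_comp R (@powR R ^~ a) (fun u => 1 - u) u _ _ d1 d2; rewrite mulrN1.
Qed.

Lemma continuous_beta_density k (a u : R) : u < 1 ->
  {for u, continuous (fun u : R => u ^+ k * (1 - u) `^ a)}.
Proof.
move=> u1; apply: continuousM; first exact: exprn_continuous.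
apply/differentiable_continuous/derivable1_diffP.
by have [] := is_derive_powR_onem a u1.
Qed.

Lemma integrable_beta_density k (b a : R) : b < 1 ->
  lam.-integrable `[0, b] (EFin \o (fun u : R => u ^+ k * (1 - u) `^ a)).
Proof.
move=> b1; apply: continuous_compact_integrable; first exact: segment_compact.
apply: continuous_in_subspaceT => u; rewrite inE/= in_itv/= => /andP[_ ub].
exact/continuous_beta_density/(le_lt_trans ub).
Qed.

End beta_density.

Section one_particle.
Context {R : realType}.
Local Notation lam := (@lebesgue_measure R).
Local Notation mR := (measurableTypeR R).
Local Notation plane := (R * R)%type.
Local Notation pl := (plane_lebesgue R).
Variables (nu r : R) (r0 : 0 < r) (r1 : r < 1).
Local Notation berg := (bergman_measure nu).

Lemma abs_cplx_sqr (z : plane) : abs (cplx z) ^+ 2 = sqnorm z.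
Proof. by rewrite /abs /cplx /= sqr_sqrtr// addr_ge0 ?sqr_ge0. Qed.

Lemma disc_sqnorm (a : R) (z : plane) : 0 <= a -> disc a z = (sqnorm z < a ^+ 2) :> Prop.
Proof.
by move=> a0; rewrite /disc /= -abs_cplx_sqr ltr_pXn2r// nnegrE abs_ge0.
Qed.

Lemma bergman_weight_sqnorm (z : plane) : sqnorm z < 1 ->
  bergman_weight nu z = (1 - sqnorm z) `^ (2 * nu - 2).
Proof.
move=> z1; rewrite /bergman_weight patchE mem_set ?abs_cplx_sqr//.
by rewrite disc_sqnorm// expr1n.
Qed.

Let r21 : r ^+ 2 < 1. Proof. by rewrite expr_lt1// ltW. Qed.

(** In the variable u = |z|^2 the disc becomes [0, r^2[ and the plane measure pi du: this explains
    the upper bound r^2 in [incbeta]. *)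
Lemma integral_sqnorm_disc k :
  (\int[berg]_z (\1_(disc r) z * sqnorm z ^+ k)%:E =
   (pi * incbeta r k.+1 (2 * nu - 1))%:E)%E.
Proof.
have mrs : measurable_fun [set: plane] (fun z => (\1_(disc r) z * sqnorm z ^+ k)%:E).
  apply/measurable_EFinP/measurable_funM => //; first by apply: measurable_indic; exact: measurable_disc.
  by apply: measurable_funX; exact: measurable_sqnorm.
rewrite ge0_integral_density//; last first.
  by move=> z; rewrite lee_fin mulr_ge0// exprn_ge0// /sqnorm addr_ge0// sqr_ge0.
pose f (u : mR) : \bar R := ((EFin \o (fun u : R => u ^+ k * (1 - u) `^ (2 * nu - 2))) \_ `[0, r ^+ 2[) u.
have mf : measurable_fun [set: mR] f.
  have mI : measurable (`[0, r ^+ 2[%classic : set mR) by exact: measurable_itv.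
  apply/(measurable_restrictT _ mI).
  apply/measurable_EFinP/measurable_funTS/measurable_funM; first exact: measurable_funX.
  by apply: (measurableT_comp (measurable_powR _)); exact: measurable_funB.
have f0 u : (0 <= f u)%E.
  rewrite /f patchE; case: ifPn => //; rewrite inE/= in_itv/= => /andP[u0 _].
  by rewrite lee_fin mulr_ge0 ?powR_ge0// exprn_ge0.
transitivity (\int[pl]_z f (sqnorm z))%E.
  apply: eq_integral => z _; rewrite /f patchE indicE.
  have sq0 : 0 <= sqnorm z by rewrite /sqnorm addr_ge0 ?sqr_ge0.
  have [rz|rz] := boolP (z \in disc r); rewrite -EFinM.
    move: rz; rewrite inE (disc_sqnorm _ (ltW r0)) => rz.
    rewrite mem_set/=; last by rewrite in_itv/= sq0.
    by rewrite mul1r bergman_weight_sqnorm// (lt_trans rz).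
  rewrite memNset ?mul0r//=; rewrite in_itv/= sq0/=.
  by move: rz; rewrite notin_setE (disc_sqnorm _ (ltW r0)).
rewrite ge0_integral_sqnorm// EFinM; congr (_ * _)%E.
have mI (b1 b2 : itv_bound R) : measurable ([set` Interval b1 b2] : set mR) by exact: measurable_itv.
rewrite /f -integral_mkcondr setIidr; last first.
  by move=> u /=; rewrite !in_itv/= andbT => /andP[].
rewrite integral_itv_bndo_bndc; last first.
  apply/measurable_EFinP/measurable_funTS/measurable_funM; first exact: measurable_funX.
  by apply: (measurableT_comp (measurable_powR _)); exact: measurable_funB.
rewrite /incbeta /Rintegral /= fineK.
  apply: eq_integral => u _; congr (_ * _ `^ _)%:E; ring.
apply: integrable_fin_num => //=.
exact: integrable_beta_density.
Qed.

Lemma bergman_measure_disc_lty : (berg (disc r) < +oo)%E.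
Proof.
have := integral_sqnorm_disc 0; under eq_integral do rewrite expr0 mulr1.
rewrite integral_indic ?setIT//; last exact: measurable_disc.
by move=> ->; rewrite ltry.
Qed.

Lemma integrable_indic_disc : berg.-integrable setT (fun z => (\1_(disc r) z)%:E).
Proof.
apply/integrableP; split.
  by apply/measurable_EFinP; apply: measurable_indic; exact: measurable_disc.
under eq_integral do rewrite gee0_abs ?lee_fin//.
rewrite integral_indic ?setIT ?bergman_measure_disc_lty//; exact: measurable_disc.
Qed.

Lemma cmeasurable_cplx : cmeasurable [set: plane] (@cplx R).
Proof. by split; [exact: measurable_fst|exact: measurable_snd]. Qed.

(** With the indicator built in, all integrals run over the whole plane, and the modulus is at most
    that indicator since |z| < r < 1. *)
Definition disc_monomial k l (z : plane) : R[i] :=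
  (\1_(disc r) z)%:C * (cplx z ^+ k * (cplx z ^+ l)^*%C).

Lemma cmeasurable_disc_monomial k l : cmeasurable setT (disc_monomial k l).
Proof.
apply: cmeasurableM.
  by apply: cmeasurable_real; apply: measurable_indic; exact: measurable_disc.
apply: cmeasurableM; first exact/cmeasurableX/cmeasurable_cplx.
exact/cmeasurable_conj/cmeasurableX/cmeasurable_cplx.
Qed.

Lemma absX (z : R[i]) n : abs (z ^+ n) = abs z ^+ n.
Proof.
elim: n => [|n ih]; first by rewrite !expr0 abs_real normr1.
by rewrite !exprS absM ih.
Qed.

Lemma abs_conj (z : R[i]) : abs z^*%C = abs z.
Proof. by case: z => a b; rewrite /abs /= sqrrN. Qed.

Lemma abs_disc_monomial k l z : abs (disc_monomial k l z) <= \1_(disc r) z.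
Proof.
rewrite absM abs_real ger0_norm//.
rewrite indicE; case: (boolP (z \in disc r)) => [|_]; last by rewrite mul0r.
rewrite inE /disc/= => rz; rewrite mul1r absM abs_conj !absX -exprD.
by rewrite exprn_ile1// ?abs_ge0// ltW// (lt_trans rz).
Qed.

Lemma cintegrable_disc_monomial k l : cintegrable berg setT (disc_monomial k l).
Proof.
apply: (cintegrable_le (cmeasurable_disc_monomial k l) integrable_indic_disc).
exact: abs_disc_monomial.
Qed.

Lemma cintegral_disc_monomial_diag k :
  cintegral berg setT (disc_monomial k k) = (pi * incbeta r k.+1 (2 * nu - 1))%:C.
Proof.
have E z : disc_monomial k k z = (\1_(disc r) z * sqnorm z ^+ k)%:C.
  rewrite /disc_monomial rmorphM; congr (_ * _).
  rewrite rmorphXn -exprMn rmorphXn; congr (_ ^+ _).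
  by rewrite /cplx /sqnorm; apply/eqP; rewrite eq_complex/=; apply/andP; split; apply/eqP; ring.
rewrite /cintegral; congr (_ +i* _).
  by under eq_Rintegral do rewrite E; rewrite /Rintegral /= integral_sqnorm_disc.
under eq_Rintegral do rewrite E/=.
by rewrite Rintegral_cst// mul0r.
Qed.

End one_particle.

Section orthogonality.
Context {R : realType}.
Local Notation plane := (R * R)%type.
Local Notation C := R[i].

Lemma cplx_rotation (c s : R) (z : plane) :
  cplx (rotation c s z) = (c +i* s) * cplx z.
Proof.
by apply/eqP; rewrite /cplx /rotation eq_complex/= [c * z.2 + _]addrC !eqxx.
Qed.

(* The rational parametrization of the circle provides infinitely many points,
   while [X^k - X^l] has finitely many roots. *)
Lemma unit_circle_expr_neq k l : k != l -> exists c s : R,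
  [/\ c ^+ 2 + s ^+ 2 = 1, c != -1 &
      (c +i* s) ^+ k * (((c +i* s) ^+ l)^*)%C != 1 :> C].
Proof.
move=> kl.
pose c (t : nat) : R := (1 - t%:R ^+ 2) / (1 + t%:R ^+ 2).
pose s (t : nat) : R := 2 * t%:R / (1 + t%:R ^+ 2).
have d0 t : 1 + t%:R ^+ 2 != 0 :> R by rewrite gt_eqF// ltr_wpDr ?sqr_ge0.
have cs t : c t ^+ 2 + s t ^+ 2 = 1 by rewrite /c /s; field.
have c1 t : c t + 1 != 0.
  have -> : c t + 1 = 2 / (1 + t%:R ^+ 2) by rewrite /c; field.
  by rewrite mulf_neq0 ?invr_eq0.
(* The parameter is recovered from the point, so the points are pairwise distinct. *)
have sc t : s t / (c t + 1) = t%:R.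
  rewrite (_ : c t + 1 = 2 / (1 + t%:R ^+ 2)); last by rewrite /c; field.
  by rewrite /s; field.
pose e t : C := c t +i* s t.
have einj : injective e.
  move=> t t' [ct st]; have := sc t; rewrite ct st sc => /eqP.
  by rewrite eqr_nat => /eqP.
have ee t : e t * (e t)^*%C = 1.
  apply/eqP; rewrite eq_complex/=; apply/andP; split; apply/eqP; last by ring.
  by rewrite -(cs t); ring.
pose p : {poly C} := 'X^k - 'X^l.
have p0 : p != 0.
  apply/eqP => /(congr1 (fun q : {poly C} => q`_k)); rewrite coefB !coefXn coef0 eqxx (negbTE kl).
  by rewrite subr0 => /eqP; rewrite oner_eq0.
have [t tp] : exists t, ~~ root p (e t).
  apply: contrapT => /forallNP h.
  have ar : all (root p) (map e (iota 0 (size p))).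
    by apply/allP => x /mapP[t _ ->]; apply/negPn/negP; exact: h.
  have := max_poly_roots p0 ar.
  by rewrite map_inj_uniq// iota_uniq size_map size_iota ltnn => /(_ isT).
exists (c t), (s t); split=> //; first by rewrite -subr_eq0 opprK.
(* Multiplying by e^l, where e times conj e is 1, turns the equation into e^k = e^l. *)
apply: contra tp => /eqP h; rewrite rootE !hornerE subr_eq0; apply/eqP.
have : e t ^+ k * ((e t ^+ l)^*)%C * e t ^+ l = e t ^+ l by rewrite h mul1r.
rewrite -mulrA [X in _ * X]mulrC.
by rewrite rmorphXn -exprMn ee expr1n mulr1.
Qed.

Variables (nu r : R) (r0 : 0 < r) (r1 : r < 1).
Local Notation berg := (bergman_measure nu).

Lemma sqnorm_rotation (c s : R) (z : plane) : c ^+ 2 + s ^+ 2 = 1 ->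
  sqnorm (rotation c s z) = sqnorm z.
Proof.
move=> cs; rewrite /sqnorm /rotation /=.
transitivity ((c ^+ 2 + s ^+ 2) * (z.1 ^+ 2 + z.2 ^+ 2)); first by ring.
by rewrite cs mul1r.
Qed.

Lemma bergman_measure_rotation (c s : R) A :
  c ^+ 2 + s ^+ 2 = 1 -> c != -1 -> measurable A ->
  berg A = berg (rotation c s @^-1` A).
Proof.
move=> cs c1 mA; rewrite /bergman_measure /= /density.
rewrite integral_mkcond [RHS]integral_mkcond.
have m : measurable_fun setT ((fun x => (bergman_weight nu x)%:E) \_ A).
  apply/(measurable_restrictT _ mA)/measurable_funTS/measurable_EFinP.
  exact: measurable_bergman_weight.
have f0 z : (0 <= ((fun x => (bergman_weight nu x)%:E) \_ A) z)%E.
  by rewrite patchE; case: ifP => // _; rewrite lee_fin bergman_weight_ge0.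
have pres B : measurable B ->
    plane_lebesgue R B = plane_lebesgue R (rotation c s @^-1` B).
  exact: plane_lebesgue_rotation.
apply: (etrans (ge0_integral_preserving (measurable_rotation c s) pres m f0)).
apply: eq_integral => z _; rewrite !patchE.
have -> : (z \in rotation c s @^-1` A) = (rotation c s z \in A) by apply/idP/idP; rewrite !inE.
case: ifP => // _; congr EFin; rewrite /bergman_weight !patchE.
have -> : (rotation c s z \in disc 1) = (z \in disc 1).
  by apply/idP/idP; rewrite !inE !disc_sqnorm// ?sqnorm_rotation//.
by rewrite !abs_cplx_sqr sqnorm_rotation.
Qed.

(** A rotation preserves the measure and multiplies the integrand by a constant, hence the integral
    too. One rotation whose constant differs from 1 forces the value 0, without any angular
    integration. *)
Lemma cintegral_disc_monomial_neq k l : k != l ->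
  cintegral berg setT (disc_monomial r k l) = 0.
Proof.
move=> kl; have [c [s [cs c1 e1]]] := unit_circle_expr_neq kl.
set e := (c +i* s) ^+ k * _ in e1.
have h : cintegral berg setT (disc_monomial r k l) =
    e * cintegral berg setT (disc_monomial r k l).
  rewrite -(cintegralZ _ (cintegrable_disc_monomial _ r0 r1 k l)).
  rewrite {1}(cintegral_preserving (measurable_rotation c s)
    (fun A mA => bergman_measure_rotation cs c1 mA) (cmeasurable_disc_monomial r k l)).
  congr cintegral; apply/funext => z /=; rewrite /disc_monomial.
  have -> : \1_(disc r) (rotation c s z) = \1_(disc r) z :> R.
    rewrite !indicE; congr (_%:R); congr nat_of_bool.
    by apply/idP/idP; rewrite !inE !disc_sqnorm ?sqnorm_rotation// ltW.
  have key (a b i x y : C) : i * (a * b * (x * y)) = a * x * (i * (b * y)) by ring.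
  by rewrite cplx_rotation !exprMn [((_ * _)^*)%C]rmorphM key.
apply/eqP; have /eqP := h; rewrite -subr_eq0 -{1}[cintegral _ _ _]mul1r -mulrBl mulf_eq0.
by rewrite subr_eq0 eq_sym (negbTE e1).
Qed.

End orthogonality.

(** * The binomial series and the Bergman kernel *)

Section complex_convergence.
Context {R : realType}.
Local Notation C := R[i].
Implicit Types (u v : nat -> C) (l m : C).

(** Componentwise, so that the real theorems on power series and dominated convergence apply
    directly. *)
Definition ccvg u l : Prop :=
  (complex.Re (u n) @[n --> \oo] --> complex.Re l) /\
  (complex.Im (u n) @[n --> \oo] --> complex.Im l).

Lemma ccvg_cst l : ccvg (fun=> l) l.
Proof. by split; exact: cvg_cst. Qed.

Lemma ccvgD u v l m : ccvg u l -> ccvg v m -> ccvg (fun n => u n + v n) (l + m).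
Proof.
move=> [ru iu] [rv iv]; split.
  by rewrite ReD; under eq_fun do rewrite ReD; exact: cvgD.
by rewrite ImD; under eq_fun do rewrite ImD; exact: cvgD.
Qed.

Lemma ccvgM u v l m : ccvg u l -> ccvg v m -> ccvg (fun n => u n * v n) (l * m).
Proof.
move=> [ru iu] [rv iv]; split.
  rewrite ReM; under eq_fun do rewrite ReM.
  by apply: cvgB; exact: cvgM.
rewrite ImM; under eq_fun do rewrite ImM.
by apply: cvgD; exact: cvgM.
Qed.

Lemma ccvg_sum I (s : seq I) (F : I -> nat -> C) (l : I -> C) :
  (forall i, ccvg (F i) (l i)) ->
  ccvg (fun n => \sum_(i <- s) F i n) (\sum_(i <- s) l i).
Proof.
move=> cF; elim: s => [|i s ih].
  by rewrite big_nil; under [X in ccvg X]eq_fun do rewrite big_nil; exact: ccvg_cst.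
by rewrite big_cons; under [X in ccvg X]eq_fun do rewrite big_cons; exact: ccvgD.
Qed.

Lemma ccvg_prod I (s : seq I) (F : I -> nat -> C) (l : I -> C) :
  (forall i, ccvg (F i) (l i)) ->
  ccvg (fun n => \prod_(i <- s) F i n) (\prod_(i <- s) l i).
Proof.
move=> cF; elim: s => [|i s ih].
  by rewrite big_nil; under [X in ccvg X]eq_fun do rewrite big_nil; exact: ccvg_cst.
by rewrite big_cons; under [X in ccvg X]eq_fun do rewrite big_cons; exact: ccvgM.
Qed.

Lemma ccvg_unique u l m : ccvg u l -> ccvg u m -> l = m.
Proof.
move=> [r1 i1] [r2 i2]; apply/eqP; rewrite eq_complex; apply/andP; split; apply/eqP.
  exact: (cvg_unique _ r1 r2).
exact: (cvg_unique _ i1 i2).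
Qed.

End complex_convergence.

Section binomial_coefficients.
Context {R : realType}.
Implicit Types a x : R.

(* The coefficients of the power series of [(1 - x) ^ (- a)]. *)
Definition rbinom a k : R := pochhammer a k / k`!%:R.

Lemma rbinom_ge0 a k : 0 <= a -> 0 <= rbinom a k.
Proof.
move=> a0; rewrite divr_ge0// /pochhammer prodr_ge0// => i _.
by rewrite addr_ge0.
Qed.

Lemma rbinom0 a : rbinom a 0 = 1.
Proof. by rewrite /rbinom /pochhammer big_ord0 fact0 divr1. Qed.

Lemma rbinomS a k : k.+1%:R * rbinom a k.+1 = (a + k%:R) * rbinom a k.
Proof.
rewrite /rbinom /pochhammer big_ord_recr/= factS natrM.
have f0 : k`!%:R != 0 :> R by rewrite pnatr_eq0 -lt0n fact_gt0.
have k0 : k.+1%:R != 0 :> R by rewrite pnatr_eq0.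
move: f0 k0; move: (k`!%:R) (k.+1%:R) => f n f0 n0.
by field; rewrite f0 n0.
Qed.

(** On coefficients, this is the derivative of (1 - x)^(-a) being a (1 - x)^(-a-1): differentiation
    stays within the family. *)
Lemma rbinomSS a k : k.+1%:R * rbinom a k.+1 = a * rbinom (a + 1) k.
Proof.
rewrite rbinomS /rbinom !mulrA; congr (_ / _).
elim: k => [|k ih]; first by rewrite /pochhammer !big_ord0 addr0 mulr1.
rewrite {1}/pochhammer big_ord_recr/= -/(pochhammer a k).
rewrite [X in _ * X]mulrC ih.
rewrite /pochhammer [in RHS]big_ord_recr/= -/(pochhammer (a + 1) k).
by rewrite -addn1 natrD; ring.
Qed.

(** Each of the first [k0] terms is absorbed by enlarging the constant; shifting the sequence back
    by one is harmless because q >= 1. *)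
Lemma ratio_bound (u : nat -> R) (q : R) k0 : (forall k, 0 <= u k) -> 1 <= q ->
  (forall k, (k0 <= k)%N -> u k.+1 <= q * u k) ->
  exists c, forall k, u k <= c * q ^+ k.
Proof.
elim: k0 u => [|k0 ih] u u0 q1 uq.
  exists (u 0%N); elim=> [|k h]; first by rewrite expr0 mulr1.
  by rewrite (le_trans (uq _ _))// exprS mulrCA ler_wpM2l// (le_trans ler01).
have [c hc] := ih (fun k => u k.+1) (fun k => u0 _) q1 (fun k hk => uq k.+1 hk).
have c0 : 0 <= c by have := hc 0%N; rewrite expr0 mulr1; exact: le_trans.
exists (u 0%N + c) => -[|k]; first by rewrite expr0 mulr1 lerDl.
have qk : 0 <= q ^+ k by rewrite exprn_ge0// (le_trans ler01).
rewrite (le_trans (hc k))// mulrDl ler_wpDl//.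
  by rewrite mulr_ge0// exprn_ge0// (le_trans ler01).
by rewrite ler_wpM2l// exprS ler_peMl.
Qed.

Lemma is_cvg_series_rbinom a x : 0 <= a -> 0 <= x -> x < 1 ->
  cvgn (series (fun k => rbinom a k * x ^+ k)).
Proof.
(* This ratio exceeds 1, the limit of the quotients (a + k) / (k + 1), and still satisfies q x <
   1. *)
move=> a0 x0 x1; set q := 2 / (1 + x).
have q1 : 1 < q by rewrite ltr_pdivlMr; lra.
have qx : q * x < 1 by rewrite mulrAC ltr_pdivrMr; lra.
(* The inequality a + k <= q (k + 1) amounts to (a - q) / (q - 1) <= k. *)
have [k0 hk0] : exists k0 : nat, (a - q) / (q - 1) <= k0%:R.
  by exists (Num.truncn ((a - q) / (q - 1))).+1; exact/ltW/truncnS_gt.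
have [c hc] : exists c, forall k, rbinom a k <= c * q ^+ k.
  apply: (@ratio_bound _ _ k0) => [k||k hk]; [exact: rbinom_ge0|exact: ltW|].
  have k0' : 0 < k.+1%:R :> R by rewrite ltr0n.
  rewrite -(ler_pM2l k0') rbinomS [leRHS]mulrA ler_wpM2r ?rbinom_ge0//.
  have hk' : (a - q) / (q - 1) <= k%:R by rewrite (le_trans hk0)// ler_nat.
  rewrite ler_pdivrMr in hk'; last by lra.
  by rewrite -(natr1 k); nra.
apply: (@series_le_cvg _ _ (fun k => c * (q * x) ^+ k)).
- by move=> k; rewrite mulr_ge0 ?rbinom_ge0// exprn_ge0.
- move=> k; rewrite mulr_ge0//; last by rewrite exprn_ge0// mulr_ge0// ltW// (lt_trans ltr01).
  by have := hc 0%N; rewrite rbinom0 expr0 mulr1; apply: le_trans.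
- by move=> k; rewrite exprMn [leRHS]mulrA ler_wpM2r ?exprn_ge0.
- apply: is_cvg_geometric_series.
  by rewrite ger0_norm// mulr_ge0// ltW// (lt_trans ltr01).
Qed.

End binomial_coefficients.

Section principal_power.
Context {R : realType}.
Local Notation C := R[i].

(** The definition by [acos] splits on the sign of the imaginary part; on the right half-plane a
    single differentiable formula replaces it. *)
Lemma carg_right_half (x y : R) : 0 < x -> carg (x +i* y) = atan (y / x).
Proof.
move=> x0; have acosE (v : R) : 0 <= v -> acos (x / abs (x +i* v)) = atan (v / x).
  move=> v0; have -> : x / abs (x +i* v) = cos (atan (v / x)).
    have -> : abs (x +i* v) = x * Num.sqrt (1 + (v / x) ^+ 2).
      rewrite -[X in X * _](gtr0_norm x0) -sqrtr_sqr -sqrtrM ?sqr_ge0//.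
      by congr Num.sqrt; rewrite /=; field; exact: lt0r_neq0.
    by rewrite cos_atan invfM mulrA divff ?mul1r// lt0r_neq0.
  rewrite cosK// in_itv/= (le_trans (ltW (atan_ltpi2 _)))//; last first.
    by rewrite ler_pdivrMr// ler_peMr ?pi_ge0// ler1n.
  by rewrite andbT; rewrite -atan0 le_atan// divr_ge0// ltW.
rewrite /carg -[complex.Im _]/y -[complex.Re _]/x; case: ifPn => [/acosE//|]; rewrite -ltNge => y0.
have -> : abs (x +i* y) = abs (x +i* (- y)) by rewrite /abs /= sqrrN.
by rewrite acosE ?oppr_ge0 1?ltW// mulNr atanN opprK.
Qed.

(** |w|^a for w = x + iy, written without the square root so as to be easily differentiated. *)
Definition pow_modulus (a x y : R) : R := expR (a / 2 * ln (x ^+ 2 + y ^+ 2)).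
Definition pow_argument (a x y : R) : R := a * atan (y / x).

Lemma cpow_right_half (a x y : R) : 0 < x -> cpow (x +i* y) a =
  (pow_modulus a x y * cos (pow_argument a x y)) +i*
  (pow_modulus a x y * sin (pow_argument a x y)).
Proof.
move=> x0; have n20 : 0 < x ^+ 2 + y ^+ 2 by rewrite ltr_pwDl ?sqr_ge0// exprn_gt0.
have -> : pow_modulus a x y = abs (x +i* y) `^ a.
  rewrite /pow_modulus /powR gt_eqF ?sqrtr_gt0//; congr expR.
  rewrite -{1}(sqr_sqrtr (ltW n20)) lnXn ?sqrtr_gt0//.
  by rewrite -[ln _ *+ 2]mulr_natl mulrA divfK.
rewrite /cpow carg_right_half// -/(pow_argument a x y).
by apply/eqP; rewrite eq_complex/= !mul0r subr0 addr0 !eqxx.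
Qed.

(* [w ^ a] along a curve [w] satisfies [(w ^ a)' = a (w' / w) w ^ a]. *)
Lemma is_derive_pow (x y : R -> R) (x' y' a t : R) : 0 < x t ->
  is_derive t 1 x x' -> is_derive t 1 y y' ->
  let n2 := x t ^+ 2 + y t ^+ 2 in
  let l1 := a * (x t * x' + y t * y') / n2 in
  let l2 := a * (x t * y' - y t * x') / n2 in
  let g1 u := pow_modulus a (x u) (y u) * cos (pow_argument a (x u) (y u)) in
  let g2 u := pow_modulus a (x u) (y u) * sin (pow_argument a (x u) (y u)) in
  is_derive t 1 g1 (l1 * g1 t - l2 * g2 t) /\
  is_derive t 1 g2 (l1 * g2 t + l2 * g1 t).
Proof.
move=> x0 dx dy n2 l1 l2 g1 g2.
pose r u := pow_modulus a (x u) (y u).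
pose th u := pow_argument a (x u) (y u).
have n20 : 0 < n2 by rewrite ltr_pwDl ?sqr_ge0// exprn_gt0.
have dr : is_derive t 1 r (l1 * r t).
  have dn : is_derive t 1 (fun u => x u ^+ 2 + y u ^+ 2) (2 * (x t * x' + y t * y')).
    by apply: is_derive_eq; rewrite /GRing.scale/=; ring.
  have dl := @is_derive1_comp R (@ln R) (fun u => x u ^+ 2 + y u ^+ 2) t _ _ (is_derive1_ln n20) dn.
  have dal : is_derive t 1 (fun u => a / 2 * ln (x u ^+ 2 + y u ^+ 2)) l1.
    apply: is_derive_eq (is_deriveZ (a / 2) dl) _; rewrite /GRing.scale/= /l1.
    by rewrite -/n2; move/lt0r_neq0 : n20 => n20; field.
  by rewrite [l1 * _]mulrC; exact: (@is_derive1_comp R expR _ t _ _ (is_derive_expR _) dal).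
have dth : is_derive t 1 th l2.
  have xn0 := lt0r_neq0 x0.
  have dq : is_derive t 1 (fun u => y u / x u) ((x t * y' - y t * x') / x t ^+ 2).
    apply: (is_derive_eq (is_deriveM dy (is_deriveV xn0 dx))).
    by rewrite /GRing.scale/=; field.
  have da := @is_derive1_comp R (@atan R) (fun u => y u / x u) t _ _ (is_derive1_atan _) dq.
  apply: is_derive_eq (is_deriveZ a da) _; rewrite /GRing.scale/= /l2.
  move/lt0r_neq0 : n20; rewrite /n2 => n20; field; rewrite n20 xn0.
  by [].
have dc := @is_derive1_comp R (@cos R) th t _ _ (is_derive_cos _) dth.
have ds := @is_derive1_comp R (@sin R) th t _ _ (is_derive_sin _) dth.
split.
  apply: is_derive_eq (is_deriveM dr dc) _; rewrite /GRing.scale/=.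
  by rewrite /g1 /g2 -/(r t) -/(th t); ring.
apply: is_derive_eq (is_deriveM dr ds) _; rewrite /GRing.scale/=.
by rewrite /g1 /g2 -/(r t) -/(th t); ring.
Qed.

End principal_power.

Section binomial_power_series.
Context {R : realType}.
Local Notation C := R[i].
Variables (zeta : C) (zeta1 : abs zeta < 1).
Local Notation rho := (abs zeta).
Implicit Types (a M t : R) (c : nat -> R).

(** A radius K > 1 with K rho < 1: the series in t converges beyond the segment [0, 1], so it is
    differentiable even at the endpoint t = 1. *)
Let K : R := 2 / (1 + rho).

Let rho0 : 0 <= rho. Proof. exact: abs_ge0. Qed.

Let K1 : 1 < K. Proof. by rewrite /K ltr_pdivlMr; have := zeta1; have := rho0; lra. Qed.

(** Comparison with the coefficients of M (1 - rho t)^(-a). Unlike mere convergence, it passes to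
    the differentiated series, at the cost of replacing a by a + 1. *)
Let dominated a M c := forall k, `|c k| <= M * (rbinom a k * rho ^+ k).

Let dominated_diffs a M c : dominated a M c ->
  dominated (a + 1) (M * a * rho) (pseries_diffs c).
Proof.
move=> dc k; rewrite /pseries_diffs normrM ger0_norm//.
rewrite (le_trans (ler_wpM2l _ (dc k.+1)))// exprS.
have -> : k.+1%:R * (M * (rbinom a k.+1 * (rho * rho ^+ k))) =
  k.+1%:R * rbinom a k.+1 * (M * rho * rho ^+ k) by ring.
have -> // : k.+1%:R * rbinom a k.+1 * (M * rho * rho ^+ k) =
  M * a * rho * (rbinom (a + 1) k * rho ^+ k) by rewrite rbinomSS; ring.
Qed.

Let dominated_cvg a M c : 0 <= a -> dominated a M c -> cvgn (pseries c K).
Proof.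
move=> a0 dc; have Krho : K * rho < 1.
  by rewrite /K mulrAC ltr_pdivrMr; have := rho0; have := zeta1; lra.
have K0 : 0 <= K by rewrite ltW// (lt_trans _ K1).
apply: normed_cvg; apply: (@series_le_cvg _ _ (fun k => M * (rbinom a k * (K * rho) ^+ k))).
- by move=> k; exact: normr_ge0.
- move=> k; rewrite mulr_ge0//; last first.
    by rewrite mulr_ge0 ?rbinom_ge0// exprn_ge0// mulr_ge0.
  by have := dc 0%N; rewrite rbinom0 expr0 !mulr1; apply: le_trans.
- move=> k; rewrite /= normrM (ger0_norm (exprn_ge0 _ K0)) (exprMn k K rho).
  rewrite (le_trans (ler_wpM2r _ (dc k))) ?exprn_ge0//.
  by rewrite [X in _ <= _ * (_ * X)]mulrC !mulrA.
- apply: is_cvg_seriesZ; apply: is_cvg_series_rbinom => //.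
  exact: mulr_ge0.
Qed.

Let dominated_cvg_in a M c t : 0 <= a -> dominated a M c -> `|t| <= 1 ->
  cvgn (pseries c t).
Proof.
move=> a0 dc t1; apply: (is_cvg_pseries_inside (dominated_cvg a0 dc)).
by rewrite (le_lt_trans t1)// (lt_le_trans K1)// ler_norm.
Qed.

Let dominated_derive a M c t : 0 <= a -> dominated a M c -> `|t| <= 1 ->
  is_derive t 1 (fun t => limn (pseries c t)) (limn (pseries (pseries_diffs c) t)).
Proof.
move=> a0 dc t1; apply: (@pseries_snd_diffs _ c K).
- exact: (dominated_cvg _ dc).
- by apply: (dominated_cvg _ (dominated_diffs dc)); lra.
- by apply: (dominated_cvg _ (dominated_diffs (dominated_diffs dc))); lra.
- by rewrite (le_lt_trans t1)// (lt_le_trans K1)// ler_norm.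
Qed.

Variables (a : R) (a0 : 0 <= a).

Let cf k : C := (rbinom a k)%:C * zeta ^+ k.
Let cR k := complex.Re (cf k).
Let cI k := complex.Im (cf k).

Let abs_cf k : abs (cf k) = 1 * (rbinom a k * rho ^+ k).
Proof. by rewrite mul1r /cf absM abs_real ger0_norm ?rbinom_ge0// absX. Qed.

Let dR : dominated a 1 cR.
Proof. by move=> k; rewrite (le_trans (le_Re_abs _))// abs_cf. Qed.

Let dI : dominated a 1 cI.
Proof. by move=> k; rewrite (le_trans (le_Im_abs _))// abs_cf. Qed.

(** The binomial series at t zeta as a function of the real variable t; [f'] is its derivative, and
    [F], [G] below are their partial sums. *)
Let f t : C := limn (pseries cR t) +i* limn (pseries cI t).
Let f' t : C := limn (pseries (pseries_diffs cR) t) +i* limn (pseries (pseries_diffs cI) t).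

Let F n t : C := \sum_(k < n) cf k * t%:C ^+ k.
Let G n t : C := \sum_(k < n) (k.+1%:R * cf k.+1) * t%:C ^+ k.

Let Re_real (x : R) (z : C) : complex.Re (z * x%:C) = complex.Re z * x.
Proof. by rewrite ReM /= mulr0 subr0. Qed.

Let Im_real (x : R) (z : C) : complex.Im (z * x%:C) = complex.Im z * x.
Proof. by rewrite ImM /= mulr0 add0r. Qed.

Let Re_sum n (u : nat -> C) : complex.Re (\sum_(k < n) u k) = \sum_(k < n) complex.Re (u k).
Proof. by elim: n => [|n ih]; [rewrite !big_ord0|rewrite !big_ord_recr/= ReD ih]. Qed.

Let Im_sum n (u : nat -> C) : complex.Im (\sum_(k < n) u k) = \sum_(k < n) complex.Im (u k).
Proof. by elim: n => [|n ih]; [rewrite !big_ord0|rewrite !big_ord_recr/= ImD ih]. Qed.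

Let ccvgF t : `|t| <= 1 -> ccvg (F ^~ t) (f t).
Proof.
move=> t1; split.
  rewrite (_ : (fun n => _) = pseries cR t); first exact: (dominated_cvg_in a0 dR).
  apply/funext => n; rewrite /F (Re_sum n (fun k => cf k * t%:C ^+ k)) /pseries /series/= big_mkord.
  by apply: eq_bigr => k _; rewrite -rmorphXn Re_real.
rewrite (_ : (fun n => _) = pseries cI t); first exact: (dominated_cvg_in a0 dI).
apply/funext => n; rewrite /F (Im_sum n (fun k => cf k * t%:C ^+ k)) /pseries /series/= big_mkord.
by apply: eq_bigr => k _; rewrite -rmorphXn Im_real.
Qed.

Let ccvgG t : `|t| <= 1 -> ccvg (G ^~ t) (f' t).
Proof.
move=> t1; have a1 : 0 <= a + 1 by rewrite addr_ge0.
have nat_real k : k.+1%:R = (k.+1%:R)%:C :> C by rewrite rmorph_nat.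
split.
  rewrite (_ : (fun n => _) = pseries (pseries_diffs cR) t).
    exact: (dominated_cvg_in a1 (dominated_diffs dR)).
  apply/funext => n; rewrite /G (Re_sum n (fun k => k.+1%:R * cf k.+1 * t%:C ^+ k)) /pseries /series/= big_mkord.
  apply: eq_bigr => k _; rewrite -rmorphXn Re_real nat_real [_ * cf _]mulrC Re_real.
  by rewrite /pseries_diffs [X in _ = X * _]mulrC.
rewrite (_ : (fun n => _) = pseries (pseries_diffs cI) t).
  exact: (dominated_cvg_in a1 (dominated_diffs dI)).
apply/funext => n; rewrite /G (Im_sum n (fun k => k.+1%:R * cf k.+1 * t%:C ^+ k)) /pseries /series/= big_mkord.
apply: eq_bigr => k _; rewrite -rmorphXn Im_real nat_real [_ * cf _]mulrC Im_real.
by rewrite /pseries_diffs [X in _ = X * _]mulrC.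
Qed.

Let cfS k : k.+1%:R * cf k.+1 = (a%:C + k%:R) * zeta * cf k.
Proof.
rewrite /cf exprS -(rmorph_nat (real_complex R) k.+1) -(rmorph_nat (real_complex R) k).
rewrite mulrA -rmorphM rbinomS rmorphM rmorphD; ring.
Qed.

(** The equation (1 - t zeta) f' = a zeta f on partial sums. Taking one term fewer in the second [G]
    makes it exact, with no remainder to estimate. *)
Let FG n t : G n.+1 t - t%:C * zeta * G n t = a%:C * zeta * F n.+1 t.
Proof.
elim: n => [|n ih].
  rewrite /G /F !big_ord_recr !big_ord0 /= cfS.
  by rewrite expr0 !mulr1 !add0r addr0 mulr0 subr0.
rewrite /G /F [in X in X - _]big_ord_recr [in X in _ - X]big_ord_recr [in RHS]big_ord_recr/=.
rewrite -/(G n.+1 t) -/(G n t) -/(F n.+1 t) mulrDr [X in _ = X]mulrDr -ih.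
by rewrite exprS (cfS n.+1); ring.
Qed.

Let ccvgS (u : nat -> C) l : ccvg u l -> ccvg (fun n => u n.+1) l.
Proof.
move=> [ru iu]; split.
  by have := ru; rewrite -(cvg_shiftS (fun n => complex.Re (u n))).
by have := iu; rewrite -(cvg_shiftS (fun n => complex.Im (u n))).
Qed.

Let ode t : `|t| <= 1 -> (1 - t%:C * zeta) * f' t = a%:C * zeta * f t.
Proof.
move=> t1; rewrite mulrBl mul1r.
apply: (@ccvg_unique _ (fun n => G n.+1 t - t%:C * zeta * G n t)).
  rewrite -mulNr; under [X in ccvg X]eq_fun do rewrite -mulNr.
  apply: ccvgD; first exact: (ccvgS (ccvgG t1)).
  by apply: ccvgM; [exact: ccvg_cst|exact: ccvgG].
under [X in ccvg X]eq_fun do rewrite FG.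
by apply: ccvgM; [exact: ccvg_cst|exact: (ccvgS (ccvgF t1))].
Qed.

Let xi := complex.Re zeta.
Let eta := complex.Im zeta.
Let x (t : R) : R := 1 - t * xi.
Let y (t : R) : R := - (t * eta).

Let onem_zeta t : 1 - t%:C * zeta = x t +i* y t.
Proof.
rewrite /x /y /xi /eta; case: (zeta) => p q.
by apply/eqP; rewrite eq_complex/= !mul0r subr0 addr0 sub0r !eqxx.
Qed.

Let x_gt0 t : `|t| <= 1 -> 0 < x t.
Proof.
move=> t1; rewrite /x subr_gt0 (le_lt_trans (ler_norm _))// normrM.
rewrite (le_lt_trans (ler_piMl _ t1))//.
exact: (le_lt_trans (le_Re_abs _) zeta1).
Qed.

Let f1 t := limn (pseries cR t).
Let f2 t := limn (pseries cI t).
Let g1 t := pow_modulus a (x t) (y t) * cos (pow_argument a (x t) (y t)).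
Let g2 t := pow_modulus a (x t) (y t) * sin (pow_argument a (x t) (y t)).

(** Real and imaginary parts of the product of f(t) and w^a, where w = 1 - t zeta: the logarithmic
    derivatives a zeta / w and - a zeta / w cancel. *)
Let derive_fg t : `|t| <= 1 ->
  is_derive t 1 (f1 \* g1 - f2 \* g2) 0 /\ is_derive t 1 (f1 \* g2 + f2 \* g1) 0.
Proof.
move=> t1.
have dx : is_derive t 1 x (- xi) by apply: is_derive_eq; rewrite /GRing.scale/=; ring.
have dy : is_derive t 1 y (- eta) by apply: is_derive_eq; rewrite /GRing.scale/=; ring.
have [dg1 dg2] := @is_derive_pow R x y _ _ a t (x_gt0 t1) dx dy.
have df1 : is_derive t 1 f1 (complex.Re (f' t)) by exact: (dominated_derive a0 dR t1).
have df2 : is_derive t 1 f2 (complex.Im (f' t)) by exact: (dominated_derive a0 dI t1).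
have := ode t1; rewrite onem_zeta => o.
have n20 : x t ^+ 2 + y t ^+ 2 != 0.
  by rewrite gt_eqF// ltr_pwDl ?sqr_ge0// exprn_gt0// x_gt0.
have o1 : x t * complex.Re (f' t) - y t * complex.Im (f' t) = a * (xi * f1 t - eta * f2 t).
  move/(congr1 (@complex.Re R)) : o; rewrite !ReM ImM /= => ->.
  by rewrite /xi /eta /f1 /f2; ring.
have o2 : x t * complex.Im (f' t) + y t * complex.Re (f' t) = a * (xi * f2 t + eta * f1 t).
  move/(congr1 (@complex.Im R)) : o; rewrite !ImM ReM /= => ->.
  by rewrite /xi /eta /f1 /f2; ring.
move: (complex.Re (f' t)) (complex.Im (f' t)) df1 df2 o1 o2 => F1 F2 df1 df2 o1 o2 {o}.
(* The equation is solved for f' by multiplying by conj w / |w|^2. *)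
have e1 : F1 = a * (x t * (xi * f1 t - eta * f2 t) + y t * (xi * f2 t + eta * f1 t)) / (x t ^+ 2 + y t ^+ 2).
  apply: (mulIf n20); rewrite divfK//.
  transitivity (x t * (x t * F1 - y t * F2) +
    y t * (x t * F2 + y t * F1)); first by ring.
  by rewrite o1 o2; ring.
have e2 : F2 = a * (x t * (xi * f2 t + eta * f1 t) - y t * (xi * f1 t - eta * f2 t)) / (x t ^+ 2 + y t ^+ 2).
  apply: (mulIf n20); rewrite divfK//.
  transitivity (x t * (x t * F2 + y t * F1) -
    y t * (x t * F1 - y t * F2)); first by ring.
  by rewrite o1 o2; ring.
split.
  apply: (is_derive_eq (is_deriveB (is_deriveM df1 dg1) (is_deriveM df2 dg2))).
  rewrite /GRing.scale/= e1 e2 -/(g1 t) -/(g2 t); field.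
  by [].
apply: (is_derive_eq (is_deriveD (is_deriveM df1 dg2) (is_deriveM df2 dg1))).
rewrite /GRing.scale/= e1 e2 -/(g1 t) -/(g2 t); field.
by [].
Qed.

Let constant01 (h : R -> R) : (forall t, `|t| <= 1 -> is_derive t 1 h 0) -> h 1 = h 0.
Proof.
move=> dh; have [||c _] := @MVT R h (fun=> 0) 0 1 ltr01.
- by move=> u; rewrite in_itv/= => /andP[u0 u1]; apply: dh; rewrite ger0_norm ltW.
- apply: derivable_within_continuous => u; rewrite in_itv/= => /andP[u0 u1].
  by have [] := dh u; rewrite ?ger0_norm.
- by rewrite mul0r => /eqP; rewrite subr_eq0 => /eqP.
Qed.

(** The product of f(t) and (1 - t zeta)^a is constant on [0, 1] and equals 1 at t = 0; the value at
    t = 1 identifies f(1) as the inverse of the principal power. *)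
Lemma binomial_series :
  ccvg (fun n => \sum_(k < n) (rbinom a k)%:C * zeta ^+ k) (cpow (1 - zeta) a)^-1.
Proof.
have n1 : `|1 : R| <= 1 by rewrite normr1.
have n0 : `|0 : R| <= 1 by rewrite normr0.
have gE : cpow (1 - zeta) a = g1 1 +i* g2 1.
  have := onem_zeta 1; rewrite mul1r => ->.
  by rewrite cpow_right_half// x_gt0.
have f10 : f 0 = 1.
  apply: (ccvg_unique (ccvgS (ccvgF n0))).
  rewrite (_ : (fun n => _) = fun=> 1); first exact: ccvg_cst.
  apply/funext => n; rewrite /F big_ord_recl big1 => [|k _].
    by rewrite /cf /= rbinom0 !expr0 !mulr1 addr0.
  by rewrite exprS mul0r mulr0.
have [g10 g20] : g1 0 = 1 /\ g2 0 = 0.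
  rewrite /g1 /g2 /pow_modulus /pow_argument /x /y !mul0r oppr0 mul0r atan0 mulr0.
  by rewrite cos0 sin0 addr0 expr1n expr0n/= addr0 ln1 !mulr0 expR0 mulr1.
have fg : f 1 * (g1 1 +i* g2 1) = 1.
  have [f1r f1i] : f1 0 = 1 /\ f2 0 = 0.
    by split; [exact: (congr1 (@complex.Re R) f10)|exact: (congr1 (@complex.Im R) f10)].
  have d1 t : `|t| <= 1 -> is_derive t 1 (f1 \* g1 - f2 \* g2) 0 by case/derive_fg.
  have d2 t : `|t| <= 1 -> is_derive t 1 (f1 \* g2 + f2 \* g1) 0 by case/derive_fg.
  have : f1 1 * g1 1 - f2 1 * g2 1 = f1 0 * g1 0 - f2 0 * g2 0 := constant01 d1.
  have : f1 1 * g2 1 + f2 1 * g1 1 = f1 0 * g2 0 + f2 0 * g1 0 := constant01 d2.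
  rewrite g10 g20 f1r f1i !mulr0 mulr1 subr0 addr0 => h2 h1.
  have -> : f 1 * (g1 1 +i* g2 1) =
    (f1 1 * g1 1 - f2 1 * g2 1) +i* (f1 1 * g2 1 + f2 1 * g1 1) by [].
  by rewrite h1 h2 mulr1.
have gn0 : g1 1 +i* g2 1 != 0.
  by apply/eqP => g0; move/eqP : fg; rewrite g0 mulr0 eq_sym oner_eq0.
have -> : (cpow (1 - zeta) a)^-1 = f 1.
  by rewrite gE; apply: (mulIf gn0); rewrite fg mulVf.
rewrite (_ : (fun n => _) = F ^~ 1); first exact: ccvgF.
by apply/funext => n; apply: eq_bigr => k _; rewrite expr1n mulr1.
Qed.

End binomial_power_series.

(** * Injective index maps and elementary symmetric sums *)

Section injections.

(** The matrix is the identity if k is injective, and has two equal rows otherwise. *)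
Lemma det_indicator (K : comNzRingType) n M (k : {ffun 'I_n -> 'I_M}) :
  \det (\matrix_(i < n, j < n) (k i == k j)%:R) = (injectiveb k)%:R :> K.
Proof.
case: injectiveP => [kinj|/injectiveP/injectivePn[i [j ij kij]]].
  rewrite (_ : \matrix_(i, j) _ = 1%:M) ?det1//.
  by apply/matrixP => i j; rewrite !mxE inj_eq.
by apply: (determinant_alternate ij) => l; rewrite !mxE kij.
Qed.

Variables (K : comNzRingType) (p : nat -> K).

(* [n`!] times the [n]-th elementary symmetric function of [p 0, ..., p M.-1] *)
Definition inj_sum n M : K :=
  \sum_(k : {ffun 'I_n -> 'I_M} | injectiveb k) \prod_(i < n) p (k i).

(** Injections are grouped by image: each set of n indices is the image of exactly n! of them. *)
Lemma inj_sumE n M :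
  inj_sum n M = n`!%:R * \sum_(A : {set 'I_M} | #|A| == n) \prod_(j in A) p j.
Proof.
rewrite /inj_sum (partition_big (fun k : {ffun 'I_n -> 'I_M} => k @: 'I_n) (fun A => #|A| == n)) /=; last first.
  by move=> k /injectiveP kinj; rewrite card_imset// card_ord.
rewrite mulr_sumr; apply: eq_bigr => A /eqP An.
transitivity (\sum_(k : {ffun 'I_n -> 'I_M} | injectiveb k && (k @: 'I_n == A)) \prod_(j in A) p j).
  apply: eq_bigr => k /andP[/injectiveP kinj /eqP <-].
  by rewrite big_imset//=; move=> i j _ _; exact: kinj.
rewrite sumr_const mulr_natl; congr (_ *+ _).
have := card_inj_ffuns_on 'I_n (mem A); rewrite card_ord An ffactnn => <-.
rewrite -sum1_card -sum1dep_card; apply: eq_bigl => k; rewrite !inE.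
rewrite unfold_in/= andbC; case: (boolP (injectiveb k)) => [kinj|_]; last by rewrite !andbF.
rewrite !andbT; apply/eqP/ffun_onP => [<- i|kA]; first exact: imset_f.
apply/eqP; rewrite eqEcard; apply/andP; split.
  by apply/fintype.subsetP => _ /imsetP[i _ ->]; exact: kA.
by rewrite An card_imset ?card_ord//; exact/injectiveP.
Qed.

Lemma prod_1D_set M (s : K) :
  \prod_(j < M) (1 + s * p j) = \sum_(A : {set 'I_M}) s ^+ #|A| * \prod_(j in A) p j.
Proof.
under eq_bigr do rewrite addrC.
rewrite bigA_distr; apply: eq_bigr => A _.
by rewrite -big_mkcond/= big_split/= prodr_const.
Qed.

End injections.

(** * Determinants of the truncated kernel *)

Section bergman_kernel.
Context {R : realType}.
Local Notation plane := (R * R)%type.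
Local Notation C := R[i].
Variables (nu r : R) (nu12 : 1 / 2 < nu) (r0 : 0 < r) (r1 : r < 1).
Local Notation berg := (bergman_measure nu).
Local Notation D := (disc r).

Definition kernel_coef k : R := (2 * nu - 1) / pi * rbinom (2 * nu) k.

Definition truncated_kernel M (z w : plane) : C :=
  \sum_(k < M) (kernel_coef k)%:C * (cplx z ^+ k * ((cplx w ^+ k)^*)%C).

Lemma kernel_coef_ge0 k : 0 <= kernel_coef k.
Proof.
have n1 : 0 <= 2 * nu - 1 by have := nu12; lra.
have n0 : 0 <= 2 * nu by have := nu12; lra.
by rewrite mulr_ge0 ?rbinom_ge0// divr_ge0 ?pi_ge0.
Qed.

Lemma kernel_coef_incbeta k :
  kernel_coef k * (pi * incbeta r k.+1 (2 * nu - 1)) = bergman_param nu r k.+1.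
Proof.
rewrite /kernel_coef /bergman_param /= -/(rbinom (2 * nu) k).
have pi0 : pi != 0 :> R by rewrite gt_eqF// pi_gt0.
by rewrite mulrA [_ * _ * pi]mulrAC divfK.
Qed.

Let r21 : r ^+ 2 < 1. Proof. by rewrite expr_lt1// ltW. Qed.

(** The kernel series at |z| = |w| = r, finite since r^2 < 1: a bound on D_r uniform in the
    truncation. *)
Definition kernel_bound : R := limn (series (fun k => kernel_coef k * (r ^+ 2) ^+ k)).

Let cvg_kernel_bound : cvgn (series (fun k => kernel_coef k * (r ^+ 2) ^+ k)).
Proof.
have n0 : 0 <= 2 * nu by have := nu12; lra.
have h := is_cvg_series_rbinom n0 (sqr_ge0 r) r21.
rewrite (_ : (fun k => _) =
  (fun k => (2 * nu - 1) / pi *: (rbinom (2 * nu) k * (r ^+ 2) ^+ k))).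
  exact: is_cvg_seriesZ.
by apply/funext => k; rewrite /kernel_coef /GRing.scale/= [RHS]mulrA.
Qed.

Lemma abs_truncated_kernel_le M z w : D z -> D w ->
  abs (truncated_kernel M z w) <= kernel_bound.
Proof.
move=> zr wr; apply: (@le_trans _ _ (series (fun k => kernel_coef k * (r ^+ 2) ^+ k) M)); last first.
  apply: nondecreasing_cvgn_le cvg_kernel_bound _.
  apply: nondecreasing_series => k _ _.
  by rewrite mulr_ge0 ?kernel_coef_ge0// exprn_ge0// sqr_ge0.
rewrite /truncated_kernel /series/= big_mkord.
elim/big_ind2 : _ => [|u v u' v' h h'|k _].
- by rewrite abs_real normr0.
- by rewrite (le_trans (le_absD _ _))// lerD.
- rewrite !absM abs_real ger0_norm ?kernel_coef_ge0// ler_wpM2l ?kernel_coef_ge0//.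
  rewrite abs_conj !absX -exprMn expr2.
  by rewrite lerXn2r ?nnegrE ?mulr_ge0 ?abs_ge0 ?(ltW r0)// ler_pM ?abs_ge0// ltW.
Qed.

Lemma kernel_bound_ge0 : 0 <= kernel_bound.
Proof.
have D0 : D (0, 0) by rewrite /disc/= /abs /= expr0n/= addr0 sqrtr0.
exact: le_trans (abs_ge0 _) (abs_truncated_kernel_le 0 D0 D0).
Qed.

Lemma ccvg_truncated_kernel z w : D z -> D w ->
  ccvg (fun M => truncated_kernel M z w) (bergman_kernel nu z w).
Proof.
move=> zr wr; set zeta := cplx z * ((cplx w)^*)%C.
have z1 : abs zeta < 1.
  rewrite /zeta absM abs_conj (le_lt_trans _ r21)// expr2.
  by rewrite ler_pM ?abs_ge0// ltW.
have n0 : 0 <= 2 * nu by have := nu12; lra.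
have := ccvgM (ccvg_cst ((2 * nu - 1) / pi)%:C) (binomial_series z1 n0).
rewrite -/(bergman_kernel nu z w).
congr ccvg; apply/funext => M; rewrite /truncated_kernel mulr_sumr.
apply: eq_bigr => k _; rewrite mulrA -rmorphM [in RHS]rmorphXn -exprMn.
by rewrite -/zeta.
Qed.

Definition disc_det n (K : plane -> plane -> C) (x : n.-tuple plane) : C :=
  \prod_(i < n) (\1_D (tnth x i))%:C *
  \det (\matrix_(i < n, j < n) K (tnth x i) (tnth x j)).

Lemma disc_detE n K x : @disc_det n K x =
  \sum_(s : 'S_n) (-1) ^+ s *
    \prod_i ((\1_D (tnth x i))%:C * K (tnth x i) (tnth x (s i))).
Proof.
rewrite /disc_det /determinant mulr_sumr; apply: eq_bigr => s _.
rewrite mulrCA big_split/=; congr (_ * (_ * _)).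
by apply: eq_bigr => i _; rewrite mxE.
Qed.

(** Regrouping by variable: the point of index i is the first argument of factor i and the second
    argument of factor s^-1 i, which supplies the conjugate exponent. *)
Let disc_monomial_expand n M (x : n.-tuple plane) (s : 'S_n) :
  \prod_i ((\1_D (tnth x i))%:C * truncated_kernel M (tnth x i) (tnth x (s i))) =
  \sum_(k : {ffun 'I_n -> 'I_M}) (\prod_i (kernel_coef (k i))%:C) *
    \prod_i disc_monomial r (k i) (k (s^-1 i)%g) (tnth x i).
Proof.
under eq_bigr do rewrite mulr_sumr.
rewrite bigA_distr_bigA; apply: eq_bigr => k _.
rewrite /disc_monomial -big_split/=.
transitivity ((\prod_i ((\1_D (tnth x i))%:C * (kernel_coef (k i))%:C * cplx (tnth x i) ^+ k i)) *
   \prod_i ((cplx (tnth x (s i)) ^+ k i)^*)%C).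
  rewrite -big_split/=; apply: eq_bigr => i _.
  by rewrite !mulrA.
rewrite [X in _ * X = _](reindex_inj (@perm_inj _ s^-1%g))/= -big_split/=.
apply: eq_bigr => i _; rewrite permKV.
by rewrite -!mulrA [RHS]mulrCA.
Qed.

(** By orthogonality only the terms with k i = k (s^-1 i) for all i survive. For fixed k, the signed
    sum over s is the determinant of the matrix of equalities between the k i, which is 1 for
    injective k and 0 otherwise. *)
Lemma cintegral_truncated_det n M :
  cintegrable (tuple_measure berg n) setT (@disc_det n (truncated_kernel M)) /\
  cintegral (tuple_measure berg n) setT (@disc_det n (truncated_kernel M)) =
  (inj_sum (fun k => bergman_param nu r k.+1) n M)%:C.
Proof.
pose G (s : 'S_n) (k : {ffun 'I_n -> 'I_M}) (x : n.-tuple plane) :=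
  (-1) ^+ s * (\prod_i (kernel_coef (k i))%:C) *
    \prod_i disc_monomial r (k i) (k (s^-1 i)%g) (tnth x i).
have E : @disc_det n (truncated_kernel M) = fun x => \sum_s \sum_k G s k x.
  apply/funext => x; rewrite disc_detE; apply: eq_bigr => s _.
  rewrite disc_monomial_expand mulr_sumr; apply: eq_bigr => k _.
  by rewrite /G mulrA.
have tp (s : 'S_n) (k : {ffun 'I_n -> 'I_M}) := @cintegral_tuple_prod _ _ _ berg n
  (fun i => disc_monomial r (k i) (k (s^-1 i)%g))
  (fun i => cintegrable_disc_monomial nu r0 r1 _ _).
have iG (s : 'S_n) k : cintegrable (tuple_measure berg n) setT (G s k).
  by apply: cintegrableZ; have [] := tp s k.
rewrite E; split.
  by apply: cintegrable_sum => s; exact: cintegrable_sum.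
rewrite cintegral_sum; last by move=> s; exact: cintegrable_sum.
under eq_bigr => s _.
  rewrite cintegral_sum//.
  under eq_bigr => k _.
    rewrite cintegralZ; last by have [] := tp s k.
    rewrite (tp s k).2.
    over.
  over.
rewrite exchange_big/= /inj_sum rmorph_sum/= [RHS]big_mkcond/=.
apply: eq_bigr => k _.
have one i j : cintegral berg setT (disc_monomial r (k i) (k j)) =
    (pi * incbeta r (k i).+1 (2 * nu - 1))%:C * (k i == k j)%:R.
  have [->|kij] := eqVneq (k i) (k j).
    by rewrite cintegral_disc_monomial_diag// mulr1.
  by rewrite cintegral_disc_monomial_neq// mulr0.
transitivity (\sum_(s : 'S_n) (\prod_i (bergman_param nu r (k i).+1)%:C) *
    ((-1) ^+ s * \prod_i (k i == k (s^-1 i)%g)%:R)).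
  apply: eq_bigr => s _; under [X in _ * X = _]eq_bigr do rewrite one.
  rewrite big_split/= [in RHS]mulrCA -!mulrA; congr (_ * _).
  rewrite !mulrA; congr (_ * _); rewrite -big_split/=; apply: eq_bigr => i _.
  by rewrite -rmorphM kernel_coef_incbeta.
(* Inverting s keeps the sign and yields the Leibniz formula in its usual form. *)
rewrite -mulr_sumr -rmorph_prod (reindex (fun s : 'S_n => s^-1%g))/=; last first.
  by exists (fun s : 'S_n => s^-1%g) => s _; rewrite invgK.
have -> : \sum_(s : 'S_n) (-1) ^+ (s^-1)%g * \prod_i (k i == k ((s^-1)^-1 i)%g)%:R =
    \det (\matrix_(i < n, j < n) (k i == k j)%:R) :> C.
  rewrite /determinant; apply: eq_bigr => s _; rewrite odd_permV invgK.
  by congr (_ * _); apply: eq_bigr => i _; rewrite mxE.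
by rewrite det_indicator; case: ifP => _; rewrite ?mulr1 ?mulr0.
Qed.

End bergman_kernel.

Section correlation_limit.
Context {R : realType}.
Local Notation plane := (R * R)%type.
Local Notation C := R[i].
Variables (nu r : R) (nu12 : 1 / 2 < nu) (r0 : 0 < r) (r1 : r < 1).
Local Notation berg := (bergman_measure nu).
Local Notation D := (disc r).

Let disc_det_out n K (x : n.-tuple plane) : ~ (forall i, D (tnth x i)) ->
  disc_det r K x = 0.
Proof.
move=> /existsNP[i Di]; rewrite /disc_det (bigD1 i)//= indicE memNset//.
by rewrite !mul0r.
Qed.

Let disc_det_in n K (x : n.-tuple plane) : (forall i, D (tnth x i)) ->
  disc_det r K x = \det (\matrix_(i < n, j < n) K (tnth x i) (tnth x j)).
Proof.
move=> Dx; rewrite /disc_det big1 ?mul1r// => i _.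
by rewrite indicE mem_set.
Qed.

(** The Leibniz formula has n! terms. The bound is uniform in M and integrable because D_r has
    finite measure. *)
Let abs_disc_det_le n M (x : n.-tuple plane) :
  abs (disc_det r (truncated_kernel nu M) x) <=
  n`!%:R * kernel_bound nu r ^+ n * \prod_(i < n) \1_D (tnth x i).
Proof.
have [Dx|nDx] := pselect (forall i, D (tnth x i)); last first.
  rewrite disc_det_out// abs_real normr0 mulr_ge0 ?prodr_ge0//.
  by rewrite mulr_ge0// exprn_ge0// kernel_bound_ge0.
rewrite disc_det_in// [X in _ * X]big1 ?mulr1; last by move=> i _; rewrite indicE mem_set.
have -> : n`!%:R * kernel_bound nu r ^+ n = \sum_(s : 'S_n) \prod_(i < n) kernel_bound nu r.
  by rewrite prodr_const card_ord sumr_const card_Sn mulr_natl.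
rewrite /determinant; elim/big_ind2 : _ => [|u v u' v' h h'|s _].
- by rewrite abs_real normr0.
- by rewrite (le_trans (le_absD _ _))// lerD.
have -> (z : C) : abs ((-1) ^+ s * z) = abs z.
  by case: (odd_perm s); rewrite ?mul1r// expr1 mulN1r /abs; case: z => a b /=; rewrite !sqrrN.
(* Nonnegativity is carried along because bounds multiply only when the factors are nonnegative. *)
have : 0 <= abs (\prod_i (\matrix_(i, j) truncated_kernel nu M (tnth x i) (tnth x j)) i (s i))
   <= \prod_(i < n) kernel_bound nu r; last by case/andP.
elim/big_ind2 : _ => [|u v u' v' /andP[u0 uv] /andP[u'0 u'v']|i _].
- by rewrite abs_real normr1 ler01 lexx.
- by rewrite absM mulr_ge0//= ler_pM.
- by rewrite mxE abs_ge0 abs_truncated_kernel_le.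
Qed.

Let ccvg_disc_det n (x : n.-tuple plane) :
  ccvg (fun M => disc_det r (truncated_kernel nu M) x) (disc_det r (bergman_kernel nu) x).
Proof.
have [Dx|nDx] := pselect (forall i, D (tnth x i)); last first.
  rewrite disc_det_out//; under [X in ccvg X]eq_fun do rewrite disc_det_out//.
  exact: ccvg_cst.
rewrite disc_det_in//; under [X in ccvg X]eq_fun do rewrite disc_det_in//.
apply: ccvg_sum => s; apply: ccvgM; first exact: ccvg_cst.
apply: ccvg_prod => i; rewrite !mxE; under [X in ccvg X]eq_fun do rewrite mxE.
exact: (ccvg_truncated_kernel nu12 r0 r1).
Qed.

Let integrable_det_bound n : (tuple_measure berg n).-integrable setT
  (fun x => (n`!%:R * kernel_bound nu r ^+ n * \prod_(i < n) \1_D (tnth x i))%:E).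
Proof.
have iD : cintegrable berg setT (fun z => (\1_D z)%:C : C).
  by split; [exact: integrable_indic_disc|exact: integrable0].
have [[h _] _] := @cintegral_tuple_prod _ _ _ berg n (fun _ z => (\1_D z)%:C : C) (fun=> iD).
under eq_fun do rewrite EFinM.
apply: integrableZl => //; move: h.
by under eq_fun do rewrite -rmorph_prod.
Qed.

(** The limit is written as the right-hand side of [is_determinantal] for the test function
    [disc_test], so that the two can be matched in [binomial_moment]. *)
Lemma cvg_correlation n :
  inj_sum (fun k => bergman_param nu r k.+1) n M @[M --> \oo] -->
  complex.Re (cintegral (tuple_measure berg n)
    [set x : n.-tuple plane | forall i, disc 1 (tnth x i)]
    (fun x => \prod_(i < n) (\1_D (tnth x i))%:C *
      \det (\matrix_(i < n, j < n) bergman_kernel nu (tnth x i) (tnth x j)))).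
Proof.
rewrite /cintegral /= Rintegral_mkcond.
under eq_Rintegral => x _.
  rewrite (_ : _ x = complex.Re (disc_det r (bergman_kernel nu) x)); last first.
    rewrite patchE; case: ifPn => // /negP; rewrite inE => nx.
    rewrite disc_det_out// => Dx; apply: nx => i.
    by apply: lt_trans r1; exact: Dx.
  over.
set m := tuple_measure berg n.
have mD M := cintegrable_measurable (@cintegral_truncated_det R nu r r0 r1 n M).1.
pose bnd (x : n.-tuple plane) := (n`!%:R * kernel_bound nu r ^+ n * \prod_(i < n) \1_D (tnth x i))%:E.
pose u M (x : n.-tuple plane) := (complex.Re (disc_det r (truncated_kernel nu M) x))%:E.
have mu_ M : measurable_fun setT (u M) by apply/measurable_EFinP; have [] := mD M.
have cu x : u M x @[M --> \oo] --> (complex.Re (disc_det r (bergman_kernel nu) x))%:E.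
  by apply/cvg_EFin; [exact: nearW|have [] := ccvg_disc_det x].
have [ilim _ lim] := @dominated_convergence _ _ _ m setT measurableT u _ bnd mu_
  (emeasurable_fun_cvg _ _ mu_ (fun x _ => cu x)) (aeW _ (fun x _ => cu x))
  (integrable_det_bound n) (aeW _ (fun x M _ =>
    le_trans (le_Re_abs _) (abs_disc_det_le M x))).
have fin M : (\int[m]_x (complex.Re (disc_det r (truncated_kernel nu M) x))%:E =
    (inj_sum (fun k => bergman_param nu r k.+1) n M)%:E)%E.
  have [[ir _] eq] := @cintegral_truncated_det R nu r r0 r1 n M.
  rewrite -[LHS]fineK; last exact: integrable_fin_num.
  by have := congr1 (@complex.Re R) eq; rewrite /= => <-.
have {}lim : (inj_sum (fun k => bergman_param nu r k.+1) n M)%:E @[M --> \oo] -->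
    (\int[m]_x (complex.Re (disc_det r (bergman_kernel nu) x))%:E)%E.
  by rewrite (_ : (fun M => _) = (fun M => \int[m]_x u M x)%E)//; apply/funext => M; rewrite fin.
have /fineK lfin : (\int[m]_x (complex.Re (disc_det r (bergman_kernel nu) x))%:E)%E \is a fin_num.
  exact: integrable_fin_num.
by rewrite /Rintegral; move: lim; rewrite -lfin => /fine_cvg.
Qed.

End correlation_limit.

(** * Moments and generating function of the number of points *)

Section closed_disc.
Context {R : realType}.
Local Notation plane := (R * R)%type.
Variables (r : R) (r0 : 0 < r) (r1 : r < 1).

(** A compact subset of the unit disc containing D_r: it gives the support of the test function, the
    finiteness of the configuration in D_r and the measurability of the count. *)
Definition cdisc : set plane := [set z | abs (cplx z) <= r].

Lemma disc_sub_cdisc : disc r `<=` cdisc.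
Proof. by move=> z; rewrite /disc /cdisc/= => /ltW. Qed.

Lemma cdisc_sub_disc1 : cdisc `<=` disc 1.
Proof. by move=> z; rewrite /disc /cdisc/= => zr; rewrite (le_lt_trans zr). Qed.

Lemma compact_cdisc : compact cdisc.
Proof.
have sq (z : plane) : 0 <= z.1 ^+ 2 + z.2 ^+ 2 by rewrite addr_ge0 ?sqr_ge0.
have E : cdisc = (fun z : plane => z.1 ^+ 2 + z.2 ^+ 2) @^-1` [set x | x <= r ^+ 2].
  apply/funext => z; rewrite /preimage/mkset/cdisc/mkset -[z.1 ^+ 2 + _](abs_cplx_sqr z).
  by rewrite ler_pXn2r ?nnegrE ?abs_ge0 ?(ltW r0).
apply: (@subclosed_compact _ _ (`[- r, r] `*` `[- r, r])).
- rewrite E; apply: closed_comp; last exact: closed_le.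
  move=> z _; apply: cvgD.
    by apply: (@cvg_comp _ _ _ fst (fun x : R => x ^+ 2) _ _ _ cvg_fst); exact: exprn_continuous.
  by apply: (@cvg_comp _ _ _ snd (fun x : R => x ^+ 2) _ _ _ cvg_snd); exact: exprn_continuous.
- by apply: compact_setX; exact: segment_compact.
- move=> [x y]; rewrite /cdisc/= !in_itv/= => xyr.
  have := le_trans (le_Re_abs (cplx (x, y))) xyr.
  have := le_trans (le_Im_abs (cplx (x, y))) xyr.
  by rewrite /= !ler_norml.
Qed.

End closed_disc.

Section factorial_moment.
Context {R : realType}.
Local Notation plane := (R * R)%type.
Local Notation C := R[i].
Variables (r : R) (r0 : 0 < r) (r1 : r < 1).
Local Notation D := (disc r).

Definition disc_test n (x : n.-tuple plane) : C := \prod_(i < n) (\1_D (tnth x i))%:C.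

Lemma disc_test_in n (x : n.-tuple plane) : (forall i, D (tnth x i)) -> disc_test x = 1.
Proof. by move=> Dx; rewrite /disc_test big1// => i _; rewrite indicE mem_set. Qed.

Lemma disc_test_out n (x : n.-tuple plane) i : ~ D (tnth x i) -> disc_test x = 0.
Proof. by move=> Di; rewrite /disc_test (bigD1 i)//= indicE memNset// mul0r. Qed.

Lemma test_function_disc n : test_function (disc 1) (@disc_test n).
Proof.
split.
- have mD : cmeasurable setT (fun z : plane => (\1_D z)%:C : C).
    by apply: cmeasurable_real; apply: measurable_indic; exact: measurable_disc.
  by apply: cmeasurable_prod => i; exact: (cmeasurable_comp (measurable_tnth i) mD).
- exists 1 => x; have [Dx|/existsNP[i Di]] := pselect (forall i, D (tnth x i)).
    by rewrite disc_test_in// abs_real normr1.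
  by rewrite (disc_test_out Di) abs_real normr0.
- exists (cdisc r); split; [exact: compact_cdisc|exact: cdisc_sub_disc1|].
  move=> x /eqP fx i; apply: disc_sub_cdisc; apply: contrapT => Di.
  by apply: fx; rewrite (disc_test_out Di).
Qed.

Lemma finite_config_disc (X : config (disc (1 : R))) : finite_set (X `&` D).
Proof.
apply: (@sub_finite_set _ _ (X `&` cdisc r)); first by apply: setIS; exact: disc_sub_cdisc.
by apply: config_locally_finite; [exact: compact_cdisc|exact: cdisc_sub_disc1].
Qed.

(** Every nonzero term is 1 and comes from a duplicate-free n-tuple of the finite set of points of X
    in D_r; such tuples are counted by the falling factorial. *)
Lemma multi_sum_disc n (X : config (disc (1 : R))) :
  multi_sum (@disc_test n) X = ((npoints D X) ^_ n)%:R.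
Proof.
set S := fset_set (X `&` D).
have memS (z : plane) : (z \in S) = (z \in X `&` D).
  by rewrite /S in_fset_set//; exact: finite_config_disc.
pose A : {set n.-tuple S} := finset (fun t : n.-tuple S => uniq t).
pose h (t : n.-tuple S) : n.-tuple plane := map_tuple val t.
have hinj : injective h.
  by move=> t t' /(congr1 val)/= tt'; apply/val_inj/(inj_map val_inj).
have hD (t : n.-tuple S) i : tnth (h t) i \in X `&` D.
  by rewrite tnth_map -memS; exact: fsvalP.
rewrite /multi_sum (fsbigE (map h (enum A)))/=.
- rewrite big_mkcond/= big_map big_enum/= (eq_bigr (fun=> 1)) => [|t tA]; last first.
    rewrite ifT; last first.
      apply/mem_set; split; first by rewrite map_inj_uniq; [move: tA; rewrite inE|exact: val_inj].
      by move=> i; have := hD t i; rewrite inE => -[].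
    by rewrite disc_test_in// => i; have := hD t i; rewrite inE => -[].
  rewrite sumr_const; congr (_%:R).
  have := card_uniq_tuples n (T := S) predT.
  rewrite (_ : finset _ = A).
    by move=> ->; rewrite /npoints cardfE.
  by apply/finset.setP => t; rewrite !inE all_predT.
- by rewrite map_inj_uniq// enum_uniq.
- move=> _ /mapP[t tA ->]; split.
    by rewrite map_inj_uniq; [move: tA; rewrite mem_enum inE|exact: val_inj].
  by move=> i; have := hD t i; rewrite inE => -[].
- move=> x [ux Xx] xr; have [Dx|/existsNP[i Di]] := pselect (forall i, D (tnth x i)); last first.
    by rewrite (disc_test_out Di).
  exfalso; move/negP : xr; apply.
  have xS i : tnth x i \in S by rewrite memS; apply/mem_set; split; [exact: Xx|exact: Dx].
  pose t : n.-tuple S := [tuple FSetSub (xS i) | i < n].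
  have xE : x = h t by apply: eq_from_tnth => i; rewrite tnth_map tnth_mktuple.
  rewrite xE; apply: map_f; rewrite mem_enum inE -(map_inj_uniq val_inj).
  by have := congr1 val xE => /= <-.
Qed.

Lemma measurable_npoints k :
  measurable [set X : config_space (disc (1 : R)) | npoints D X = k].
Proof.
apply: sub_sigma_algebra; exists D, k; split => //; first exact: measurable_disc.
by exists (cdisc r); split; [exact: compact_cdisc|exact: cdisc_sub_disc1|exact: disc_sub_cdisc].
Qed.

Lemma measurable_fun_npoints (f : nat -> \bar R) :
  measurable_fun setT (fun X : config_space (disc (1 : R)) => f (npoints D X)).
Proof.
move=> _ B mB; rewrite setTI.
rewrite (_ : _ @^-1` _ = \bigcup_(k in [set k | B (f k)]) [set X | npoints D X = k]).
  by apply: bigcup_measurable => k _; exact: measurable_npoints.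
apply/seteqP; split => X /=; first by move=> BX; exists (npoints D X).
by move=> [k Bk ->].
Qed.

End factorial_moment.

(** * Elementary symmetric functions of a nonnegative sequence *)

Section elementary_symmetric.
Context {R : realType}.
Variables (p : nat -> R) (p0 : forall j, 0 <= p j).

(** As coefficients of this product, the elementary symmetric functions get at once their recursion
    in M, hence positivity and monotonicity, and their generating function. *)
Definition elem_sym_poly M : {poly R} := \prod_(j < M) (1 + 'X * (p j)%:P).

Definition elem_sym n M : R := (elem_sym_poly M)`_n.

Lemma inj_sum_elem_sym n M : inj_sum p n M = n`!%:R * elem_sym n M.
Proof.
rewrite inj_sumE /elem_sym /elem_sym_poly (prod_1D_set (fun j => (p j)%:P)) coef_sum.
congr (_ * _); rewrite [LHS]big_mkcond/=; apply: eq_bigr => A _.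
rewrite -rmorph_prod/= mulrC mul_polyC coefZ coefXn eq_sym.
by case: ifP; rewrite ?mulr1 ?mulr0.
Qed.

Let elem_sym_polyS M : elem_sym_poly M.+1 = elem_sym_poly M * (1 + 'X * (p M)%:P).
Proof. by rewrite /elem_sym_poly big_ord_recr. Qed.

Let elem_symS n M : elem_sym n M.+1 = elem_sym n M + p M * (if n is n'.+1 then elem_sym n' M else 0).
Proof.
rewrite /elem_sym elem_sym_polyS mulrDr mulr1 coefD; congr (_ + _).
rewrite mulrA coefMC mulrC coefMX; case: n => //=.
Qed.

Lemma elem_sym_ge0 n M : 0 <= elem_sym n M.
Proof.
elim: M n => [|M ih] n; first by rewrite /elem_sym /elem_sym_poly big_ord0 coef1.
by rewrite elem_symS addr_ge0// mulr_ge0//; case: n.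
Qed.

Lemma elem_sym_nd n : nondecreasing_seq (elem_sym n).
Proof.
apply/nondecreasing_seqP => M; rewrite elem_symS lerDl mulr_ge0//.
by case: n => // n; exact: elem_sym_ge0.
Qed.

Lemma elem_sym0 M : elem_sym 0 M = 1.
Proof.
elim: M => [|M ih]; first by rewrite /elem_sym /elem_sym_poly big_ord0 coef1.
by rewrite elem_symS ih mulr0 addr0.
Qed.

Lemma elem_sym1 M : elem_sym 1 M = \sum_(j < M) p j.
Proof.
elim: M => [|M ih]; first by rewrite /elem_sym /elem_sym_poly !big_ord0 coef1.
by rewrite elem_symS ih elem_sym0 mulr1 big_ord_recr.
Qed.

(** L may exceed the number of coefficients, so that expansions can be compared over a common
    range. *)
Lemma prod_elem_sym (s : R) M L : (M < L)%N ->
  \prod_(j < M) (1 + s * p j) = \sum_(n < L) elem_sym n M * s ^+ n.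
Proof.
move=> ML; have sz : (size (elem_sym_poly M) <= L)%N.
  apply: leq_trans ML; elim: {L} M => [|M ih]; first by rewrite /elem_sym_poly big_ord0 size_poly1.
  rewrite elem_sym_polyS mulrDr mulr1 (leq_trans (size_polyD _ _))// geq_max (leq_trans ih)//=.
  rewrite mulrA mulrC mul_polyC (leq_trans (size_scale_leq _ _))//.
  by rewrite (leq_trans (size_polyMleq _ _))// size_polyX addn2.
rewrite -(horner_coef_wide s sz) /elem_sym_poly horner_prod; apply: eq_bigr => j _.
by rewrite !hornerE.
Qed.

End elementary_symmetric.

(** * From binomial moments to the generating function *)

Section generating_function.
Context {R : realType} d (T : measurableType d) (P : probability T R).
Variables (N : T -> nat) (p : nat -> R) (e : nat -> R).
Hypothesis p0 : forall j, 0 <= p j.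
Hypothesis mN : forall f : nat -> \bar R, measurable_fun setT (fun x => f (N x)).
Hypothesis elem_sym_e : forall n, elem_sym p n M @[M --> \oo] --> e n.
Hypothesis momentN : forall n, (\int[P]_x ('C(N x, n)%:R)%:E = (e n)%:E)%E.

Let elem_sym_le n M : elem_sym p n M <= e n.
Proof.
have := nondecreasing_cvgn_le (elem_sym_nd p0 n) (cvgP _ (@elem_sym_e n)) M.
by rewrite (cvg_lim _ (@elem_sym_e n)).
Qed.

Let e0 n : 0 <= e n.
Proof. exact: le_trans (elem_sym_ge0 p0 n 0) (elem_sym_le n 0). Qed.

Let F M (t : R) := \prod_(j < M) (1 + t * p j).

Let sum_p_le M : \sum_(j < M) p j <= e 1%N.
Proof.
by rewrite -elem_sym1.
Qed.

Let F_nd t : 0 <= t -> nondecreasing_seq (F ^~ t).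
Proof.
move=> t0; apply/nondecreasing_seqP => M; rewrite /F big_ord_recr/= ler_peMr//.
  by rewrite prodr_ge0// => j _; rewrite addr_ge0// mulr_ge0.
by rewrite lerDl mulr_ge0.
Qed.

(** By 1 + x <= exp x, as [e 1] bounds the partial sums of p. *)
Let F_bound M t : 0 <= t -> F M t <= expR (t * e 1%N).
Proof.
move=> t0; apply: (@le_trans _ _ (expR (t * \sum_(j < M) p j))).
  rewrite mulr_sumr expR_sum; apply: ler_prod => j _.
  by rewrite addr_ge0 ?mulr_ge0//= expR_ge1Dx.
by rewrite ler_expR ler_wpM2l.
Qed.

Let cvgF t : 0 <= t -> cvgn (F ^~ t).
Proof.
move=> t0; apply: nondecreasing_is_cvgn; first exact: F_nd.
by exists (expR (t * e 1%N)) => _ [M _ <-]; exact: F_bound.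
Qed.

Let Flim t := limn (F ^~ t).

(** With L fixed, the limit in M is harmless; for M large the truncated sum is at most the whole
    product, the other terms being nonnegative. *)
Let sum_e_le t L : 0 <= t -> \sum_(n < L) e n * t ^+ n <= Flim t.
Proof.
move=> t0.
have h : \sum_(n < L) elem_sym p n M * t ^+ n @[M --> \oo] --> \sum_(n < L) e n * t ^+ n.
  elim: L => [|L ih]; first by under eq_fun do rewrite big_ord0; rewrite big_ord0; exact: cvg_cst.
  under eq_fun do rewrite big_ord_recr; rewrite big_ord_recr.
  by apply: cvgD => //; apply: cvgMl; exact: elem_sym_e.
rewrite -(cvg_lim _ h)//; apply: limr_le; first exact: cvgP h.
near=> M.
have LM : (L <= M.+1)%N by near: M; exists L => // M /= /leq_trans; apply.
rewrite (@le_trans _ _ (F M t))//; last exact: nondecreasing_cvgn_le (F_nd t0) (cvgF t0) M.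
rewrite /F (prod_elem_sym _ _ (ltnSn M)).
rewrite -!(big_mkord xpredT (fun n => elem_sym p n M * t ^+ n)).
rewrite [leRHS](big_cat_nat _ (n := L))//= lerDl.
by apply: sumr_ge0 => n _; rewrite mulr_ge0 ?exprn_ge0// elem_sym_ge0.
Unshelve. all: by end_near. Qed.

Let binomial_sum (s : R) k L : (k < L)%N ->
  \sum_(n < L) 'C(k, n)%:R * s ^+ n = (1 + s) ^+ k.
Proof.
move=> kL; rewrite exprDn -(big_mkord xpredT (fun n => 'C(k, n)%:R * s ^+ n)).
rewrite (big_cat_nat _ (n := k.+1))//= [X in _ + X]big_nat_cond [X in _ + X]big1 ?addr0.
  rewrite big_mkord; apply: eq_bigr => n _.
  by rewrite expr1n mul1r mulr_natl.
by move=> n; rewrite andbT => /andP[kn _]; rewrite bin_small// mul0r.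
Qed.

(** The limits in L and in M of a nonnegative increasing double sequence commute: each inequality
    truncates one index and lets the other run. *)
Let cvg_sum_e t : 0 <= t ->
  (\sum_(0 <= n < L) (e n * t ^+ n)%:E @[L --> \oo] --> (Flim t)%:E)%E.
Proof.
move=> t0.
have u0 n : (true -> 0 <= (e n * t ^+ n)%:E)%E by move=> _; rewrite lee_fin mulr_ge0 ?exprn_ge0.
have cu := is_cvg_nneseries (fun n _ => u0 n).
suff <- : (limn (fun L => \sum_(0 <= n < L) (e n * t ^+ n)%:E) = (Flim t)%:E)%E by exact: cu.
apply/eqP; rewrite eq_le; apply/andP; split.
  apply: lime_le; first exact: cu.
  by apply: nearW => L; rewrite sumEFin lee_fin big_mkord sum_e_le.
have cF : ((F M t)%:E @[M --> \oo] --> (Flim t)%:E)%E.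
  by apply/cvg_EFin; [exact: nearW|exact: cvgF].
rewrite -(cvg_lim _ cF)//; apply: lime_le; first exact: cvgP cF.
apply: nearW => M; rewrite /F (prod_elem_sym _ _ (ltnSn M)).
apply: (@le_trans _ _ (\sum_(0 <= n < M.+1) (e n * t ^+ n)%:E)%E).
  rewrite sumEFin lee_fin big_mkord; apply: ler_sum => n _.
  by rewrite ler_wpM2r ?exprn_ge0.
exact: (nneseries_lim_ge _ (fun n _ => u0 n)).
Qed.

(** All terms of the binomial expansion are nonnegative, so sum and integral commute without an
    integrability condition. The finite value supplies the dominating function for general s. *)
Lemma integral_1D_expn_ge0 t : 0 <= t ->
  (\int[P]_x ((1 + t) ^+ N x)%:E = (Flim t)%:E)%E.
Proof.
move=> t0; rewrite -(cvg_lim _ (cvg_sum_e t0))//.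
transitivity (\int[P]_x (\sum_(0 <= n <oo) ('C(N x, n)%:R * t ^+ n)%:E))%E.
  apply: eq_integral => x _.
  have : (\sum_(0 <= n < L) ('C(N x, n)%:R * t ^+ n)%:E @[L --> \oo] --> ((1 + t) ^+ N x)%:E)%E.
    apply: cvg_near_cst; near=> L; rewrite sumEFin big_mkord binomial_sum//.
    by near: L; exists (N x).+1.
  by move/cvg_lim => <-.
rewrite integral_nneseries//; last 2 first.
- by move=> n; exact: (mN (fun k => ('C(k, n)%:R * t ^+ n)%:E)).
- by move=> n x _; rewrite lee_fin mulr_ge0 ?exprn_ge0.
apply: eq_eseriesr => n _; under eq_integral do rewrite EFinM.
rewrite ge0_integralZr//; last 2 first.
- exact: (mN (fun k => ('C(k, n)%:R)%:E)).
- by rewrite lee_fin exprn_ge0.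
by rewrite momentN.
Unshelve. all: by end_near. Qed.

(** The partial binomial sums at s are dominated by (1 + |s|)^N, integrable by the previous
    lemma. *)
Lemma cvg_prod_expectation (s : R) :
  (\int[P]_x ((1 + s) ^+ N x)%:E = (limn (F ^~ s))%:E)%E /\ cvgn (F ^~ s).
Proof.
set t := `|s|; have t0 : 0 <= t by exact: normr_ge0.
have it : P.-integrable setT (fun x => ((1 + t) ^+ N x)%:E).
  apply/integrableP; split; first exact: (mN (fun k => ((1 + t) ^+ k)%:E)).
  under eq_integral do rewrite gee0_abs ?lee_fin ?exprn_ge0 ?addr_ge0//.
  by rewrite integral_1D_expn_ge0// ltry.
pose u L x := (\sum_(n < L) 'C(N x, n)%:R * s ^+ n)%:E.
have mu_ L : measurable_fun setT (u L).
  exact: (mN (fun k => (\sum_(n < L) 'C(k, n)%:R * s ^+ n)%:E)).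
have ms : measurable_fun setT (fun x => ((1 + s) ^+ N x)%:E).
  exact: (mN (fun k => ((1 + s) ^+ k)%:E)).
have cu x : u L x @[L --> \oo] --> ((1 + s) ^+ N x)%:E.
  apply: cvg_near_cst; near=> L; rewrite /u binomial_sum//.
  by near: L; exists (N x).+1.
have bu x L : (`|u L x| <= ((1 + t) ^+ N x)%:E)%E.
  rewrite lee_fin (le_trans (ler_norm_sum _ _ _))//.
  rewrite -(@binomial_sum t (N x) (maxn L (N x).+1)); last by rewrite leq_max ltnSn orbT.
  rewrite -!(big_mkord xpredT (fun n => 'C(N x, n)%:R * t ^+ n)).
  rewrite [leRHS](big_cat_nat _ (n := L))//= ?leq_maxl// big_mkord ler_wpDr//.
    by apply: sumr_ge0 => n _; rewrite mulr_ge0 ?exprn_ge0.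
  by apply: ler_sum => n _; rewrite normrM normrX ger0_norm.
have [ilim _ lim] := dominated_convergence measurableT mu_ ms
  (aeW _ (fun x _ => cu x)) it (aeW _ (fun x L _ => bu x L)).
have iu L : (\int[P]_x u L x = (\sum_(n < L) e n * s ^+ n)%:E)%E.
  rewrite /u; under eq_integral do rewrite -sumEFin.
  have iC n : P.-integrable setT (fun x => ('C(N x, n)%:R * s ^+ n)%:E).
    under eq_fun do rewrite EFinM; apply: integrableZr => //.
    apply/integrableP; split; first exact: (mN (fun k => ('C(k, n)%:R)%:E)).
    by under eq_integral do rewrite gee0_abs ?lee_fin//; rewrite momentN ltry.
  rewrite integral_sum// -sumEFin; apply: eq_bigr => n _.
  under eq_integral do rewrite EFinM.
  rewrite integralZr//= ?momentN//.
  apply/integrableP; split; first exact: (mN (fun k => ('C(k, n)%:R)%:E)).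
  by under eq_integral do rewrite gee0_abs ?lee_fin//; rewrite momentN ltry.
have /fineK Efin : (\int[P]_x ((1 + s) ^+ N x)%:E \is a fin_num)%E by exact: integrable_fin_num.
set E := fine _ in Efin.
have limE : \sum_(n < L) e n * s ^+ n @[L --> \oo] --> E.
  have : ((\sum_(n < L) e n * s ^+ n)%:E @[L --> \oo] --> E%:E)%E.
    rewrite Efin (_ : (fun L => _) = (fun L => \int[P]_x u L x)%E)//.
    by apply/funext => L; rewrite iu.
  by move/fine_cvg.
(* The terms of the two expansions at [s] differ by at most those at [t = `|s|],
   where everything is nonnegative. *)
have bound M : `|E - F M s| <= Flim t - F M t.
  have cM : `|\sum_(n < L) e n * s ^+ n - F M s| @[L --> \oo] --> `|E - F M s|.
    by apply: cvg_norm; apply: cvgB => //; exact: cvg_cst.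
  rewrite -(cvg_lim _ cM)//; apply: limr_le; first exact: cvgP cM.
  near=> L.
  have ML : (M < L)%N by near: L; exists M.+1.
  rewrite /F !(prod_elem_sym _ _ ML) -sumrB (le_trans (ler_norm_sum _ _ _))//.
  apply: (@le_trans _ _ (\sum_(n < L) (e n * t ^+ n - elem_sym p n M * t ^+ n))).
    apply: ler_sum => n _; rewrite -!mulrBl normrM normrX ger0_norm// subr_ge0.
    exact: elem_sym_le.
  by rewrite sumrB lerB// sum_e_le.
have cFs : F M s @[M --> \oo] --> E.
  apply/cvgrPdist_le => eps eps0; near=> M; rewrite (le_trans (bound M))//.
  near: M; have /cvgrPdist_le/(_ eps eps0) := cvgF t0; apply: filterS => M.
  by apply: le_trans; exact: ler_norm.
by split; [rewrite (cvg_lim _ cFs)// Efin|exact: cvgP cFs].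
Unshelve. all: by end_near. Qed.

End generating_function.

(** * Complete Beta integrals *)

Section complete_beta.
Context {R : realType}.
Local Notation lam := (@lebesgue_measure R).
Local Notation mR := (measurableTypeR R).
Variables (b : R) (b0 : 0 < b).

Let dens k (u : R) : R := u ^+ k * (1 - u) `^ (b - 1).
Let I k (x : R) : R := \int[lam]_(u in `[0, x]) dens k u.

Let int_dens k (x : R) : x < 1 -> lam.-integrable `[0, x] (EFin \o dens k).
Proof. exact: integrable_beta_density. Qed.

Let powE (u : R) : u < 1 -> (1 - u) `^ b = (1 - u) * (1 - u) `^ (b - 1).
Proof. by move=> u1; rewrite mulr_powRB1// subr_ge0 ltW. Qed.

Let derive_parts k (u : R) : u < 1 ->
  is_derive u 1 (fun u : R => u ^+ k * (1 - u) `^ b)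
    (k%:R * u ^+ k.-1 * (1 - u) `^ b - b * u ^+ k * (1 - u) `^ (b - 1)).
Proof.
move=> u1; have d := is_derive_powR_onem b u1.
have dX : is_derive u 1 (fun u : R => u ^+ k) (k%:R * u ^+ k.-1).
  apply: DeriveDef; first exact: exprn_derivable.
  by rewrite exp_derive /GRing.scale/= mulr1.
apply: (is_derive_eq (is_deriveM dX d)).
by rewrite /GRing.scale/=; ring.
Qed.

(** [0 ^+ k] is the boundary term at 0: it is 1 for k = 0 and vanishes otherwise. *)
Let ftc k (x : R) (f : R -> R) : 0 < x -> x < 1 ->
  {within `[0, x], continuous f} ->
  (forall u, u < 1 -> f u = k%:R * u ^+ k.-1 * (1 - u) `^ b - b * u ^+ k * (1 - u) `^ (b - 1)) ->
  \int[lam]_(u in `[0, x]) f u = x ^+ k * (1 - x) `^ b - 0 ^+ k.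
Proof.
move=> x0 x1 cf fE; rewrite /Rintegral.
rewrite (@continuous_FTC2 R f (fun u => u ^+ k * (1 - u) `^ b))//=.
- by rewrite subr0 powR1 mulr1.
- split.
  + move=> u; rewrite in_itv/= => /andP[_ ux].
    by have [] := derive_parts k (lt_trans ux x1).
  + apply: cvg_at_right_filter; exact: continuous_beta_density.
  + apply: cvg_at_left_filter; exact: continuous_beta_density.
- move=> u; rewrite in_itv/= => /andP[_ ux].
  have u1 := lt_trans ux x1.
  by rewrite derive1E fE//; have [_ ->] := derive_parts k u1.
Qed.

Let cont_dens a k (u : R) : u < 1 -> {for u, continuous (fun u => a * dens k u)}.
Proof.
move=> u1; apply: continuousM; first exact: cst_continuous.
exact: continuous_beta_density.
Qed.

Let I0 (x : R) : 0 < x -> x < 1 -> b * I 0 x = 1 - (1 - x) `^ b.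
Proof.
move=> x0 x1.
have := @ftc 0 x (fun u => - b * dens 0 u) x0 x1.
rewrite RintegralZl//; last exact: int_dens.
rewrite !expr0 mul1r -/(I 0 x) => h; apply: oppr_inj; rewrite opprB -mulNr; apply: h.
- apply: continuous_in_subspaceT => u; rewrite inE/= in_itv/= => /andP[_ ux].
  exact/cont_dens/(le_lt_trans ux).
- by move=> u u1; rewrite /dens; ring.
Qed.

(** Integration by parts, with (1 - u)^b split as (1 - u) (1 - u)^(b-1). As x tends to 1 the
    right-hand side vanishes because b > 0, leaving the recursion of the complete Beta integral. *)
Let IS k (x : R) : 0 < x -> x < 1 ->
  k.+1%:R * I k x - (k.+1%:R + b) * I k.+1 x = x ^+ k.+1 * (1 - x) `^ b.
Proof.
move=> x0 x1.
have iZ (a : R) j : lam.-integrable `[0, x] (EFin \o (fun u => a * dens j u)).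
  have -> : EFin \o (fun u => a * dens j u) = (fun u => a%:E * (EFin \o dens j) u)%E by [].
  by apply: integrableZl => //; exact: int_dens.
have := @ftc k.+1 x (fun u => k.+1%:R * dens k u - (k.+1%:R + b) * dens k.+1 u) x0 x1.
rewrite RintegralB// !RintegralZl//; [|exact: int_dens|exact: int_dens].
rewrite expr0n subr0; apply.
- apply: continuous_in_subspaceT => u; rewrite inE/= in_itv/= => /andP[_ ux].
  apply: (@continuousB _ _ _ (fun u => k.+1%:R * dens k u) (fun u => (k.+1%:R + b) * dens k.+1 u) u);
  exact/cont_dens/(le_lt_trans ux).
- by move=> u u1; rewrite /= powE// /dens exprS; ring.
Qed.

(* [(1 - u) `^ (b - 1)] may be unbounded near 1: the integrals over [0, 1] are
   obtained as limits of those over [0, x_ n], where integration by parts applies. *)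
Let x_ (n : nat) : R := 1 - n.+2%:R^-1.

Let x_gt0 n : 0 < x_ n.
Proof. by rewrite subr_gt0 invf_lt1 ?ltr1n// ltr0n. Qed.

Let x_lt1 n : x_ n < 1.
Proof. by rewrite /x_ gtrBl invr_gt0 ltr0n. Qed.

Let cvg_x : x_ n @[n --> \oo] --> (1 : R).
Proof.
rewrite -[X in _ --> X]subr0; apply: cvgB; first exact: cvg_cst.
have := @cvg_harmonic R; rewrite -(cvg_shiftS (@harmonic R)).
by [].
Qed.

Let cvg_pow : (1 - x_ n) `^ b @[n --> \oo] --> (0 : R).
Proof.
have /cvg_at_rightP/(_ (fun n => 1 - x_ n)) := powR_cvg0 b0.
apply; split => [n|]; first by rewrite subr_gt0.
by rewrite -[X in _ --> X](subrr 1); apply: cvgB => //; exact: cvg_cst.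
Qed.

(** The Beta value B(k + 1, b) = k! / (b (b + 1) ... (b + k)). *)
Let v k : R := (b * rbinom (b + 1) k)^-1.

Let rb0 k : 0 < rbinom (b + 1) k.
Proof.
have b1 : 0 < b + 1 by have := b0; lra.
elim: k => [|k ih]; first by rewrite rbinom0.
have k0 : 0 < k.+1%:R :> R by rewrite ltr0n.
rewrite -(pmulr_rgt0 _ k0) rbinomS mulr_gt0// ltr_wpDr//.
Qed.

Let vS k : v k.+1 = k.+1%:R * v k / (k.+1%:R + b).
Proof.
rewrite /v; have k0 : k.+1%:R != 0 :> R by rewrite pnatr_eq0.
have kb : k.+1%:R + b != 0 by rewrite gt_eqF// ltr_wpDl.
have r0 : rbinom (b + 1) k != 0 by rewrite gt_eqF.
have bn : b != 0 by rewrite gt_eqF.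
have -> : rbinom (b + 1) k.+1 = (k.+1%:R + b) * rbinom (b + 1) k / k.+1%:R.
  apply: (mulfI k0); rewrite rbinomS -(natr1 k).
  rewrite natr1 [RHS]mulrCA mulfV// mulr1 -natr1; ring.
by move: (k.+1%:R) (rbinom _ _) k0 kb r0 => n q n0 nb q0; field; rewrite n0 nb q0 bn.
Qed.

Let cvg_I k : I k (x_ n) @[n --> \oo] --> v k.
Proof.
elim: k => [|k ih].
  rewrite (_ : (fun n => _) = (fun n => b^-1 * (1 - (1 - x_ n) `^ b))).
    rewrite /v rbinom0 mulr1 -[X in _ --> X]mulr1; apply: cvgMr.
    by rewrite -[X in _ --> X]subr0; apply: cvgB => //; exact: cvg_cst.
  by apply/funext => n; rewrite -I0// mulKf// gt_eqF.
have kb : k.+1%:R + b != 0 by rewrite gt_eqF// ltr_wpDl.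
rewrite (_ : (fun n => _) = (fun n =>
    (k.+1%:R * I k (x_ n) - x_ n ^+ k.+1 * (1 - x_ n) `^ b) / (k.+1%:R + b))).
  rewrite vS; apply: cvgMl; rewrite -[X in _ --> X]subr0; apply: cvgB; first exact: cvgMr.
  rewrite -[X in _ --> X](mulr0 (1 ^+ k.+1)); apply: cvgM => //.
  exact: (@cvg_comp _ _ _ x_ (fun x : R => x ^+ k.+1) _ _ _ cvg_x (@exprn_continuous R k.+1 1)).
by apply/funext => n; rewrite -IS// opprB addrC subrK mulrC mulKf.
Qed.

Let mdens k (D : set mR) : measurable D -> measurable_fun D (EFin \o dens k).
Proof.
move=> mD; apply/measurable_EFinP/measurable_funTS/measurable_funM; first exact: measurable_funX.
by apply: (measurableT_comp (measurable_powR _)); exact: measurable_funB.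
Qed.

Let integral_dens k : (\int[lam]_(u in `[0%R, 1%R]) (dens k u)%:E = (v k)%:E)%E.
Proof.
(* Without the endpoint 1, a null set, the interval is the increasing union of the [0, x_ n]. *)
rewrite -integral_itv_bndo_bndc; last exact: mdens.
have -> : `[0, 1[%classic = \bigcup_n `[0, x_ n]%classic :> set R.
  apply/seteqP; split => u /=; last first.
    by move=> [n _] /=; rewrite !in_itv/= => /andP[-> /le_lt_trans]; apply.
  rewrite in_itv/= => /andP[u0 u1].
  have : \forall n \near \oo, u < x_ n by apply: (cvgr_gt _ cvg_x).
  by move=> [n _ /(_ n (leqnn n))] un; exists n => //=; rewrite in_itv/= u0 ltW.
have lim : (\int[lam]_(u in `[0%R, x_ n]) (dens k u)%:E @[n --> \oo] -->
    \int[lam]_(u in \bigcup_n `[0%R, x_ n]%classic) (dens k u)%:E)%E.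
  apply: ge0_nondecreasing_set_cvg_integral => //.
  - apply/nondecreasing_seqP => n; apply/subsetPset => u /=; rewrite !in_itv/= => /andP[-> ux].
    rewrite (le_trans ux)// /x_ lerB// lef_pV2 ?posrE ?ltr0n// ler_nat//.
  - by move=> n; exact: mdens.
  - move=> n u /=; rewrite in_itv/= => /andP[u0 _].
    by rewrite lee_fin mulr_ge0 ?powR_ge0// exprn_ge0.
have lim2 : (\int[lam]_(u in `[0%R, x_ n]) (dens k u)%:E @[n --> \oo] --> (v k)%:E)%E.
  rewrite (_ : (fun n => _) = (fun n => (I k (x_ n))%:E)).
    by apply/cvg_EFin; [exact: nearW|exact: cvg_I].
  by apply/funext => n; rewrite /I /Rintegral fineK//; apply: integrable_fin_num => //; exact: int_dens.
exact: (cvg_unique _ lim lim2).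
Qed.

(** For b = 2 nu - 1 the first two factors are the constant of [bergman_param], which is thus the
    inverse of a complete Beta integral. *)
Lemma incbeta1 k : b * rbinom (b + 1) k * incbeta 1 k.+1 b = 1.
Proof.
rewrite /incbeta expr1n /Rintegral /= integral_dens/= /v mulfV//.
by rewrite mulf_neq0// gt_eqF.
Qed.

Lemma incbeta_ge0 (r : R) k : 0 <= incbeta r k.+1 b.
Proof.
apply: Rintegral_ge0 => u /=; rewrite in_itv/= => /andP[u0 _].
by rewrite mulr_ge0 ?powR_ge0// exprn_ge0.
Qed.

Lemma incbeta_le1 (r : R) k : 0 < r -> r < 1 -> incbeta r k.+1 b <= incbeta 1 k.+1 b.
Proof.
move=> r0 r1; have r21 : r ^+ 2 < 1 by rewrite expr_lt1// ltW.
rewrite /incbeta /Rintegral expr1n /= fine_le//.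
- by apply: integrable_fin_num => //; exact: int_dens.
- by rewrite integral_dens.
- apply: ge0_subset_integral => //.
  + exact: mdens.
  + move=> u /=; rewrite in_itv/= => /andP[u0 _].
    by rewrite lee_fin mulr_ge0 ?powR_ge0// exprn_ge0.
  + by move=> u /=; rewrite !in_itv/= => /andP[-> ur]; rewrite (le_trans ur)// ltW.
Qed.

End complete_beta.

(** * Independent Bernoulli variables from a uniform one *)

Section bernoulli_digits.
Context {R : realType}.
Local Notation lam := (@lebesgue_measure R).
Local Notation mR := (measurableTypeR R).
Local Notation Q := (uniform_prob (@ltr01 R)).

(** Half-open, because [0, p[ and [p, 1[ partition [0, 1[ and each is carried by [rescale] exactly
    onto [0, 1[. *)
Lemma uniform01E (A : set mR) : measurable A -> Q A = lam (A `&` `[0, 1[).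
Proof.
move=> mA; rewrite /uniform_prob integral_uniform_pdf.
have mi : measurable (`[0, 1[%classic : set mR) by exact: measurable_itv.
have mi1 : measurable (`[0, 1]%classic : set mR) by exact: measurable_itv.
have -> : A `&` `[0, 1]%classic = (A `&` `[0, 1[%classic) `|` (A `&` [set 1]).
  rewrite -setIUr; congr (_ `&` _); apply/seteqP; split => x /=; rewrite !in_itv/=.
    by move=> /andP[-> ]; rewrite le_eqVlt => /predU1P[->|->]; [right|left].
  by move=> [/andP[-> /ltW]//|->]; rewrite ler01 lexx.
rewrite (eq_integral (cst 1%E)) => [|x]; last first.
  rewrite inE /uniform_pdf => -[[_ /=]|[_ ->]]; last by rewrite ler01 lexx/= subr0 invr1.
  by rewrite in_itv/= => /andP[-> /ltW ->]; rewrite subr0 invr1.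
rewrite integral_cst/=; last by apply: measurableU; apply: measurableI.
rewrite mul1e measureU0//; [exact: measurableI|exact: measurableI|].
apply/eqP; rewrite eq_le measure_ge0 andbT -(lebesgue_measure_set1 (1 : R)).
by apply: le_measure; rewrite ?inE//; exact: measurableI.
Qed.

Definition rescale (p u : R) : R := if u < p then u / p else (u - p) / (1 - p).

Lemma measurable_rescale p : measurable_fun [set: mR] (rescale p : mR -> mR).
Proof.
apply: measurable_fun_if => //; first exact: measurable_fun_ltr.
  by apply: measurable_funTS; exact: measurable_funM.
by apply: measurable_funTS; apply: measurable_funM => //; exact: measurable_funB.
Qed.

Definition digit_set (p : R) (b : bool) (A : set mR) : set mR :=
  [set u | (u < p) = b /\ A (rescale p u)].

Lemma measurable_digit_set p b A : measurable A -> measurable (digit_set p b A).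
Proof.
move=> mA; apply: measurableI; last first.
  by rewrite -[X in measurable X]setTI; exact: measurable_rescale.
rewrite -[X in measurable X]setTI.
have : measurable_fun [set: mR] (fun u : mR => u < p) by exact: measurable_fun_ltr.
by move=> /(_ measurableT [set b]); apply.
Qed.

(** Each branch of [rescale] is affine from an interval of length p or 1 - p onto [0, 1[: given the
    digit, the remainder is again uniform. *)
Lemma uniform01_digit_set (p : R) b A : 0 <= p -> p <= 1 -> measurable A ->
  Q (digit_set p b A) = ((if b then p else 1 - p)%:E * Q A)%E.
Proof.
move=> p0 p1 mA; rewrite !uniform01E//; last exact: measurable_digit_set.
have mi : measurable (`[0, 1[%classic : set mR) by exact: measurable_itv.
have mAi : measurable (A `&` `[0, 1[) by exact: measurableI.
have mS : measurable (digit_set p b A `&` `[0, 1[).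
  by apply: measurableI => //; exact: measurable_digit_set.
case: b mS => mS.
  (* An empty branch is treated apart, as [rescale] would divide by 0 there; likewise p = 1
     below. *)
  have [pe|pn] := eqVneq p 0.
    rewrite pe mul0e (_ : _ `&` _ = set0) ?measure0//.
    apply/seteqP; split => // u [[/= up _]]; rewrite in_itv/= => /andP[u0 _].
    by have := le_lt_trans u0 up; rewrite ltxx.
  have pp : 0 < p by rewrite lt_def pn.
  rewrite (lebesgue_measure_affine 0 pp mS); congr (_ * lam _)%E.
  apply/seteqP; split => u /=; rewrite addr0 /digit_set/= /rescale !in_itv/= => -[].
    move=> [up]; rewrite up mulrAC divff// mul1r => Au /andP[pu0 _]; split => //.
    by move: pu0 up; rewrite pmulr_rge0// => -> /=; rewrite gtr_pMr.
  move=> Au /andP[u0 u1]; have up : p * u < p by rewrite gtr_pMr.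
  by rewrite up mulrAC divff// mul1r mulr_ge0//= (lt_le_trans up).
have [pe|pn] := eqVneq p 1.
  rewrite pe subrr mul0e (_ : _ `&` _ = set0) ?measure0//.
  by apply/seteqP; split => // u [[/= up _]]; rewrite in_itv/= up andbF.
have pp : 0 < 1 - p by rewrite subr_gt0 lt_def eq_sym pn.
have pp0 : 1 - p != 0 by rewrite gt_eqF.
rewrite (lebesgue_measure_affine p pp mS); congr (_ * lam _)%E.
have e u : ((1 - p) * u + p - p) / (1 - p) = u by rewrite addrK mulrAC divff// mul1r.
apply/seteqP; split => u /=; rewrite /digit_set/= /rescale !in_itv/= => -[].
  move=> [up]; rewrite up e => Au /andP[_ h]; split => //.
  move: up => /negbT; rewrite -leNgt lerDr pmulr_rge0// => ->/=.
  by move: h; rewrite -ltrBrDr gtr_pMr.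
move=> Au /andP[u0 u1]; have up : ((1 - p) * u + p < p) = false.
  by apply/negbTE; rewrite -leNgt lerDr mulr_ge0// ltW.
rewrite up e; split => //; apply/andP; split.
  by rewrite addr_ge0// mulr_ge0// ltW.
by rewrite -ltrBrDr gtr_pMr.
Qed.

Variables (p : nat -> R) (p01 : forall j, 0 <= p j <= 1).

(* The successive remainders of the expansion of [u] with varying digit laws;
   under the uniform law, each is uniform and independent of the previous digits. *)
Fixpoint remainder (j : nat) (u : mR) : mR :=
  if j is j'.+1 then rescale (p j') (remainder j' u) else u.

Definition digit (j : nat) (u : mR) : bool := remainder j u < p j.

Lemma measurable_remainder j : measurable_fun [set: mR] (remainder j).
Proof.
elim: j => [|j ih]; first exact: measurable_id.
exact: (measurableT_comp (measurable_rescale _) ih).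
Qed.

Lemma measurable_digit j : measurable_fun [set: mR] (digit j).
Proof. by apply: measurable_fun_ltr => //; exact: measurable_remainder. Qed.

HB.instance Definition _ j := isMeasurableFun.Build _ _ _ _ (digit j) (measurable_digit j).

(** The indicator of A makes the induction work: digit M and the next remainder are functions of
    [remainder M u], so splitting on that digit gives two instances at M, with A replaced by a
    [digit_set]. Arbitrary weights h cover both cylinder events and generating functions. *)
Lemma integral_digits M (h : nat -> bool -> R) (A : set mR) :
  (forall j b, 0 <= h j b) -> measurable A ->
  (\int[Q]_u ((\prod_(j < M) h j (digit j u)) * \1_A (remainder M u))%:E =
   (\prod_(j < M) (p j * h j true + (1 - p j) * h j false))%:E * Q A)%E.
Proof.
move=> h0; elim: M A => [|M ih] A mA.
  under eq_integral do rewrite big_ord0 mul1r.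
  by rewrite big_ord0 mul1e integral_indic// setIT.
have mh b B : measurable B -> measurable_fun [set: mR]
    (fun u => ((\prod_(j < M) h j (digit j u)) * \1_B (remainder M u))%:E).
  move=> mB; apply/measurable_EFinP/measurable_funM.
    apply: measurable_prod => j _.
    by apply: (measurableT_comp _ (measurable_digit j)).
  by apply: (measurableT_comp _ (measurable_remainder M)); exact: measurable_indic.
have h0' B u : (0 <= ((\prod_(j < M) h j (digit j u)) * \1_B (remainder M u))%:E)%E.
  by rewrite lee_fin mulr_ge0// prodr_ge0.
transitivity (\int[Q]_u
   ((h M true)%:E * ((\prod_(j < M) h j (digit j u)) * \1_(digit_set (p M) true A) (remainder M u))%:E +
    (h M false)%:E * ((\prod_(j < M) h j (digit j u)) * \1_(digit_set (p M) false A) (remainder M u))%:E))%E.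
  apply: eq_integral => u _; rewrite -!EFinM -EFinD; congr EFin.
  rewrite big_ord_recr/=.
  have -> : \1_A (rescale (p M) (remainder M u)) = \1_(digit_set (p M) (digit M u) A) (remainder M u) :> R.
    rewrite !indicE; congr (_%:R); congr nat_of_bool; apply/idP/idP; rewrite !inE/= /digit_set/=.
      by move=> Au; split.
    by case.
  (* Only the branch labelled by the actual digit contributes. *)
  have z b : b != digit M u -> \1_(digit_set (p M) b A) (remainder M u) = 0 :> R.
    move=> bn; rewrite indicE memNset// /digit_set/= => -[e _].
    by move: bn; rewrite /digit e eqxx.
  by case: (digit M u) z => z; [rewrite (z false)//|rewrite (z true)//]; ring.
rewrite ge0_integralD//; last 4 first.
- by move=> u _; apply: mule_ge0; [rewrite lee_fin|exact: h0'].
- by apply: measurable_funeM; apply: mh => //; exact: measurable_digit_set.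
- by move=> u _; apply: mule_ge0; [rewrite lee_fin|exact: h0'].
- by apply: measurable_funeM; apply: mh => //; exact: measurable_digit_set.
have [/andP[pM0 pM1]] := p01 M.
rewrite !ge0_integralZl ?lee_fin//; try by apply: mh => //; exact: measurable_digit_set.
rewrite !ih; try exact: measurable_digit_set.
rewrite !uniform01_digit_set// big_ord_recr/=.
have /fineK <- : Q A \is a fin_num by exact: fin_num_measure.
by rewrite -!EFinM -EFinD; congr EFin; ring.
Qed.

End bernoulli_digits.

Section digit_laws.
Context {R : realType}.
Local Notation mR := (measurableTypeR R).
Local Notation Q := (uniform_prob (@ltr01 R)).
Variables (p : nat -> R) (p01 : forall j, 0 <= p j <= 1).

Let digit_weight (B : nat -> set bool) j : R :=
  p j * \1_(B j) true + (1 - p j) * \1_(B j) false.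

Lemma digits_cylinder (s : seq nat) (B : nat -> set bool) : uniq s ->
  (Q (\bigcap_(j in [set` s]) (digit p j @^-1` B j)) =
   (\prod_(j <- s) digit_weight B j)%:E)%E.
Proof.
move=> us; set M := (\max_(j <- s) j).+1.
have sM j : j \in s -> (j < M)%N by move=> js; rewrite ltnS; exact: leq_bigmax_seq.
(* Indices outside s get weight 1, and their factors are p j + (1 - p j) = 1. *)
pose h j b : R := if j \in s then \1_(B j) b else 1.
have h0 j b : 0 <= h j b by rewrite /h; case: ifP.
have := integral_digits p01 M h0 (@measurableT _ mR).
rewrite probability_setT mule1.
have -> : \prod_(j < M) (p j * h j true + (1 - p j) * h j false) =
    \prod_(j <- s) digit_weight B j.
  rewrite -(big_mkord xpredT (fun j => p j * h j true + (1 - p j) * h j false)).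
  rewrite (bigID (mem s))/= [X in _ * X]big1 ?mulr1 => [|j js]; last first.
    by rewrite /h (negbTE js) !mulr1 addrC subrK.
  rewrite -big_filter; have sp : perm_eq [seq j <- index_iota 0 M | j \in s] s.
    apply: uniq_perm => //; first by rewrite filter_uniq// iota_uniq.
    move=> j; rewrite mem_filter mem_index_iota /=; case: (boolP (j \in s)) => //= js.
    exact: sM.
  rewrite (perm_big _ sp)/= !big_seq; apply: eq_bigr => j js.
  by rewrite /h js.
move=> <-.
have mI : measurable (\bigcap_(j in [set` s]) (digit p j @^-1` B j) : set mR).
  rewrite bigcap_seq; apply: big_ind => [|A A' mA mA'|j _] //; first exact: measurableI.
  by rewrite -[X in measurable X]setTI; exact: measurable_digit.
transitivity (\int[Q]_u (\1_(\bigcap_(j in [set` s]) (digit p j @^-1` B j)) u)%:E)%E.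
  by rewrite integral_indic// setIT.
apply: eq_integral => u _; congr EFin; rewrite indicT mulr1.
rewrite indicE; case: (boolP (u \in _)) => [|/negP]; rewrite inE/= => us'.
  rewrite big1// => j _; rewrite /h; case: ifP => // js.
  by rewrite indicE mem_set//; exact: us'.
have [j js nj] : exists2 j, j \in s & ~ B j (digit p j u).
  apply: contrapT => /forall2NP nex; apply: us' => j /= js.
  by have [//|/contrapT] := nex j.
by rewrite (bigD1 (Ordinal (sM _ js)))//= /h js indicE memNset// mul0r.
Qed.

Lemma digits_independent (J : set nat) : mutually_independent Q J (fun j => digit p j).
Proof.
move=> s B us _ mB; apply: (etrans (digits_cylinder B us)).
rewrite -prodEFin; apply: eq_bigr => j _.
have := @digits_cylinder [:: j] B isT; rewrite big_seq1 => <-; congr (Q _).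
apply/seteqP; split => u /= h; first by apply: (h j); rewrite /= inE.
by move=> i /=; rewrite inE => /eqP ->.
Qed.

Lemma digit_true j : Q [set u | digit p j u = true] = (p j)%:E.
Proof.
have := @digits_cylinder [:: j] (fun=> [set true]) isT.
rewrite big_seq1 /digit_weight !indicE mem_set// memNset// mulr1 mulr0 addr0 => <-.
congr (Q _); apply/seteqP; split => u /= h; first by move=> i /=; rewrite inE => /eqP ->.
by apply: (h j); rewrite /= inE.
Qed.

(** The count starts at 1, as the series in the theorem does: digit 0 is drawn first but not
    counted. *)
Definition digit_count M (u : mR) : nat := (\sum_(1 <= j < M.+1) digit p j u)%N.

Let mdigit j (f : bool -> R) : measurable_fun [set: mR] (fun u => f (digit p j u)).
Proof.
by apply: (@measurableT_comp _ _ _ _ _ _ f _ (digit p j)) => //; exact: measurable_digit.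
Qed.

Lemma measurable_expn_digit_count M (q : R) :
  measurable_fun [set: mR] (fun u => (q ^+ digit_count M u)%:E).
Proof.
apply/measurable_EFinP.
rewrite (_ : (fun u => _) = (fun u => \prod_(j < M) q ^+ digit p j.+1 u)).
  by apply: measurable_prod => j _; exact: (mdigit j.+1 (fun b : bool => q ^+ b)).
apply/funext => u; rewrite /digit_count big_add1 big_mkord.
by elim/big_rec2 : _ => [|j x y _ <-]; [rewrite expr0|rewrite exprD].
Qed.

Lemma pgf_digit_count M (q : R) : 0 <= q ->
  (\int[Q]_u (q ^+ digit_count M u)%:E = (\prod_(1 <= j < M.+1) (1 + (q - 1) * p j))%:E)%E.
Proof.
(* Weight 1 at index 0 makes the uncounted digit integrate to 1. *)
move=> q0; pose h j (b : bool) : R := if j == 0%N then 1 else q ^+ b.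
have h0 j b : 0 <= h j b by rewrite /h; case: ifP => // _; rewrite exprn_ge0.
have := integral_digits p01 M.+1 h0 (@measurableT _ mR).
rewrite probability_setT mule1.
rewrite big_ord_recl/= {1 2}/h /= !mulr1 [p _ + _]addrC subrK mul1r => hM.
transitivity (\prod_(j < M) (p (lift ord0 j) * h (lift ord0 j) true + (1 - p (lift ord0 j)) * h (lift ord0 j) false))%:E.
  rewrite -hM; apply: eq_integral => u _; congr EFin; rewrite indicT mulr1.
  rewrite big_ord_recl/= mul1r /digit_count big_add1 big_mkord.
  elim/big_rec2 : _ => [|j x y _ <-]; first by rewrite expr0.
  by rewrite exprD.
congr EFin; rewrite big_add1 big_mkord; apply: eq_bigr => j _.
by rewrite /h /= expr1 expr0; ring.
Qed.

Variables (sigma : R) (psigma : forall M, \sum_(1 <= j < M.+1) p j <= sigma).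

(** Extended real, because infinitely many digits may be 1 on a null set. *)
Definition digit_sum (u : mR) : \bar R := (\sum_(1 <= j <oo) (digit p j u)%:R%:E)%E.

Let cvg_digit_sum u : (digit_count M u)%:R%:E @[M --> \oo] --> digit_sum u.
Proof.
have c : cvgn (fun n => \sum_(1 <= j < n) ((digit p j u)%:R%:E : \bar R))%E.
  by apply: is_cvg_nneseries => n _ _; rewrite lee_fin.
move: c; rewrite -(cvg_shiftS (fun n => \sum_(1 <= j < n) ((digit p j u)%:R%:E : \bar R))%E).
apply: cvg_trans; rewrite (_ : (fun M => _) = (fun M => \sum_(1 <= j < M.+1) (digit p j u)%:R%:E)%E)//.
by apply/funext => M; rewrite /digit_count natr_sum sumEFin.
Qed.

Let c M (u : mR) : \bar R := (digit_count M u)%:R%:E.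

Let cE M u : c M u = (\sum_(1 <= j < M.+1) (digit p j u)%:R%:E)%E.
Proof. by rewrite /c /digit_count natr_sum sumEFin. Qed.

Let mc M : measurable_fun [set: mR] (c M).
Proof.
rewrite (_ : c M = fun u => \sum_(1 <= j < M.+1) (digit p j u)%:R%:E)%E; last first.
  by apply/funext => u; exact: cE.
apply: emeasurable_sum => j.
by apply/measurable_EFinP; exact: (mdigit j (fun b : bool => b%:R)).
Qed.

Lemma measurable_digit_sum : measurable_fun [set: mR] digit_sum.
Proof.
have cu u : [set: mR] u -> c ^~ u @ \oo --> digit_sum u by move=> _; exact: cvg_digit_sum.
exact: (emeasurable_fun_cvg _ _ mc cu).
Qed.

Let digit_count_nd u : nondecreasing_seq (digit_count ^~ u).
Proof.
by apply/nondecreasing_seqP => M; rewrite /digit_count [leRHS]big_nat_recr//= leEnat leq_addr.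
Qed.

Let integral_c M : (\int[Q]_u c M u = (\sum_(1 <= j < M.+1) p j)%:E)%E.
Proof.
under eq_integral do rewrite cE.
rewrite ge0_integral_sum//; last first.
  by move=> j; apply/measurable_EFinP; exact: (mdigit j (fun b : bool => b%:R)).
rewrite -sumEFin; apply: eq_bigr => j _; rewrite -digit_true.
transitivity (\int[Q]_u (\1_[set u | digit p j u = true] u)%:E)%E; last first.
  rewrite integral_indic// ?setIT//.
  by rewrite -[X in measurable X]setTI; exact: (@measurable_digit R p j measurableT [set true]).
apply: eq_integral => u _; rewrite indicE.
by have -> : (u \in [set u | digit p j u = true]) = digit p j u by apply/idP/idP; rewrite inE.
Qed.

Let integral_digit_sum_lty : (\int[Q]_u digit_sum u < +oo)%E.
Proof.
have E u : digit_sum u = limn (c ^~ u) by rewrite (cvg_lim _ (@cvg_digit_sum u)).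
under eq_integral do rewrite E.
rewrite monotone_convergence//; last 2 first.
- by move=> M u _; rewrite lee_fin.
- by move=> u _ m n mn; rewrite lee_fin ler_nat -leEnat digit_count_nd.
apply: (@le_lt_trans _ _ sigma%:E); last exact: ltry.
apply: lime_le; last by apply: nearW => M; rewrite integral_c lee_fin.
apply: ereal_nondecreasing_is_cvgn => m n mn; rewrite !integral_c lee_fin.
rewrite [leRHS](big_cat_nat _ (n := m.+1))//= lerDl; apply: sumr_ge0 => j _.
by have /andP[] := p01 j.
Qed.

(** By monotone convergence the expectation of the sum is at most [sigma], and an integrable
    function is finite almost everywhere. *)
Lemma digit_sum_fin : {ae Q, forall u, digit_sum u \is a fin_num}.
Proof.
have : Q.-integrable setT digit_sum.
  apply/integrableP; split; first exact: measurable_digit_sum.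
  under eq_integral do rewrite gee0_abs ?nneseries_ge0//.
  exact: integral_digit_sum_lty.
by move=> iS; have := integrable_ae measurableT iS; apply: filterS => u; exact.
Qed.

(** Where the sum is infinite, [fine] gives the default value 0. *)
Definition digit_total (u : mR) : nat := Num.truncn (fine (digit_sum u)).

(** A bounded nondecreasing sequence of integers is stationary, at its maximum. *)
Let digit_count_eventually u : digit_sum u \is a fin_num ->
  \forall M \near \oo, digit_count M u = digit_total u.
Proof.
move=> fS.
have le M : (digit_count M u)%:R <= fine (digit_sum u).
  rewrite -lee_fin fineK// -(cvg_lim _ (@cvg_digit_sum u))//; apply: lime_ge.
    exact: cvgP (@cvg_digit_sum u).
  by exists M => // n /= Mn; rewrite lee_fin ler_nat -leEnat digit_count_nd.
have bnd k : `[< exists M, digit_count M u = k >] -> (k <= digit_total u)%N.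
  move=> /asboolP[M <-]; rewrite /digit_total truncn_ge_nat//.
  by rewrite (le_trans _ (le 0%N)).
have ex : exists k, `[< exists M, digit_count M u = k >].
  by exists (digit_count 0 u); apply/asboolP; exists 0%N.
case: (ex_maxnP ex bnd) => k /asboolP[M0 M0k] kmax.
have ev M : (M0 <= M)%N -> digit_count M u = k.
  move=> M0M; apply/eqP; rewrite eqn_leq kmax; last by apply/asboolP; exists M.
  by rewrite -M0k -leEnat digit_count_nd.
have -> : digit_total u = k.
  have cS : c M u @[M --> \oo] --> (k%:R%:E : \bar R).
    by apply: cvg_near_cst; exists M0 => // M /= /ev; rewrite /c => ->.
  rewrite /digit_total; have -> : digit_sum u = k%:R%:E.
    have cD : c ^~ u @ \oo --> digit_sum u := @cvg_digit_sum u.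
    by rewrite -(cvg_lim _ cD)// (cvg_lim _ cS).
  by rewrite /= natrK.
by exists M0 => // M /= /ev.
Qed.

Lemma digit_sumE u : digit_sum u \is a fin_num -> digit_sum u = (digit_total u)%:R%:E.
Proof.
move=> fS; have ev := digit_count_eventually fS.
rewrite -(cvg_lim _ (@cvg_digit_sum u))//; apply/cvg_lim => //.
by apply: cvg_near_cst; apply: filterS ev => M ->.
Qed.

Lemma measurable_digit_total k : measurable [set u | digit_total u = k].
Proof.
have mt : measurable_fun [set: R] (fun x : R => (Num.truncn x)%:R : R).
  by apply: nondecreasing_measurable => // x y xy; rewrite ler_nat le_truncn.
have mf : measurable_fun [set: mR] (fun u => fine (digit_sum u)).
  exact: (measurableT_comp (@fine_measurable _ setT measurableT) measurable_digit_sum).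
have := measurableT_comp mt mf measurableT (measurable_set1 (k%:R : R)).
rewrite setTI; congr measurable; apply/seteqP; split => u /=.
  by move=> /eqP; rewrite eqr_nat => /eqP.
by rewrite /digit_total => ->.
Qed.

Lemma pgf_digit_total (q : R) : 0 <= q -> q < 1 ->
  (\prod_(1 <= j < M.+1) (1 + (q - 1) * p j))%:E @[M --> \oo] -->
  (\int[Q]_u (q ^+ digit_total u)%:E)%E.
Proof.
move=> q0 q1.
have mq : measurable_fun [set: mR] (fun u => (q ^+ digit_total u)%:E).
  move=> _ B mB; rewrite setTI.
  rewrite (_ : _ @^-1` _ = \bigcup_(k in [set k | B (q ^+ k)%:E]) [set u | digit_total u = k]).
    by apply: bigcup_measurable => k _; exact: measurable_digit_total.
  by apply/seteqP; split => u /= h; [exists (digit_total u)|case: h => k Bk ->].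
have cq : {ae Q, forall u, [set: mR] u ->
    (q ^+ digit_count M u)%:E @[M --> \oo] --> (q ^+ digit_total u)%:E}.
  apply: filterS digit_sum_fin => u fS _; apply: cvg_near_cst.
  by apply: filterS (digit_count_eventually fS) => M ->.
have i1 : Q.-integrable [set: mR] (cst 1%E) by exact: finite_measure_integrable_cst.
have b1 u M : [set: mR] u -> (`|(q ^+ digit_count M u)%:E| <= cst 1 u)%E.
  by move=> _; rewrite lee_fin ger0_norm ?exprn_ge0// exprn_ile1// ltW.
have [_ _ lim] := @dominated_convergence _ _ _ Q setT measurableT
  (fun M u => (q ^+ digit_count M u)%:E) (fun u => (q ^+ digit_total u)%:E) (cst 1%E)
  (fun M => measurable_expn_digit_count M q) mq cq i1 (aeW _ b1).
rewrite (_ : (fun M => _) = (fun M => \int[Q]_u (q ^+ digit_count M u)%:E)%E)//.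
by apply/funext => M; rewrite pgf_digit_count.
Qed.

End digit_laws.

(** * Laws on the natural numbers *)

Section power_series_uniqueness.
Context {R : realType}.

(* No analyticity is needed: the coefficients of the difference vanish one after
   the other, dividing by [q ^+ m] and letting [q] tend to 0. *)
Lemma power_series_eq (a b : nat -> R) :

  (forall n, 0 <= a n <= 1) -> (forall n, 0 <= b n <= 1) ->
  (forall q, 0 < q < 1 -> \sum_(n < L) (a n - b n) * q ^+ n @[L --> \oo] --> (0 : R)) ->
  a = b.
Proof.
move=> a01 b01 ab; pose c n := a n - b n.
have c1 n : `|c n| <= 1.
  by have /andP[? ?] := a01 n; have /andP[? ?] := b01 n; rewrite ler_norml /c; apply/andP; split; lra.
suff c0 m : c m = 0.
  by apply/funext => n; apply/eqP; rewrite -subr_eq0; apply/eqP; exact: c0.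
elim/ltn_ind : m => m ih.
(* The coefficients before m vanish by induction and those after it are at most 1 in absolute value,
   so term m is bounded by a geometric tail. *)
have h q : 0 < q -> q < 1 -> `|c m| * q ^+ m <= q ^+ m.+1 / (1 - q).
  move=> q0 q1; have q1' : 0 < 1 - q by rewrite subr_gt0.
  apply/ler_addgt0Pr => e e0.
  have /ab/cvgr0_norm_le/(_ e e0) : 0 < q < 1 by rewrite q0.
  move=> [L0 _ /(_ (maxn L0 m.+1) (leq_maxl _ _))]/=; set L := maxn _ _ => hL.
  have mL : (m.+1 <= L)%N by exact: leq_maxr.
  have E : \sum_(n < L) (a n - b n) * q ^+ n = c m * q ^+ m + \sum_(m.+1 <= n < L) c n * q ^+ n.
    rewrite -(big_mkord xpredT (fun n => (a n - b n) * q ^+ n)) (big_cat_nat _ (n := m.+1))//=.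
    congr (_ + _); rewrite big_nat_recr//= big_nat_cond big1 ?add0r// => n /andP[/andP[_ nm] _].
    by have := ih _ nm; rewrite /c => ->; rewrite mul0r.
  have geo : \sum_(m.+1 <= n < L) q ^+ n <= q ^+ m.+1 / (1 - q).
    rewrite ler_pdivlMr// mulr_suml.
    under eq_bigr do rewrite mulrBr mulr1 -exprSr -opprB.
    rewrite sumrN telescope_sumr// opprB lerBlDr lerDl exprn_ge0// ltW//.
  have -> : `|c m| * q ^+ m = `|c m * q ^+ m| by rewrite normrM (ger0_norm (exprn_ge0 _ (ltW q0))).
  have -> : c m * q ^+ m = \sum_(n < L) (a n - b n) * q ^+ n - \sum_(m.+1 <= n < L) c n * q ^+ n.
    by rewrite E addrK.
  rewrite (le_trans (ler_normB _ _))// addrC lerD//.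
  apply: le_trans geo; rewrite (le_trans (ler_norm_sum _ _ _))//.
  apply: ler_sum => n _; rewrite normrM (ger0_norm (exprn_ge0 _ (ltW q0))).
  by rewrite ler_piMl// exprn_ge0// ltW.
apply/eqP; rewrite -normr_le0; apply/ler_addgt0Pr => e e0; rewrite add0r.
(* Chosen so that q / (1 - q) = e. *)
pose q := e / (1 + e); have e1 : 0 < 1 + e by rewrite addr_gt0.
have q0 : 0 < q by rewrite divr_gt0.
have q1 : q < 1 by rewrite ltr_pdivrMr// mul1r ltrDr.
have := h q q0 q1; rewrite exprSr -mulrA mulrC ler_pM2l ?exprn_gt0//.
rewrite (_ : q / (1 - q) = e)//.
have -> : 1 - q = (1 + e)^-1 by rewrite /q; field; rewrite gt_eqF.
by rewrite invrK /q divfK// gt_eqF.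
Qed.

End power_series_uniqueness.

Section nat_valued_law.
Context {R : realType} d (T : measurableType d) (P : probability T R).
Variables (N : T -> nat) (mN : forall k, measurable [set x | N x = k]).

Let mset (B : set nat) : measurable [set x | B (N x)].
Proof.
rewrite (_ : [set x | _] = \bigcup_(k in B) [set x | N x = k]).
  by apply: bigcup_measurable.
by apply/seteqP; split => [x Bx|x [k Bk /= ->]//]; exists (N x).
Qed.

Let mfun (f : nat -> \bar R) : measurable_fun setT (fun x => f (N x)).
Proof. by move=> _ B mB; rewrite setTI; exact: (mset (f @^-1` B)). Qed.

Lemma nat_law_set (B : set nat) :
  (P [set x | B (N x)] = \sum_(k <oo | k \in B) P [set x | N x = k])%E.
Proof.
rewrite (_ : [set x | _] = \bigcup_(k in B) [set x | N x = k]); last first.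
  by apply/seteqP; split => [x Bx|x [k Bk /= ->]//]; exists (N x).
rewrite measure_bigcup//; apply/trivIsetP => i j _ _ ij.
apply/seteqP; split => // x [/= Ni Nj].
by move: ij; rewrite -Ni -Nj eqxx.
Qed.

(** q^N is the sum of q^k over the events N = k; nonnegativity allows termwise integration. *)
Lemma cvg_pgf (q : R) : 0 <= q -> q < 1 ->
  \sum_(k < L) fine (P [set x | N x = k]) * q ^+ k @[L --> \oo] -->
  fine (\int[P]_x (q ^+ N x)%:E)%E.
Proof.
move=> q0 q1.
have fin : (\int[P]_x (q ^+ N x)%:E \is a fin_num)%E.
  rewrite ge0_fin_numE; last by apply: integral_ge0 => x _; rewrite lee_fin exprn_ge0.
  apply: (@le_lt_trans _ _ (\int[P]_x (cst 1%E) x)%E); last first.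
    by rewrite integral_cst// mul1e (le_lt_trans (probability_le1 _ _))// ltry.
  apply: ge0_le_integral => //.
  - by move=> x _; rewrite lee_fin exprn_ge0.
  - exact: (mfun (fun k => (q ^+ k)%:E)).
  - by move=> x _; rewrite lee_fin exprn_ile1// ltW.
have m1 k : measurable_fun setT (fun x => (\1_[set x | N x = k] x : R)%:E).
  by apply/measurable_EFinP; apply: measurable_indic; exact: mN.
have E : (\int[P]_x (q ^+ N x)%:E =
    \sum_(0 <= k <oo) (fine (P [set x | N x = k]) * q ^+ k)%:E)%E.
  transitivity (\int[P]_x (\sum_(0 <= k <oo) ((q ^+ k)%:E * (\1_[set x | N x = k] x)%:E)))%E.
    apply: eq_integral => x _.
    have : (\sum_(0 <= k < L) ((q ^+ k)%:E * (\1_[set x | N x = k] x)%:E) @[L --> \oo] --> (q ^+ N x)%:E)%E.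
      apply: cvg_near_cst; near=> L.
      have NL : (N x < L)%N by near: L; exists (N x).+1.
      rewrite big_mkord (bigD1 (Ordinal NL))//= indicE mem_set// mule1 big1 ?adde0// => i iN.
      rewrite indicE memNset ?mule0// => /= Ni; move/eqP : iN; apply.
      by apply/val_inj; rewrite /= Ni.
    by move/cvg_lim => <-.
  rewrite integral_nneseries//; last 2 first.
  - by move=> k; apply: measurable_funeM; exact: m1.
  - by move=> k x _; rewrite mule_ge0// lee_fin ?exprn_ge0.
  apply: eq_eseriesr => k _.
  rewrite ge0_integralZl//; last by rewrite lee_fin exprn_ge0.
  rewrite integral_indic// setIT EFinM muleC fineK//.
  exact: fin_num_measure.
have u0 k : (0%N <= k)%N -> true -> (0 <= (fine (P [set x | N x = k]) * q ^+ k)%:E)%E.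
  by move=> _ _; rewrite lee_fin mulr_ge0 ?fine_ge0// exprn_ge0.
have : ((\sum_(k < L) fine (P [set x | N x = k]) * q ^+ k)%:E @[L --> \oo] -->
    (fine (\int[P]_x (q ^+ N x)%:E))%:E)%E.
  rewrite fineK// E (_ : (fun L => _) =
    (fun L => \sum_(0 <= k < L) (fine (P [set x | N x = k]) * q ^+ k)%:E)%E).
    exact: is_cvg_nneseries u0.
  by apply/funext => L; rewrite sumEFin big_mkord.
by move/fine_cvg.
Unshelve. all: by end_near. Qed.

End nat_valued_law.

Lemma nat_law_eq {R : realType} d1 (T1 : measurableType d1) (P1 : probability T1 R)
    d2 (T2 : measurableType d2) (P2 : probability T2 R) (N1 : T1 -> nat) (N2 : T2 -> nat) :
  (forall k, measurable [set x | N1 x = k]) ->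
  (forall k, measurable [set x | N2 x = k]) ->
  (forall q : R, 0 < q < 1 ->
    (\int[P1]_x (q ^+ N1 x)%:E = \int[P2]_x (q ^+ N2 x)%:E)%E) ->
  forall B : set nat, P1 [set x | B (N1 x)] = P2 [set x | B (N2 x)].
Proof.
move=> mN1 mN2 pgf B; rewrite !nat_law_set//; apply: eq_eseriesr => k _.
pose a k := fine (P1 [set x | N1 x = k]); pose b k := fine (P2 [set x | N2 x = k]).
have ab : a = b.
  apply: power_series_eq => [n|n|q /andP[q0 q1]].
  - by rewrite fine_ge0//= -lee_fin fineK ?fin_num_measure// probability_le1.
  - by rewrite fine_ge0//= -lee_fin fineK ?fin_num_measure// probability_le1.
  have := cvgB (@cvg_pgf _ _ _ P1 _ mN1 _ (ltW q0) q1) (@cvg_pgf _ _ _ P2 _ mN2 _ (ltW q0) q1).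
  rewrite pgf ?q0// subrr => h.
  rewrite (_ : (fun L => _) =
    (fun L => \sum_(n < L) a n * q ^+ n - \sum_(n < L) b n * q ^+ n)); first exact: h.
  by apply/funext => L; rewrite -sumrB; apply: eq_bigr => n _; rewrite mulrBl.
have := congr1 (@^~ k) ab; rewrite /a /b => abk.
by rewrite -[LHS]fineK ?fin_num_measure// abk fineK// fin_num_measure.
Qed.

(** * Bernoulli parameters and the law of the number of points *)

Section bernoulli_parameters.
Context {R : realType}.
Variables (nu r : R) (nu12 : 1 / 2 < nu) (r0 : 0 < r) (r1 : r < 1).

Let b0 : 0 < 2 * nu - 1.
Proof. by move: nu12; lra. Qed.

Let paramE k : bergman_param nu r k.+1 =
  (2 * nu - 1) * rbinom (2 * nu) k * incbeta r k.+1 (2 * nu - 1).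
Proof. by []. Qed.

Lemma bergman_param_ratio k : bergman_param nu r k.+1 =
  incbeta r k.+1 (2 * nu - 1) / incbeta 1 k.+1 (2 * nu - 1).
Proof.
have := incbeta1 b0 k; rewrite subrK paramE => h.
have i0 : incbeta 1 k.+1 (2 * nu - 1) != 0.
  by apply: contra_eq_neq h => ->; rewrite mulr0 eq_sym oner_neq0.
by apply: (mulIf i0); rewrite divfK// -[LHS]mulrA [_ * incbeta 1 _ _]mulrC [LHS]mulrA h mul1r.
Qed.

Lemma bergman_param01 j : 0 <= bergman_param nu r j <= 1.
Proof.
(* The parameter depends on j only through [j.-1], so index 0 repeats index 1. *)
have -> : bergman_param nu r j = bergman_param nu r j.-1.+1 by [].
rewrite bergman_param_ratio; set k := j.-1.
have i1 : 0 < incbeta 1 k.+1 (2 * nu - 1).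
  rewrite lt_neqAle incbeta_ge0 andbT eq_sym.
  by apply: contra_eq_neq (incbeta1 b0 k) => ->; rewrite mulr0 eq_sym oner_neq0.
by rewrite divr_ge0 ?incbeta_ge0//= ler_pdivrMr// mul1r incbeta_le1.
Qed.

End bernoulli_parameters.

Section particle_number.
Context {R : realType}.
Variables (nu r : R) (nu12 : 1 / 2 < nu) (r0 : 0 < r) (r1 : r < 1).
Variable P : probability (config_space (disc (1 : R))) R.
Hypothesis detP : is_determinantal (bergman_measure nu) (bergman_kernel nu) P.

Local Notation p := (fun k => bergman_param nu r k.+1).
Local Notation N := (npoints (disc r)).

Let p0 j : 0 <= p j.
Proof. by have /andP[] := bergman_param01 nu12 r0 r1 j.+1. Qed.

(** Applied to the indicator of D_r^n, the determinantal identity equates the factorial moment with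
    the limit of n! times the elementary symmetric functions; both are then divided by n!. *)
Lemma binomial_moment n : exists2 e : R,
  elem_sym p n M @[M --> \oo] --> e &
  (\int[P]_X ('C(N X, n)%:R)%:E = e%:E)%E.
Proof.
have nf0 : n`!%:R != 0 :> R by rewrite pnatr_eq0 -lt0n fact_gt0.
(* [is_determinantal] speaks of n > 0 only; for n = 0 both sides are 1. *)
case: n nf0 => [|n] nf0.
  exists 1; first by under eq_fun do rewrite elem_sym0; exact: cvg_cst.
  under eq_integral do rewrite bin0.
  by rewrite integral_cst//= mul1e probability_setT.
have [[iP _] eqP] := detP (ltn0Sn n) (test_function_disc r0 r1 n.+1).
have cv := @cvg_correlation R nu r nu12 r0 r1 n.+1.
move: iP eqP cv; set K := cintegral (tuple_measure _ _) _ _ => iP eqP cv.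
have ffE (X : config (disc (1 : R))) : complex.Re (multi_sum (@disc_test R r n.+1) X) = (N X ^_ n.+1)%:R.
  by rewrite multi_sum_disc// -(rmorph_nat (real_complex R)).
have EP : (\int[P]_X ((N X ^_ n.+1)%:R)%:E = (complex.Re K)%:E)%E.
  rewrite -eqP /= /Rintegral fineK; last exact: integrable_fin_num.
  by apply: eq_integral => X _; rewrite ffE.
exists (complex.Re K / n.+1`!%:R).
  rewrite (_ : elem_sym p n.+1 = fun M => inj_sum p n.+1 M / n.+1`!%:R); first exact: cvgMl.
  by apply/funext => M; rewrite inj_sum_elem_sym mulrAC mulfV ?mul1r.
rewrite EFinM -EP -ge0_integralZr//.
- by apply: eq_integral => X _; rewrite -EFinM -bin_ffact natrM mulfK.
- exact: (measurable_fun_npoints r0 r1 (fun k => ((k ^_ n.+1)%:R)%:E)).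
Qed.

Lemma particle_number_pgf (s : R) :
  (\int[P]_X ((1 + s) ^+ N X)%:E = (limn (fun M => \prod_(j < M) (1 + s * p j)))%:E)%E /\
  cvgn (fun M => \prod_(j < M) (1 + s * p j)).
Proof.
have /choice[e he] n : exists e : R, elem_sym p n M @[M --> \oo] --> e /\
    (\int[P]_X ('C(N X, n)%:R)%:E = e%:E)%E.
  by have [e] := binomial_moment n; exists e.
exact: (cvg_prod_expectation p0 (measurable_fun_npoints r0 r1)
  (fun n => (he n).1) (fun n => (he n).2)).
Qed.

(** The partial sums increase to the first moment of N_r, which is finite. *)
Lemma sum_bergman_param_le : exists sigma : R,
  forall M, \sum_(1 <= j < M.+1) bergman_param nu r j <= sigma.
Proof.
have [e ce _] := binomial_moment 1; exists e => M.
rewrite big_add1 big_mkord -(elem_sym1 p) -(cvg_lim _ ce)//.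
by apply: nondecreasing_cvgn_le; [exact: elem_sym_nd|exact: cvgP ce].
Qed.

End particle_number.

Theorem theorem2 (R : realType) (nu r : R)
    (P : probability (config_space (disc (1 : R))) R) :
  1 / 2 < nu -> 0 < r -> r < 1 ->
  is_determinantal (bergman_measure nu) (bergman_kernel nu) P ->
  (forall s : R, -1 < s -> s < 1 ->
     let partial_prod n :=
       \prod_(1 <= j < n.+1) (1 + s * bergman_param nu r j) in
     cvgn partial_prod /\
     ('E_P[fun X => ((1 + s) ^+ npoints (disc r) X)%R])%E = (limn partial_prod)%:E) /\
  exists (d : measure_display) (Omega : measurableType d)
         (Q : probability Omega R) (X : nat -> {mfun Omega >-> bool}),
    [/\ mutually_independent Q [set j | (1 <= j)%N] X,
        forall j, (1 <= j)%N ->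
          Q [set w | X j w = true] = (bergman_param nu r j)%:E /\
          bergman_param nu r j =
            incbeta r j (2 * nu - 1) / incbeta 1 j (2 * nu - 1) &
        forall B : set (\bar R), measurable B ->
          P [set Z | B (npoints (disc r) Z)%:R%:E] =
          Q [set w | B (\sum_(1 <= j <oo) (X j w)%:R%:E)%E]].
Proof.
move=> nu12 r0 r1 detP; set N := npoints (disc r).
have prodE s : (fun n => \prod_(1 <= j < n.+1) (1 + s * bergman_param nu r j)) =
    (fun n => \prod_(j < n) (1 + s * bergman_param nu r j.+1)).
  by apply/funext => n; rewrite big_add1 big_mkord.
have pgfN := particle_number_pgf nu12 r0 r1 detP.
split=> [s _ _|].
  rewrite /= prodE; have [Es cs] := pgfN s.
  by split => //; rewrite unlock.
have p01 := bergman_param01 nu12 r0 r1.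
have [sigma psigma] := sum_bergman_param_le nu12 r0 r1 detP.
pose Q := uniform_prob (@ltr01 R).
pose S := digit_total (bergman_param nu r).
have mS k : measurable [set u | S u = k] by exact: measurable_digit_total.
exists _, (measurableTypeR R), Q, (fun j => digit (bergman_param nu r) j); split.
- exact: digits_independent.
- move=> [//|j] _; split; first exact: digit_true.
  exact: bergman_param_ratio.
move=> B mB.
(* With s = q - 1, both generating functions are the limit of the same finite products. *)
have pgfE q : 0 < q < 1 ->
    (\int[P]_X (q ^+ N X)%:E = \int[Q]_u (q ^+ S u)%:E)%E.
  move=> /andP[q0 q1]; have [Eq cq] := pgfN (q - 1).
  rewrite addrC subrK in Eq; rewrite Eq.
  have := pgf_digit_total p01 psigma (ltW q0) q1.
  rewrite -prodE => /cvg_lim <-//.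
  by rewrite EFin_lim// prodE.
have -> : P [set Z | B (N Z)%:R%:E] = Q [set u | B (S u)%:R%:E].
  exact: (nat_law_eq (measurable_npoints r0 r1) mS pgfE [set k | B k%:R%:E]).
have mSB : measurable [set u | B (S u)%:R%:E].
  rewrite (_ : [set u | _] = \bigcup_(k in [set k | B k%:R%:E]) [set u | S u = k]).
    by apply: bigcup_measurable => k _; exact: mS.
  by apply/seteqP; split => u /= h; [exists (S u)|case: h => k Bk ->].
have mDB : measurable [set u | B (digit_sum (bergman_param nu r) u)].
  by rewrite -[X in measurable X]setTI; exact: measurable_digit_sum.
have QE (A : set (measurableTypeR R)) : measurable A -> Q A = (\int[Q]_u (\1_A u)%:E)%E.
  by move=> mA; rewrite integral_indic// setIT.
(* The extended-real sum equals the natural number [S] only almost everywhere, so the two events are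
   compared through the integrals of their indicators. *)
rewrite (QE _ mSB) [RHS](QE _ mDB); apply: ae_eq_integral => //.
- by apply/measurable_EFinP; exact: measurable_indic.
- by apply/measurable_EFinP; exact: measurable_indic.
apply: filterS (digit_sum_fin p01 psigma) => u fu _.
congr EFin; rewrite !indicE; congr ((_ : bool)%:R); apply: asbool_equiv_eq.
by rewrite /= -digit_sumE.
Qed.
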